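(* Let $p\ge 1$ (a real number). (i) For all functions $f\in L^p(\mathbb T)$ and all $\beta\in[0,1/p]$, $$\dim_{\mathcal P}\big(\mathcal E^+_{\rm FS}(\beta,f)\big)\le 1-\beta p .$$ (ii) There exists a function $f\in L^p(\mathbb T)$ such that, for all $\beta\in[0,1/p]$, $$\dim_{\mathcal H}\big(E_{\rm FS}(\beta,f)\big)=\dim_{\mathcal P}\big(E_{\rm FS}(\beta,f)\big)=1-\beta p .$$ In particular, $\dim_{\mathcal P}\big(E^+_{\rm FS}(\beta,f)\big)=1-\beta p$ for all $\beta\in[0,1/p]$.
   Context: $\mathbb T=\mathbb R/\mathbb Z$; functions are complex-valued; $S_nf(x)=\sum_{|k|\le n}\hat f(k)e^{2\pi i kx}$ is the $n$-th partial sum of the Fourier series of $f$. $\dim_{\mathcal H}$ and $\dim_{\mathcal P}$ denote Hausdorff and packing dimension (the empty set has dimension $0$), and $\log 0=-\infty$. For $x\in\mathbb T$, $\beta^-_{\rm FS}(x)$ is the infimum of the real numbers $\beta$ such that $S_nf(x)=O(n^\beta)$, i.e. $\beta^-_{\rm FS}(x)=\limsup_{n\to+\infty}\frac{\log|S_nf(x)|}{\log n}$, and $\beta^+_{\rm FS}(x)$ is the supremum of the real numbers $\beta$ such that $n^\beta=O(S_nf(x))$, i.e. $\beta^+_{\rm FS}(x)=\liminf_{n\to+\infty}\frac{\log|S_nf(x)|}{\log n}$. For $\beta\ge0$, $$\mathcal E^+_{\rm FS}(\beta,f)=\{x\in\mathbb T:\ \beta^+_{\rm FS}(x)\ge\beta\},\qquad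 E^+_{\rm FS}(\beta,f)=\{x\in\mathbb T:\ \beta^+_{\rm FS}(x)=\beta\},$$ $$E_{\rm FS}(\beta,f)=\{x\in\mathbb T:\ \beta^+_{\rm FS}(x)=\beta^-_{\rm FS}(x)=\beta\}=\Big\{x\in\mathbb T:\ \lim_{n\to+\infty}\tfrac{\log|S_nf(x)|}{\log n}=\beta\Big\}.$$ *)

(* Defs.v *)
From HB Require Import structures.
From mathcomp Require Import all_boot all_order all_algebra.
From mathcomp Require Import all_classical all_reals all_analysis.
From mathcomp Require Import complex.
Set Implicit Arguments.
Unset Strict Implicit.
Unset Printing Implicit Defensive.
Import Order.TTheory GRing.Theory Num.Theory.
Import numFieldNormedType.Exports.

Local Open Scope classical_set_scope.
Local Open Scope ring_scope.
Local Open Scope quotient_scope.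
Local Open Scope complex_scope.

Section dimensions.
Context (R : realType) (M : metricType R).
Implicit Types (E : set M) (s delta : R).

(* [0] is adjoined so that the diameter of the empty set is 0 and not -oo. *)
Definition diam E : \bar R :=
  ereal_sup (0%E |` [set (mdist x y)%:E | x in E & y in E]).

(* Countable covers are indexed by sets of naturals; no term is contributed by
   an index outside I, so that the convention 0 `^ 0 = 1 of [poweR] yields the
   counting measure for s = 0. *)
Definition hausdorff_premeasure s delta E : \bar R := ereal_inf
  [set w | exists (I : set nat) (U : nat -> set M),
    [/\ E `<=` \bigcup_(i in I) U i,
        forall i, I i -> (diam (U i) <= delta%:E)%E &
        w = \esum_(i in I) poweR (diam (U i)) s]].

Definition hausdorff_measure s E : \bar R :=
  ereal_sup [set hausdorff_premeasure s delta E | delta in [set d | 0 < d]].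

Definition hausdorff_dim E : \bar R :=
  ereal_inf [set s%:E | s in [set s | 0 <= s /\ hausdorff_measure s E = 0%E]].

Definition mclosed_ball (x : M) (r : R) : set M := [set y | mdist x y <= r].

(* A packing is a countable set of pairs (center, radius). The size of a ball
   of radius r is taken to be 2 r, as on the real line; in a general metric
   space its diameter can be smaller. *)
Definition packing_premeasure s delta E : \bar R := ereal_sup
  [set w | exists P : set (M * R),
    [/\ countable P,
        forall b, P b -> E b.1 /\ 0 < b.2 <= delta,
        trivIset P (fun b => mclosed_ball b.1 b.2) &
        w = \esum_(b in P) ((2 * b.2) `^ s)%:E]].

Definition packing_content s E : \bar R :=
  ereal_inf [set packing_premeasure s delta E | delta in [set d | 0 < d]].

(* [packing_content] is not countably subadditive. *)
Definition packing_measure s E : \bar R := ereal_inf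
  [set w | exists F : nat -> set M,
    E `<=` \bigcup_i F i /\ w = (\sum_(i <oo) packing_content s (F i))%E].

Definition packing_dim E : \bar R :=
  ereal_inf [set s%:E | s in [set s | 0 <= s /\ packing_measure s E = 0%E]].

End dimensions.

(* The predicate of [Num.int], as an additive subgroup of R. *)
Definition int_subgroup (R : realType) : zmodClosed R :=
  (@Num.int_num_subdef R : {pred R}).

Definition torus (R : realType) : Type := Quotient.quot (int_subgroup R).

Section torus_metric.
Context (R : realType).
Local Notation T := (torus R).

HB.instance Definition _ := GRing.Zmodule.on T.
HB.instance Definition _ := EqQuotient.on T.

Definition dist_int (t : R) : R := inf [set `|t - k%:~R| | k in [set: int]].

Definition torus_dist (x y : T) : R := dist_int (repr x - repr y).

Let lbnd (t : R) : has_lbound [set `|t - k%:~R| | k in [set: int]].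
Proof. by exists 0 => _ [k _ <-]. Qed.

Let hinf (t : R) : has_inf [set `|t - k%:~R| | k in [set: int]].
Proof. by split; [exists `|t - 0%:~R|, 0|exact: lbnd]. Qed.

Lemma dist_int_le (t : R) (k : int) : dist_int t <= `|t - k%:~R|.
Proof. by apply: ge_inf; [exact: lbnd|exists k]. Qed.

Lemma dist_int_ge0 (t : R) : 0 <= dist_int t.
Proof. by apply: lb_le_inf; [case: (hinf t)|move=> _ [k _ <-]]. Qed.

Lemma dist_int_approx (t e : R) : 0 < e ->
  exists k : int, `|t - k%:~R| < dist_int t + e.
Proof. by move=> /(inf_adherent)/(_ (hinf t))[_ [k _ <-] h]; exists k. Qed.

Lemma dist_intN (t : R) : dist_int (- t) = dist_int t.
Proof.
suff H u : dist_int u <= dist_int (- u).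
  by apply/eqP; rewrite eq_le H andbT -{2}[t]opprK H.
apply/ler_addgt0Pr => e /(dist_int_approx (- u))[k /ltW]; apply: le_trans.
rewrite (le_trans (dist_int_le u (- k)))//.
by rewrite mulrNz opprK -normrN opprD.
Qed.

Lemma dist_intD (t u : R) : dist_int (t + u) <= dist_int t + dist_int u.
Proof.
apply/ler_addgt0Pr => e e0; have e2 : 0 < e / 2 by rewrite divr_gt0.
have [k hk] := dist_int_approx t e2; have [l hl] := dist_int_approx u e2.
apply: le_trans (dist_int_le _ (k + l)) _.
rewrite intrD opprD addrACA (le_trans (ler_normD _ _))//.
rewrite [leRHS](_ : _ = dist_int t + e / 2 + (dist_int u + e / 2)).
  by rewrite lerD ?ltW.
by rewrite addrACA -splitr.
Qed.

Lemma dist_int_eq0 (t : R) : dist_int t = 0 -> t \is a Num.int.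
Proof.
move=> t0.
have [k] := @dist_int_approx t 2^-1 ltac:(by rewrite invr_gt0).
rewrite t0 add0r => hk.
have [/eqP|tk] := eqVneq (t - k%:~R) 0.
  by rewrite subr_eq0 => /eqP ->; exact: intr_int.
have tk0 : 0 < Num.min `|t - k%:~R| 2^-1.
  by rewrite lt_min normr_gt0 tk invr_gt0 ltr0n.
have [l] := dist_int_approx t tk0; rewrite t0 add0r lt_min => /andP[h1 h2].
have : `|(k - l)%:~R| < 1 :> R.
  rewrite intrD mulrNz (_ : _ - _ = (t - l%:~R) - (t - k%:~R)); last first.
    by rewrite opprB [RHS]addrC addrA subrK.
  by rewrite (le_lt_trans (ler_normB _ _))// [ltRHS](splitr 1) mul1r ltrD.
rewrite -intr_norm ltrz1 -[X in (_ < X)%R]add0r ltzD1 normr_le0 subr_eq0 => /eqP kl.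
by move: h1; rewrite kl ltxx.
Qed.

Let torus_distxx x : torus_dist x x = 0.
Proof.
apply/eqP; rewrite /torus_dist eq_le dist_int_ge0 andbT subrr.
by rewrite (le_trans (dist_int_le _ 0))// subrr normr0.
Qed.

Let torus_dist_eq0 x y : torus_dist x y = 0 -> x = y.
Proof.
move=> /dist_int_eq0 h; rewrite -[x]reprK -[y]reprK; apply/eqP.
by rewrite -Quotient.idealrBE.
Qed.

Let torus_dist_sym x y : torus_dist x y = torus_dist y x.
Proof. by rewrite /torus_dist -dist_intN opprB. Qed.

Let torus_dist_triangle y x z :
  torus_dist x z <= torus_dist x y + torus_dist y z.
Proof.
rewrite /torus_dist (le_trans _ (dist_intD _ _))//.
by rewrite addrA subrK.
Qed.

HB.instance Definition _ := @isMetric.Build R T torus_dist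
  torus_distxx torus_dist_eq0 torus_dist_sym torus_dist_triangle.

End torus_metric.

Section fourier.
Context (R : realType).
Local Notation T := (torus R).
Local Notation mu := (@lebesgue_measure R).
Implicit Types (f : T -> R[i]) (p beta : R) (x : T).

Definition to_torus (t : R) : T := \pi_T t.

(* \int_T |f|^p < oo, integration over T being integration of the lift to the
   line over [0, 1]. *)
Definition Lp p f : Prop :=
  [/\ measurable_fun (`[0, 1] : set R) (fun t => complex.Re (f (to_torus t))),
      measurable_fun (`[0, 1] : set R) (fun t => complex.Im (f (to_torus t))) &
      (\int[mu]_(t in `[0%R, 1%R]) (Normc.normc (f (to_torus t)) `^ p)%:E < +oo)%E].

Definition Cintegral (D : set R) (g : R -> R[i]) : R[i] :=
  (\int[mu]_(t in D) complex.Re (g t)) +i* (\int[mu]_(t in D) complex.Im (g t)).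

(* e^(2 i pi t) *)
Definition expi2pi (t : R) : R[i] := cos (2 * pi * t) +i* sin (2 * pi * t).

Definition fourier_coef f (k : int) : R[i] :=
  Cintegral `[0, 1] (fun t => f (to_torus t) * expi2pi (- (k%:~R * t))).

(* [expi2pi] being 1-periodic, the choice of the representative of x is
   irrelevant; j - n ranges over the integers k such that |k| <= n. *)
Definition fourier_sum f (n : nat) x : R[i] :=
  \sum_(0 <= j < (2 * n).+1)
    fourier_coef f (j%:Z - n%:Z) * expi2pi ((j%:Z - n%:Z)%:~R * repr x).

(* [lne] is the logarithm with lne 0 = -oo. *)
Definition log_ratio f x (n : nat) : \bar R :=
  (lne (Normc.normc (fourier_sum f n x))%:E / (ln n%:R)%:E)%E.

Definition beta_minus f x : \bar R := limn_esup (log_ratio f x).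
Definition beta_plus f x : \bar R := limn_einf (log_ratio f x).

Definition calE_plus beta f : set T := [set x | (beta%:E <= beta_plus f x)%E].
Definition E_plus beta f : set T := [set x | beta_plus f x = beta%:E].
Definition E_FS beta f : set T :=
  [set x | beta_plus f x = beta%:E /\ beta_minus f x = beta%:E].

End fourier.

(* Main.v *)
(* Upper bounds. For |k| <= n < 2^m the Dirichlet kernels D_n are dominated by a
   single dyadic envelope of integral O(m). If |S_n f| is at least lam, for some
   n of size 2^m, at points which are 2^-m-separated, splitting |f| at height
   c ~ lam/m and using |f| <= c + c^(1-p) |f|^p shows that there are only
   O(2^m m^p lam^-p) such points. With lam = 2^(m gamma) this is an entropy bound
   of exponent 1 - gamma p; it bounds the packing dimension of the sets where
   |S_n f| >= n^gamma for all large n, and the Hausdorff dimension of the set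
   where this happens infinitely often.

   Sharpness. Stages s occupy about s^3 binary positions. For each rational
   theta in [0, 1], a proportion theta of the positions of every stage is
   reserved, and the Riesz product over the positions reserved so far, rescaled
   to norm 1 in L^p, is added to f at every stage with subexponential weights.
   If the reserved digits of x are zeros, all the cosines of the Riesz product
   are at least 1/2 at x, so its partial sums are nonnegative at x and, from
   n = 2^(stage start) on, larger than half its maximum
   2^(theta (stage start)); hence |S_n f(x)| >= n^(theta/p - o(1)). The remaining
   digits of x are a parameter u in [0, 1), and u is a Hoelder function of x, of
   every exponent s < 1 - theta. So the Hausdorff or packing measure of order s
   vanishes only on sets of Lebesgue-null u. By the upper bound, the set of u
   with |S_n f(x)| >= n^gamma infinitely often is null for all
   gamma > beta = theta/p, hence almost every u gives a point of E_FS(beta, f).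
   For irrational theta the reserved positions of the rationals below theta
   are used. *)
Require Import Defs.
From mathcomp Require Import all_boot all_order all_algebra.
From mathcomp Require Import all_classical all_reals all_analysis.
From mathcomp Require Import complex archimedean measurable_realfun.
From mathcomp Require Import ring lra zify.
Set Implicit Arguments.
Unset Strict Implicit.
Unset Printing Implicit Defensive.
Import Order.TTheory GRing.Theory Num.Theory.
Import numFieldNormedType.Exports.

Local Open Scope classical_set_scope.
Local Open Scope ring_scope.


(** * Dirichlet kernels *)

Section trigonometry.
Context {R : realType}.
Implicit Types (t u x y : R).

(** One function has to serve all exponents. At a point made for theta, the Riesz products with
    larger parameters may have negative partial sums and cancel the growth. So the product of index
    j is multiplied by a square wave equal to 1 on one half of each period 2^-(stage_start j) and to
    0 on the other, and an address bit in every stage puts the point in the first half if the j-th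
    parameter is at most theta and in the second otherwise. This cut-off destroys the finite
    spectrum, but it leaves the product unchanged, or cancels it, near the point; by localization it
    costs a partial sum at most a constant depending on j only, uniformly in n and s. The amplitudes
    carry the inverse of this constant, and a constant 1 included in f outweighs the sum of all
    errors. The cubes are a compromise. A stage has O(s^2) positions and about s^3 positions precede
    it, so log n varies by a factor tending to 1 between two stage starts: all orders n are
    controlled, not only a subsequence. And stages are long enough for losses 2^-O(s) to be
    negligible against 2^(c s^3). *)

Lemma sin_ler x : 0 <= x -> sin x <= x.
Proof.
rewrite le_eqVlt => /predU1P[<-|x0]; first by rewrite sin0.
have [c _] : exists2 c, c \in `]0, x[ & sin x - sin 0 = cos c * (x - 0) :> R.
  apply: (@MVT R (@sin R) (@cos R)) => //.
  by apply: continuous_subspaceT => z; exact: continuous_sin.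
rewrite sin0 !subr0 => ->.
by rewrite -[leRHS]mul1r ler_wpM2r ?cos_le1 ?ltW.
Qed.

Lemma cos_ge_quadratic x : 1 - x ^+ 2 / 2 <= cos x.
Proof.
wlog x0 : x / 0 <= x.
  move=> h; have [|/ltW] := leP 0 x; first exact: h.
  by rewrite -oppr_ge0 => /h; rewrite cosN sqrrN.
have : cos ((x / 2) *+ 2) = 1 - (sin (x / 2)) ^+ 2 *+ 2.
  by rewrite cos_mulr2n cos2sin2; ring.
have -> : (x / 2) *+ 2 = x by rewrite -mulr_natr; field.
move=> ->.
have h2 : 0 <= x / 2 by rewrite divr_ge0.
have h1 : `|sin (x / 2)| <= x / 2.
  have := sin_ler h2; rewrite ler_norml => ->; rewrite andbT.
  have [xp|xp] := leP (x / 2) pi.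
    by rewrite (le_trans _ (sin_ge0_pi _)) ?oppr_le0// h2.
  have := sin_geN1 (x / 2); have := @pi_ge2 R; lra.
have : (sin (x / 2)) ^+ 2 <= (x / 2) ^+ 2.
  by rewrite -real_normK ?num_real// ler_sqr ?nnegrE.
by lra.
Qed.

Lemma cos_ge_half y : `|y| <= 1 -> 1 / 2 <= cos y.
Proof.
move=> y1; apply: le_trans (cos_ge_quadratic y).
have : y ^+ 2 <= 1 by rewrite -real_normK ?num_real// expr_le1.
by lra.
Qed.

(** A crude Jordan inequality: on [0, 1] the mean value theorem with cos >= 1/2 gives x / 2, and
    beyond 1 the sine stays above sin 1 >= 1/2 >= x / 4 because pi / 2 < 2. *)
Lemma sin_ge_fourth x : 0 <= x <= pi / 2 -> x / 4 <= sin x.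
Proof.
move=> /andP[x0 xp].
have small y : 0 <= y <= 1 -> y / 2 <= sin y.
  move=> /andP[]; rewrite le_eqVlt => /predU1P[<- _|y0 y1]; first by rewrite sin0 mul0r.
  have [c] : exists2 c, c \in `]0, y[ & sin y - sin 0 = cos c * (y - 0) :> R.
    apply: (@MVT R (@sin R) (@cos R)) => //.
    by apply: continuous_subspaceT => z; exact: continuous_sin.
  rewrite in_itv/= => /andP[c0 cy]; rewrite sin0 !subr0 => ->.
  rewrite mulrC ler_wpM2r//; first exact: ltW.
  rewrite -[leLHS]mul1r; apply: cos_ge_half.
  by rewrite ger0_norm ?ltW// (lt_le_trans cy).
have [x1|x1] := leP x 1; first by have := small x; lra.
have : sin 1 <= sin x.
  rewrite ltW// ltr_sin ?in_itv//=; have := @pi_ge2 R; lra.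
have := small 1; have := @pihalf_lt2 R; lra.
Qed.

End trigonometry.

Section dist_int.
Context {R : realType}.
Implicit Types (t u x y : R).

Lemma dist_intDz t (k : int) : dist_int (t + k%:~R) = dist_int t.
Proof.
have H u (l : int) : dist_int (u + l%:~R) <= dist_int u.
  apply/ler_addgt0Pr => e /(dist_int_approx u)[j /ltW]; apply: le_trans.
  rewrite (le_trans (dist_int_le _ (j + l)))// intrD opprD addrACA.
  by rewrite subrr addr0.
apply/eqP; rewrite eq_le H/= -{1}(addrK k%:~R t) -mulrNz; exact: H.
Qed.

Lemma dist_int_abs t : `|t| <= 1 / 2 -> dist_int t = `|t|.
Proof.
move=> t2; apply/eqP; rewrite eq_le; apply/andP; split.
  by have := dist_int_le t 0; rewrite subr0.
apply: lb_le_inf; first by exists `|t - 0%:~R|, 0.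
move=> _ [k _ <-].
have [->|k0] := eqVneq k 0; first by rewrite subr0.
have : 1 <= `|k%:~R : R|.
  by rewrite -intr_norm (_ : 1 = 1%:~R)// ler_int; lia.
have := ler_normD (k%:~R - t) t; rewrite subrK.
by rewrite (distrC k%:~R); lra.
Qed.

Lemma dist_int_near t : exists2 k : int, `|t - k%:~R| <= 1 / 2 & dist_int t = `|t - k%:~R|.
Proof.
exists (Num.floor (t + 1 / 2)).
  have /andP[] := real_floor_itv (num_real (t + 1 / 2)).
  by rewrite intrD ler_norml; lra.
set k := Num.floor _.
rewrite -(dist_intDz t (- k)) mulrNz dist_int_abs//.
have /andP[] := real_floor_itv (num_real (t + 1 / 2)).
by rewrite -/k intrD ler_norml; lra.
Qed.

Lemma dist_int_half t : dist_int t <= 1 / 2.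
Proof. by have [k kt ->] := dist_int_near t. Qed.

Lemma dist_int_norm t : dist_int t <= `|t|.
Proof. by have := dist_int_le t 0; rewrite subr0. Qed.

Lemma dist_int_int (t : R) : t \is a Num.int -> dist_int t = 0.
Proof.
move=> /intrP[k ->]; rewrite -[X in dist_int X]add0r dist_intDz.
by rewrite dist_int_abs normr0// ; lra.
Qed.

Lemma cos2piDz t (k : int) : cos (2 * pi * (t + k%:~R)) = cos (2 * pi * t).
Proof.
have pn u (n : nat) : cos (2 * pi * (u + n%:R)) = cos (2 * pi * u).
  rewrite mulrDr (_ : 2 * pi * n%:R = (pi *+ 2) *+ n); last first.
    by rewrite -[in RHS]mulr_natr -(mulr_natr pi); ring.
  exact: (periodicn (@cosD2pi R)).
case: k => n; first exact: pn.
by rewrite NegzE mulrNz -[in RHS](subrK n.+1%:R t) pn.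
Qed.

Lemma sinD2piz t (k : int) : sin (t + 2 * pi * k%:~R) = sin t.
Proof.
have pn u (n : nat) : sin (u + 2 * pi * n%:R) = sin u.
  rewrite (_ : 2 * pi * n%:R = (pi *+ 2) *+ n); last first.
    by rewrite -[in RHS]mulr_natr -(mulr_natr pi); ring.
  exact: (periodicn (@sinD2pi R)).
case: k => n; first exact: pn.
by rewrite NegzE mulrNz mulrN -[in RHS](subrK (2 * pi * n.+1%:R) t) pn.
Qed.

Lemma norm_sinpiDz t (k : int) : `|sin (pi * (t + k%:~R))| = `|sin (pi * t)|.
Proof.
have pn u (n : nat) : `|sin (pi * (u + n%:R))| = `|sin (pi * u)|.
  elim: n => [|n IH]; first by rewrite addr0.
  by rewrite -addn1 natrD addrA mulrDr mulr1 sinDpi normrN.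
case: k => n; first exact: pn.
by rewrite NegzE mulrNz -[in RHS](subrK n.+1%:R t) pn.
Qed.

Lemma sinpi_ge t : dist_int t / 2 <= `|sin (pi * t)|.
Proof.
have [k tk ->] := dist_int_near t.
rewrite -(norm_sinpiDz t (- k)) mulrNz; set u := t - _ in tk *.
have p2 := @pi_ge2 R.
have : `|sin (pi * u)| = `|sin (pi * `|u|)|.
  by case: (ger0P u) => // _; rewrite mulrN sinN normrN.
move=> ->; have u0 : 0 <= `|u| by [].
apply: le_trans (ler_norm _).
have pu : pi * `|u| <= pi * (1 / 2) by rewrite ler_wpM2l// pi_ge0.
have : 2 * `|u| <= pi * `|u| by rewrite ler_wpM2r.
have pu0 : 0 <= pi * `|u| by rewrite mulr_ge0// pi_ge0.
have := @sin_ge_fourth R (pi * `|u|); rewrite pu0/=.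
rewrite (_ : pi / 2 = pi * (1 / 2)); last by field.
by rewrite pu => /(_ isT); lra.
Qed.

Lemma cos2pi_dist t : cos (2 * pi * t) = cos (2 * pi * dist_int t).
Proof.
have [k tk ->] := dist_int_near t.
rewrite -(cos2piDz t (- k)) mulrNz.
by case: ger0P => // _; rewrite mulrN cosN.
Qed.

Lemma cos2pi_ge_half t : dist_int t <= 1 / 8 -> 1 / 2 <= cos (2 * pi * t).
Proof.
move=> t8; rewrite cos2pi_dist; apply: cos_ge_half.
have := @pihalf_lt2 R; have := dist_int_ge0 t; have := @pi_ge2 R => p2 d0 p4.
rewrite ger0_norm; last by rewrite !mulr_ge0//; lra.
have : pi * dist_int t <= pi * (1 / 8) by rewrite ler_wpM2l//; lra.
by rewrite -mulrA; lra.
Qed.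

End dist_int.

Section dirichlet_kernel.
Context {R : realType}.
Implicit Types (t u x y : R).

Definition dirichlet n u : R :=
  \sum_(0 <= j < (2 * n).+1) cos (2 * pi * ((j%:Z - n%:Z)%:~R * u)).

Lemma dirichletE n u :
  dirichlet n u = 1 + 2 * \sum_(1 <= j < n.+1) cos (2 * pi * (j%:R * u)).
Proof.
rewrite /dirichlet (@big_cat_nat _ _ _ n.+1)//=; last by lia.
rewrite [X in X + _](@big_cat_nat _ _ _ n)//= big_nat1.
rewrite subrr mul0r mulr0 cos0.
have -> : \sum_(0 <= j < n) cos (2 * pi * ((j%:Z - n%:Z)%:~R * u)) =
          \sum_(1 <= j < n.+1) cos (2 * pi * (j%:R * u)).
  rewrite big_nat_rev/= add0n big_add1/=; apply: eq_big_nat => i /= ni.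
  rewrite -[LHS]cosN; congr cos.
  rewrite (_ : (n - i.+1)%:Z - n%:Z = - (i.+1)%:Z); last by lia.
  by rewrite mulrNz; ring.
have -> : \sum_(n.+1 <= j < (2 * n).+1) cos (2 * pi * ((j%:Z - n%:Z)%:~R * u)) =
          \sum_(1 <= j < n.+1) cos (2 * pi * (j%:R * u)).
  rewrite -{1}(add0n n.+1) big_addn big_add1/= (_ : (_ - n.+1)%N = n); last by lia.
  apply: eq_big_nat => i _; congr (cos (_ * (_ * _))).
  by rewrite (_ : (i + n.+1)%:Z - n%:Z = i.+1%:Z)//; lia.
by ring.
Qed.

Lemma dirichlet_sin n u :
  sin (pi * u) * dirichlet n u = sin (pi * ((2 * n + 1)%:R * u)).
Proof.
rewrite dirichletE; elim: n => [|n].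
  by rewrite big_geq// mulr0 addr0 mulr1 muln0 add0n mul1r.
rewrite [in X in _ -> X]big_nat_recr//=; set S := bigop _ _ _ => IH.
rewrite (_ : _ * _ = sin (pi * u) * (1 + 2 * S) +
   2 * (sin (pi * u) * cos (2 * pi * (n.+1%:R * u)))); last by ring.
rewrite IH.
set a := 2 * pi * _.
rewrite (_ : pi * ((2 * n + 1)%:R * u) = a - pi * u); last first.
  by rewrite /a natrD natrM -addn1 natrD; ring.
rewrite (_ : pi * ((2 * n.+1 + 1)%:R * u) = a + pi * u); last first.
  by rewrite /a natrD natrM; ring.
by rewrite sinB sinD; ring.
Qed.

Lemma dirichlet_le n u : `|dirichlet n u| <= (2 * n + 1)%:R.
Proof.
rewrite (le_trans (ler_norm_sum _ _ _))//.
apply: (@le_trans _ _ (\sum_(0 <= j < (2 * n).+1) 1)).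
  by apply: ler_sum => i _; exact: cos_max.
by rewrite sumr_const_nat subn0 addn1.
Qed.

Lemma dirichlet_dist n u : `|dirichlet n u| * dist_int u <= 2.
Proof.
have h := sinpi_ge u.
have : `|sin (pi * u)| * `|dirichlet n u| <= 1.
  by rewrite -normrM dirichlet_sin sin_max.
have : dist_int u / 2 * `|dirichlet n u| <= `|sin (pi * u)| * `|dirichlet n u|.
  by rewrite ler_wpM2r.
by rewrite mulrC; lra.
Qed.

Lemma dirichletDz n u (k : int) : dirichlet n (u + k%:~R) = dirichlet n u.
Proof.
apply: eq_bigr => j _; rewrite [X in cos (_ * X)]mulrDr.
by rewrite -(intrM R); exact: cos2piDz.
Qed.

(* A positive multiple of the dyadic envelope of min(2^m, 1/|u|), which
   dominates all the Dirichlet kernels of order less than 2^m at once. *)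
Definition dyadic_kernel m u : R :=
  \sum_(0 <= j < m.+1) 2 ^+ j.+1 * (dist_int u <= 2 ^- j)%R%:R.

Lemma dyadic_kernel_ge0 m u : 0 <= dyadic_kernel m u.
Proof. by apply: sumr_ge0 => j _; rewrite mulr_ge0// exprn_ge0. Qed.

Lemma dyadic_kernel_ge m u j : (j <= m)%N -> dist_int u <= 2 ^- j ->
  2 ^+ j.+1 <= dyadic_kernel m u.
Proof.
move=> jm uj; rewrite /dyadic_kernel (@big_cat_nat _ _ _ j)//=; last by rewrite ltnW.
rewrite big_nat_recl//= uj mulr1 addrCA lerDl addr_ge0// sumr_ge0//.
Qed.

(** Within 2^-m of the integers the trivial bound 2 n + 1 <= 2^(m+1) suffices. Elsewhere the
    distance lies between 2^-(j+1) and 2^-j for some j < m, and the bound 2 / distance is absorbed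
    by the j-th indicator alone. *)
Lemma dirichlet_dyadic n m u : (n < 2 ^ m)%N ->
  `|dirichlet n u| <= 2 * dyadic_kernel m u.
Proof.
move=> nm.
have [um|um] := leP (dist_int u) (2 ^- m).
  rewrite (le_trans (dirichlet_le n u))//.
  have := dyadic_kernel_ge (leqnn m) um.
  have : ((2 * n + 1)%:R <= (2 ^ m.+1)%:R :> R).
    by rewrite ler_nat expnS; lia.
  by rewrite natrX; have := dyadic_kernel_ge0 m u; lra.
have [j [jm ju uj]] : exists j, [/\ (j < m)%N, 2 ^- j.+1 < dist_int u & dist_int u <= 2 ^- j].
  elim: m um {nm} => [|m IH] um.
    by have := dist_int_half u; rewrite expr0 invr1 in um; lra.
  have [um'|um'] := leP (dist_int u) (2 ^- m); first by exists m.
  by have [j [? ? ?]] := IH um'; exists j; split => //; exact: ltnW.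
have := dyadic_kernel_ge (ltnW jm) uj.
have := dirichlet_dist n u.
have d0 : 0 < dist_int u by rewrite (lt_trans _ ju)// invr_gt0 exprn_gt0.
rewrite -ler_pdivlMr// => h1 h2; rewrite (le_trans h1)// ler_wpM2l//.
rewrite (le_trans _ h2)// -[leRHS]invrK lef_pV2 ?posrE ?invr_gt0 ?exprn_gt0//.
exact: ltW.
Qed.

End dirichlet_kernel.

(** * Separated points with large kernel averages *)

Section counting.
Context {R : realType}.
Local Notation mu := (@lebesgue_measure R).
Implicit Types (t u x y r : R) (h : R -> R).

Lemma dist_int_continuous : continuous (@dist_int R).
Proof.
move=> x; apply/cvgrPdist_le => e e0; near=> y.
have H u v : dist_int u - dist_int v <= `|u - v|.
  have := dist_intD v (u - v); rewrite addrC subrK.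
  by have := dist_int_norm (u - v); lra.
have : `|x - y| <= e by near: y; exact: cvgr_dist_le.
have := H x y; have := H y x; rewrite distrC => h1 h2 h3.
by rewrite ler_norml; lra.
Unshelve. all: by end_near. Qed.

Lemma measurable_dist_int : measurable_fun [set: R] (@dist_int R).
Proof. exact: continuous_measurable_fun dist_int_continuous. Qed.

Lemma measurable_dist_intB x : measurable_fun [set: R] (fun t => dist_int (x - t)).
Proof.
apply: (measurableT_comp measurable_dist_int).
by apply: measurable_funB => //; exact: measurable_cst.
Qed.

Lemma measurable_dist_int_ball x r : measurable [set t | dist_int (x - t) <= r].
Proof.
rewrite (_ : [set t | _] = (fun t => dist_int (x - t)) @^-1` `]-oo, r]); last first.
  by apply/seteqP; split => t /=; rewrite in_itv.
by rewrite -[X in measurable X]setTI; apply: measurable_dist_intB.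
Qed.

Lemma dyadic_kernelE m x t : dyadic_kernel m (x - t) =
  \sum_(0 <= j < m.+1) 2 ^+ j.+1 * \1_[set t | dist_int (x - t) <= 2 ^- j] t.
Proof.
apply: eq_bigr => j _; congr (_ * _); rewrite indicE; congr (nat_of_bool _)%:R.
by apply/idP/idP => [?|]; [rewrite inE|rewrite inE].
Qed.

Lemma measurable_dyadic_kernel m x (D : set R) :
  measurable_fun D (fun t => dyadic_kernel m (x - t)).
Proof.
under eq_fun do rewrite dyadic_kernelE.
apply: measurable_sum => j; apply: measurable_funM => //.
by apply: measurable_indic; exact: measurable_dist_int_ball.
Qed.

(** After reduction of x to [0, 1), only its translates by -1, 0 and 1 can be nearest to a point of
    [0, 1]; hence three intervals of length 2 r. *)
Lemma lebesgue_dist_int_ball x r : 0 <= r ->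
  (mu ([set t | (dist_int (x - t) <= r)%R] `&` `[0%R, 1%R]) <= (6 * r)%:E)%E.
Proof.
move=> r0.
pose y := x - (Num.floor x)%:~R.
have /andP[y0 y1] : 0 <= y < 1.
  by have := real_floor_itv (num_real x); rewrite intrD /y; lra.
pose J k : set R := `[y + k - r, y + k + r]%classic.
have mJ k : measurable (J k) by exact: measurable_itv.
have sub : [set t | dist_int (x - t) <= r] `&` `[0, 1] `<=`
    J (- 1) `|` (J 0 `|` J 1).
  move=> t []/=; rewrite in_itv/= => + /andP[t0 t1].
  rewrite (_ : x - t = y - t + (Num.floor x)%:~R); last by rewrite /y; ring.
  rewrite dist_intDz; have [k k2 ->] := dist_int_near (y - t).
  move: k2; rewrite !ler_norml => /andP[k1 k2] /andP[k3 k4].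
  have : (-2)%:~R < k%:~R :> R /\ k%:~R < 2%:~R :> R by rewrite /=; lra.
  rewrite !ltr_int => -[kl ku].
  have : k = -1 \/ k = 0 \/ k = 1 by lia.
  case=> [ke|[ke|ke]]; rewrite {}ke in k3 k4; [right; right|right; left|left];
    by rewrite /J/= in_itv/=; lra.
have muJ k : mu (J k) = (2 * r)%:E.
  rewrite lebesgue_measure_itv/= lte_fin.
  case: ifPn => [_|]; first by rewrite -EFinB; congr EFin; ring.
  by rewrite -leNgt => ?; congr EFin; lra.
have mJ2 : measurable (J 0 `|` J 1) by exact: measurableU.
apply: (@le_trans _ _ (mu (J (- 1) `|` (J 0 `|` J 1)))).
  apply: le_measure => //; apply/mem_set; last by apply: measurableU; [exact: mJ|exact: mJ2].
  by apply: measurableI => //; exact: measurable_dist_int_ball.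
have U2 A B : measurable A -> measurable B -> (mu (A `|` B) <= mu A + mu B)%E.
  exact: measureU2.
apply: (le_trans (U2 _ _ (mJ _) mJ2)).
rewrite (_ : (6 * r)%:E = mu (J (- 1)%R) + (mu (J 0%R) + mu (J 1%R)))%E; last first.
  by rewrite !muJ -!EFinD; congr EFin; ring.
by apply: leeD2l; exact: (U2 _ _ (mJ _) (mJ _)).
Qed.

(** Every scale contributes the same amount, 2^(j+1) times 6 times 2^-j. The factor m + 1 is only
    logarithmic in the order n and will be absorbed by an arbitrarily small exponent. *)
Lemma integral_dyadic_kernel m x :
  (\int[mu]_(t in `[0%R, 1%R]) (dyadic_kernel m (x - t))%:E <=
   (12 * m.+1%:R)%:E)%E.
Proof.
under eq_integral do rewrite dyadic_kernelE -sumEFin.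
rewrite ge0_integral_sum; [|by []| |]; last 2 first.
- move=> j; apply/measurable_EFinP; apply: measurable_funM => //.
  by apply: measurable_indic; exact: measurable_dist_int_ball.
- by move=> j t _; rewrite lee_fin mulr_ge0// exprn_ge0.
apply: (@le_trans _ _ (\sum_(0 <= j < m.+1) 12%:E)%E).
  apply: lee_sum => j _; under eq_integral do rewrite EFinM.
  rewrite ge0_integralZl_EFin; [|by []| | |]; last 3 first.
  - by move=> t _; rewrite lee_fin.
  - by apply/measurable_EFinP; apply: measurable_indic; exact: measurable_dist_int_ball.
  - by rewrite exprn_ge0.
  rewrite integral_indic//; last exact: measurable_dist_int_ball.
  have e0 : 0 <= 2 ^- j :> R by rewrite invr_ge0 exprn_ge0.
  have e1 : (0 <= (2 ^+ j.+1)%:E :> \bar R)%E by rewrite lee_fin exprn_ge0.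
  apply: (le_trans (lee_wpmul2l e1 (lebesgue_dist_int_ball x e0))).
  rewrite -EFinM lee_fin exprS.
  have : (2 ^+ j : R) != 0 by rewrite expf_neq0.
  by move=> ?; rewrite (_ : _ * _ = 12)//; field.
by rewrite sumEFin lee_fin sumr_const_nat subn0 -[X in X <= _]mulr_natr.
Qed.

Section separated.
Variables (I : eqType) (g : I -> R) (s : seq I) (m : nat).
Hypothesis us : uniq s.
Hypothesis sep : {in s &, forall a b, a != b -> 2 ^- m < dist_int (g a - g b)}.

(** Pigeonhole: translated by the nearest integers [c a], the points fall in an interval of length 2
    * 2^-j around t, and each of its cells of length 2^-m, numbered by [h], holds at most one of
    them. *)
Lemma count_separated t j : (j <= m)%N ->
  (count (fun a => (dist_int (g a - t) <= 2 ^- j)%R) s <= 4 * 2 ^ (m - j))%N.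
Proof.
move=> jm; rewrite -size_filter; set s' := seq.filter _ _.
have us' : uniq s' by rewrite filter_uniq.
have /choice[c cP] : forall a, exists k : int,
    dist_int (g a - t) = `|g a - t - k%:~R|.
  by move=> a; have [k _] := dist_int_near (g a - t); exists k.
pose h a := Num.truncn ((g a - t - (c a)%:~R + 2 ^- j) * 2 ^+ m).
have e0 k : 0 < 2 ^+ k :> R by rewrite exprn_gt0.
have em : 2 ^- j * 2 ^+ m = 2 ^+ (m - j) :> R.
  by rewrite -{1}(subnKC jm) exprD mulrA mulVf ?mul1r// gt_eqF.
have hP a : a \in s' ->
    0 <= (g a - t - (c a)%:~R + 2 ^- j) * 2 ^+ m <= 2 * 2 ^+ (m - j).
  rewrite mem_filter cP ler_norml => /andP[/andP[h1 h2] _].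
  apply/andP; split; first by rewrite mulr_ge0 ?(ltW (e0 m))//; lra.
  by rewrite -em mulrA ler_wpM2r ?(ltW (e0 m))//; lra.
have sub : {subset map h s' <= iota 0 (2 * 2 ^ (m - j)).+1}.
  move=> _ /mapP[a /hP /andP[h1 h2] ->]; rewrite mem_iota/= add0n ltnS -(ler_nat R).
  by rewrite natrM natrX (le_trans _ h2)//; have /andP[] := truncn_itv h1.
have uh : uniq (map h s').
  rewrite map_inj_in_uniq// => a b as' bs' hab; apply/eqP/negPn/negP => ab.
  have mem d : d \in s' -> d \in s by rewrite mem_filter => /andP[].
  have := sep (mem _ as') (mem _ bs') ab.
  rewrite ltNge => /negP; apply.
  have /andP[a0 _] := hP _ as'; have /andP[b0 _] := hP _ bs'.
  have /andP[a1 a2] := truncn_itv a0; have /andP[b1 b2] := truncn_itv b0.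
  rewrite -/(h a) -/(h b) hab -addn1 natrD in a1 a2 b1 b2.
  rewrite -(dist_intDz _ (c b - c a)) (le_trans (dist_int_norm _))//.
  rewrite -[leRHS]div1r ler_pdivlMr ?e0//.
  rewrite -[X in _ * X](ger0_norm (ltW (e0 m))) -normrM ler_norml intrB.
  by apply/andP; split; lra.
have := uniq_leq_size uh sub; rewrite size_map size_iota => /leq_trans; apply.
by have := expn_gt0 2 (m - j); lia.
Qed.

(** Uniform in t and in the number of points: the integral of |f|^p is thus paid once for all the
    points together, instead of once for each. *)
Lemma sum_dyadic_kernel_separated t :
  \sum_(a <- s) dyadic_kernel m (g a - t) <= 8 * 2 ^+ m * m.+1%:R.
Proof.
rewrite /dyadic_kernel exchange_big/=.
apply: (@le_trans _ _ (\sum_(0 <= j < m.+1) 8 * 2 ^+ m)); last first.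
  by rewrite sumr_const_nat subn0 mulr_natr.
rewrite big_nat [leRHS]big_nat; apply: ler_sum => j /andP[_]; rewrite ltnS => jm.
rewrite -mulr_sumr -natr_sum.
rewrite (_ : (\sum_(a <- s) _)%N =
    count (fun a => (dist_int (g a - t) <= 2 ^- j)%R) s); last first.
  by rewrite -sum1_count [RHS]big_mkcond; apply: eq_bigr => a _; case: ifP.
have := count_separated t jm; rewrite -(ler_nat R) natrM natrX => h.
rewrite (_ : 8 * 2 ^+ m = 2 ^+ j.+1 * (4 * 2 ^+ (m - j))); last first.
  by rewrite -{1}(subnKC jm) exprD exprS; ring.
by rewrite ler_wpM2l ?exprn_ge0.
Qed.

Variables (h : R -> R) (p M lam : R).
Hypotheses (h0 : forall t, 0 <= h t) (p1 : 1 <= p) (lam0 : 0 < lam).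
Hypothesis mh : measurable_fun (`[0, 1]%classic : set R) h.
Hypothesis hM : (\int[mu]_(t in `[0%R, 1%R]) (h t `^ p)%:E <= M%:E)%E.
Hypothesis big_lam : {in s, forall a, (lam%:E <=
  \int[mu]_(t in `[0%R, 1%R]) (h t * dyadic_kernel m (g a - t))%:E)%E}.

(* With c = lam / (24 (m + 1)), the pointwise bound h <= c + c^(1-p) h^p splits
   off a part of h whose integral against each kernel is at most lam / 2. *)
Lemma size_separated_le :
  (size s)%:R <= 16 * 2 ^+ m * m.+1%:R * M * lam^-1 *
                 (lam / (24 * m.+1%:R)) `^ (1 - p).
Proof.
pose c := lam / (24 * m.+1%:R).
have c0 : 0 < c by rewrite divr_gt0// mulr_gt0.
pose d := c `^ (1 - p).
have d0 : 0 < d by rewrite powR_gt0.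
have young t : h t <= c + d * h t `^ p.
  have [hc|hc] := leP (h t) c; first by rewrite (le_trans hc)// lerDl mulr_ge0 ?powR_ge0// ltW.
  have ht0 : 0 < h t by rewrite (lt_trans c0).
  rewrite ler_wpDl ?(ltW c0)//.
  have q0 : 0 <= h t / c by rewrite divr_ge0 ?(ltW ht0) ?(ltW c0).
  rewrite -[X in _ * X `^ _](divfK (lt0r_neq0 c0)) (powRM p q0 (ltW c0)).
  rewrite mulrCA -powRD; last by rewrite (gt_eqF c0) implybT.
  rewrite subrK powRr1 ?(ltW c0)// -ler_pdivrMr//.
  rewrite -[leLHS](powRr1 q0).
  by rewrite ler_powR// ler_pdivlMr// mul1r ltW.
pose K t := \sum_(a <- s) dyadic_kernel m (g a - t).
have K0 u : 0 <= K u by apply: sumr_ge0 => a _; exact: dyadic_kernel_ge0.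
have mK : measurable_fun (`[0, 1]%classic : set R) K.
  by apply: measurable_sum => a; exact: measurable_dyadic_kernel.
have mhp : measurable_fun (`[0, 1]%classic : set R) (fun t => h t `^ p).
  exact: (measurableT_comp (measurable_powR p)).
pose B := 8 * 2 ^+ m * m.+1%:R : R.
have B0 : 0 <= B by rewrite !mulr_ge0// exprn_ge0.
(* The constant part c is integrated against each kernel separately, the part d h^p against the
   pointwise bound B on the sum of all kernels. *)
have key : (((size s)%:R * lam)%:E <=
    ((size s)%:R * (c * (12 * m.+1%:R)) + d * B * M)%:E)%E.
  apply: (@le_trans _ _ (\sum_(a <- s) lam%:E)%E).
    by rewrite sumEFin lee_fin big_const_seq iter_addr_0 count_predT [leLHS]mulr_natl.
  apply: (@le_trans _ _
    (\sum_(a <- s) \int[mu]_(t in `[0%R, 1%R]) (h t * dyadic_kernel m (g a - t))%:E)%E).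
    by rewrite big_seq [leRHS]big_seq; apply: lee_sum => a; exact: big_lam.
  rewrite -ge0_integral_sum; [|by []| |]; last 2 first.
  - move=> a; apply/measurable_EFinP; apply: measurable_funM => //.
    exact: measurable_dyadic_kernel.
  - by move=> a z _; rewrite lee_fin mulr_ge0// dyadic_kernel_ge0.
  apply: (@le_trans _ _ (\int[mu]_(t in `[0%R, 1%R])
      (c%:E * (K t)%:E + (d * B)%:E * (h t `^ p)%:E))%E).
    apply: ge0_le_integral => //.
    - by move=> z _; rewrite sume_ge0// => a _; rewrite lee_fin mulr_ge0// dyadic_kernel_ge0.
    - apply: emeasurable_sum => a; apply/measurable_EFinP; apply: measurable_funM => //.
      exact: measurable_dyadic_kernel.
    - by apply/measurable_EFinP; apply: measurable_funD; apply: measurable_funM.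
    move=> z _; rewrite sumEFin -mulr_sumr -!EFinM -EFinD lee_fin -/(K z).
    apply: (@le_trans _ _ ((c + d * h z `^ p) * K z)).
      by apply: ler_wpM2r; [exact: K0|exact: young].
    rewrite mulrDl lerD2l [leRHS]mulrAC ler_wpM2l//.
      by rewrite mulr_ge0 ?powR_ge0// ltW.
    exact: sum_dyadic_kernel_separated.
  rewrite ge0_integralD//; last 4 first.
  - by move=> z _; rewrite -EFinM lee_fin mulr_ge0// ltW.
  - by apply/measurable_EFinP; apply: measurable_funM.
  - by move=> z _; rewrite -EFinM lee_fin !mulr_ge0 ?powR_ge0// ltW.
  - by apply/measurable_EFinP; apply: measurable_funM.
  rewrite !ge0_integralZl_EFin//; last 6 first.
  - by move=> z _; rewrite lee_fin powR_ge0.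
  - exact/measurable_EFinP.
  - by rewrite mulr_ge0// ltW.
  - by move=> z _; rewrite lee_fin.
  - exact/measurable_EFinP.
  - exact: ltW.
  rewrite EFinD; apply: leeD; last first.
    by rewrite [leRHS]EFinM lee_wpmul2l// lee_fin mulr_ge0// ltW.
  rewrite mulrCA [leRHS]EFinM lee_wpmul2l ?lee_fin ?(ltW c0)//.
  rewrite /K; under eq_integral do rewrite -sumEFin.
  rewrite ge0_integral_sum//; last 2 first.
  - by move=> a; apply/measurable_EFinP; exact: measurable_dyadic_kernel.
  - by move=> a z _; rewrite lee_fin dyadic_kernel_ge0.
  apply: (@le_trans _ _ (\sum_(a <- s) (12 * m.+1%:R)%:E)%E).
    by apply: lee_sum => a _; exact: integral_dyadic_kernel.
  by rewrite sumEFin lee_fin big_const_seq iter_addr_0 count_predT [leRHS]mulr_natl.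
move: key; rewrite lee_fin.
have m0 : (m.+1%:R : R) != 0 by [].
have -> : c * (12 * m.+1%:R) = lam / 2 by rewrite /c; field.
rewrite -/c -/d => key.
have : (size s)%:R * (lam / 2) <= d * B * M by lra.
rewrite mulrA ler_pdivrMr// -ler_pdivlMr// => /le_trans; apply.
rewrite le_eqVlt; apply/orP; left; apply/eqP; rewrite /B; field.
by rewrite gt_eqF.
Qed.

End separated.
End counting.

(** * Partial sums as convolutions with the Dirichlet kernel *)

Section fourier_partial_sum.
Context {R : realType}.
Local Notation mu := (@lebesgue_measure R).
Local Notation I01 := (`[0, 1]%classic : set R).
Implicit Types (t u x y r : R) (g h b : R -> R).

Definition int01 g := mu.-integrable I01 (EFin \o g).

Lemma int01Ml g b B : int01 g -> measurable_fun I01 b ->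
  (forall t, `|b t| <= B) -> int01 (fun t => g t * b t).
Proof.
move=> ig mb bB; apply: (@integrableMl _ _ _ mu I01 _ (EFin \o g) b) => //.
exists B; split; first exact: num_real.
by move=> M BM t _ /=; rewrite (le_trans (bB t))// ltW.
Qed.

Lemma int01D g h : int01 g -> int01 h -> int01 (fun t => g t + h t).
Proof. by move=> ig ih; apply: (@integrableD _ _ _ mu I01 _ (EFin \o g) (EFin \o h)). Qed.

Lemma int01Z g r : int01 g -> int01 (fun t => r * g t).
Proof. by move=> ig; apply: (@integrableZl _ _ _ mu I01 _ r (EFin \o g)). Qed.

Lemma int01_bounded b B : measurable_fun I01 b -> (forall t, `|b t| <= B) -> int01 b.
Proof.
move=> mb bB; apply: measurable_bounded_integrable => //.
  by rewrite [ltLHS](lebesgue_measure_itv `[0, 1])/= lte_fin ltr01 -EFinB ltry.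
exists B; split; first exact: num_real.
by move=> M BM t _ /=; rewrite (le_trans (bB t))// ltW.
Qed.

Lemma int01_sum (I : Type) (s : seq I) (f : I -> R -> R) :
  (forall i, int01 (f i)) -> int01 (fun t => \sum_(i <- s) f i t).
Proof.
move=> intf; elim: s => [|i s IH].
  by under eq_fun do rewrite big_nil; apply: (@int01_bounded _ 0) => //= t; rewrite normr0.
by under eq_fun do rewrite big_cons; exact: int01D.
Qed.

Lemma Rintegral01D g h : int01 g -> int01 h ->
  (\int[mu]_(t in I01) (g t + h t))%R =
  (\int[mu]_(t in I01) g t)%R + (\int[mu]_(t in I01) h t)%R.
Proof. by move=> ig ih; rewrite RintegralD. Qed.

Lemma Rintegral01_sum (I : Type) (s : seq I) (f : I -> R -> R) :
  (forall i, int01 (f i)) ->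
  (\int[mu]_(t in I01) \sum_(i <- s) f i t)%R = \sum_(i <- s) (\int[mu]_(t in I01) f i t)%R.
Proof.
move=> intf; elim: s => [|i s IH].
  under eq_Rintegral do rewrite big_nil; rewrite Rintegral_cst// big_nil mul0r//.
under eq_Rintegral do rewrite big_cons.
by rewrite Rintegral01D// ?IH ?big_cons//; exact: int01_sum.
Qed.

Lemma Rintegral01Z g r : int01 g ->
  (\int[mu]_(t in I01) (r * g t))%R = r * (\int[mu]_(t in I01) g t)%R.
Proof. by move=> ig; rewrite RintegralZl. Qed.

Lemma measurable_cos2pi r x (D : set R) : measurable_fun D (fun t => cos (2 * pi * (r * (x - t)))).
Proof.
apply: measurable_funTS; apply: continuous_measurable_fun.
move=> t; apply: (@continuous_comp _ _ _ (fun t => 2 * pi * (r * (x - t))) cos).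
  apply: cvgM; first exact: cvg_cst.
  apply: cvgM; first exact: cvg_cst.
  by apply: cvgB; [exact: cvg_cst|exact: cvg_id].
exact: continuous_cos.
Qed.

Lemma measurable_dirichlet n x (D : set R) : measurable_fun D (fun t => dirichlet n (x - t)).
Proof. by apply: measurable_sum => j; exact: measurable_cos2pi. Qed.

Lemma int01_dirichlet g n x : int01 g -> int01 (fun t => g t * dirichlet n (x - t)).
Proof.
move=> ig; apply: (int01Ml ig (measurable_dirichlet n x (D := _))) => t.
exact: dirichlet_le.
Qed.

Definition cosc g (k : int) := (\int[mu]_(t in I01) (g t * cos (2 * pi * (k%:~R * t))))%R.
Definition sinc g (k : int) := (\int[mu]_(t in I01) (g t * sin (2 * pi * (k%:~R * t))))%R.

Lemma measurable_cos k (D : set R) : measurable_fun D (fun t => cos (2 * pi * (k%:~R * t)) : R).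
Proof.
have := @measurable_cos2pi (- k%:~R) 0 D; congr measurable_fun.
by apply/funext => t; congr (cos (_ * _)); ring.
Qed.

Lemma measurable_sin k (D : set R) : measurable_fun D (fun t => sin (2 * pi * (k%:~R * t)) : R).
Proof.
apply: measurable_funTS; apply: continuous_measurable_fun.
move=> t; apply: (@continuous_comp _ _ _ (fun t => 2 * pi * (k%:~R * t)) sin).
  apply: cvgM; first exact: cvg_cst.
  by apply: cvgM; [exact: cvg_cst|exact: cvg_id].
exact: continuous_sin.
Qed.

Lemma int01_cos g (k : int) : int01 g -> int01 (fun t => g t * cos (2 * pi * (k%:~R * t))).
Proof. by move=> ig; apply: (int01Ml ig (measurable_cos k (D := _))) => t; exact: cos_max. Qed.

Lemma int01_sin g (k : int) : int01 g -> int01 (fun t => g t * sin (2 * pi * (k%:~R * t))).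
Proof. by move=> ig; apply: (int01Ml ig (measurable_sin k (D := _))) => t; exact: sin_max. Qed.

Lemma sum_odd (F : int -> R) n : (forall k, F (- k) = - F k) ->
  \sum_(0 <= j < (2 * n).+1) F (j%:Z - n%:Z) = 0.
Proof.
move=> Fodd; set S := LHS; suff : S = - S by lra.
rewrite {1}/S big_nat_rev/= add0n -sumrN; apply: eq_big_nat => j /= jn.
by rewrite -Fodd; congr F; lia.
Qed.

Lemma cosc_sinc_sum g n x : int01 g ->
  \sum_(0 <= j < (2 * n).+1) (let k := j%:Z - n%:Z in
    cosc g k * cos (2 * pi * (k%:~R * x)) + sinc g k * sin (2 * pi * (k%:~R * x))) =
  (\int[mu]_(t in I01) (g t * dirichlet n (x - t)))%R.
Proof.
move=> ig; rewrite /dirichlet.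
under [RHS]eq_Rintegral do rewrite mulr_sumr.
rewrite Rintegral01_sum; last first.
  move=> j; apply: (int01Ml ig (measurable_cos2pi _ x (D := _))) => t; exact: cos_max.
apply: eq_bigr => j _ /=; set k : R := _%:~R.
rewrite /cosc /sinc mulrC (mulrC _ (sin _)) -!Rintegral01Z; last 2 first.
- exact: int01_sin.
- exact: int01_cos.
rewrite -Rintegral01D; last 2 first.
- by apply: int01Z; exact: int01_cos.
- by apply: int01Z; exact: int01_sin.
apply: eq_Rintegral => t _.
by rewrite (_ : 2 * pi * (k * (x - t)) = 2 * pi * (k * x) - 2 * pi * (k * t));
    [rewrite cosB|]; ring.
Qed.

Lemma coscN g k : cosc g (- k) = cosc g k.
Proof.
apply: eq_Rintegral => t _; congr (_ * _).
by rewrite mulrNz mulNr mulrN cosN.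
Qed.

Lemma sincN g k : int01 g -> sinc g (- k) = - sinc g k.
Proof.
move=> ig; rewrite -[RHS]mulN1r /sinc -Rintegral01Z; last exact: int01_sin.
apply: eq_Rintegral => t _.
by rewrite mulrNz mulNr mulrN sinN; ring.
Qed.

Lemma Re_sum (I : Type) (s : seq I) (F : I -> R[i]) :
  complex.Re (\sum_(i <- s) F i) = \sum_(i <- s) complex.Re (F i).
Proof. by elim/big_rec2: _ => // i a [b c] _ /= <-; case: (F i). Qed.

Lemma Im_sum (I : Type) (s : seq I) (F : I -> R[i]) :
  complex.Im (\sum_(i <- s) F i) = \sum_(i <- s) complex.Im (F i).
Proof. by elim/big_rec2: _ => // i a [b c] _ /= <-; case: (F i). Qed.

Local Open Scope complex_scope.

(** Multiplying out the complex products leaves, besides the two real convolutions, cross terms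
    mixing the real and imaginary parts of f; they are odd in k and cancel over the symmetric
    range. *)
Lemma fourier_sumE (f : torus R -> R[i]) n (x : torus R) :
  int01 (fun t => complex.Re (f (to_torus t))) ->
  int01 (fun t => complex.Im (f (to_torus t))) ->
  fourier_sum f n x =
    (\int[mu]_(t in I01) (complex.Re (f (to_torus t)) * dirichlet n (repr x - t)))%R +i*
    (\int[mu]_(t in I01) (complex.Im (f (to_torus t)) * dirichlet n (repr x - t)))%R.
Proof.
set g := fun t => complex.Re _; set h := fun t => complex.Im _ => ig ih.
have coefE k : fourier_coef f k = (cosc g k + sinc h k) +i* (cosc h k - sinc g k).
  rewrite /fourier_coef /Cintegral; congr Complex.
    rewrite -Rintegral01D; [|exact: int01_cos|exact: int01_sin].
    apply: eq_Rintegral => t _.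
    rewrite /g /h /expi2pi; case: (f _) => a b /=.
    by rewrite mulrN cosN sinN; ring.
  rewrite -mulN1r -Rintegral01Z; last exact: int01_sin.
  rewrite -Rintegral01D; [|exact: int01_cos|by apply: int01Z; exact: int01_sin].
  apply: eq_Rintegral => t _.
  rewrite /g /h /expi2pi; case: (f _) => a b /=.
  by rewrite mulrN cosN sinN; ring.
rewrite /fourier_sum; under eq_bigr do rewrite coefE.
apply/eqP; rewrite eq_complex/= Re_sum Im_sum; apply/andP; split; apply/eqP.
  rewrite -(cosc_sinc_sum _ _ ig) -[RHS]addr0.
  rewrite -[X in _ = _ + X](@sum_odd (fun k => sinc h k * cos (2 * pi * (k%:~R * repr x)) -
     cosc h k * sin (2 * pi * (k%:~R * repr x))) n); last first.
    move=> k; rewrite sincN// coscN.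
    rewrite (_ : 2 * pi * ((- k)%:~R * repr x) = - (2 * pi * (k%:~R * repr x))).
      by rewrite cosN sinN; ring.
    by rewrite mulrNz; ring.
  rewrite -big_split/=; apply: eq_bigr => j _; rewrite /expi2pi /=; ring.
rewrite -(cosc_sinc_sum _ _ ih) -[RHS]addr0.
rewrite -[X in _ = _ + X](@sum_odd (fun k => cosc g k * sin (2 * pi * (k%:~R * repr x)) -
   sinc g k * cos (2 * pi * (k%:~R * repr x))) n); last first.
  move=> k; rewrite sincN// coscN.
    rewrite (_ : 2 * pi * ((- k)%:~R * repr x) = - (2 * pi * (k%:~R * repr x))).
      by rewrite cosN sinN; ring.
    by rewrite mulrNz; ring.
rewrite -big_split/=; apply: eq_bigr => j _; rewrite /expi2pi /=; ring.
Qed.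

End fourier_partial_sum.

Section powers_of_two.
Context {R : realType}.
Implicit Types (r s p e : R).

Lemma pow2_gt0 r : 0 < 2 `^ r :> R.
Proof. by rewrite powR_gt0. Qed.

Lemma pow2_ge0 r : 0 <= 2 `^ r :> R.
Proof. exact: powR_ge0. Qed.

Lemma pow2D r s : 2 `^ (r + s) = 2 `^ r * 2 `^ s :> R.
Proof. by rewrite powRD ?pnatr_eq0 ?implybT. Qed.

Lemma pow2N r : 2 `^ (- r) = (2 `^ r)^-1 :> R.
Proof. exact: powRN. Qed.

Lemma pow2n n : 2 `^ n%:R = 2 ^+ n :> R.
Proof. by rewrite powR_mulrn. Qed.

Lemma ler_pow2 r s : r <= s -> 2 `^ r <= 2 `^ s :> R.
Proof. by move=> rs; rewrite ler_powR// ler1n. Qed.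

Lemma pow2_ge1Dx r : 1 + r * ln 2 <= 2 `^ r.
Proof. by rewrite /powR gt_eqF//; exact: expR_ge1Dx. Qed.

Lemma ln2_gt0 : 0 < ln 2 :> R.
Proof. by rewrite ln_gt0// ltr1n. Qed.

(** The linear lower bound 1 + r ln 2 for 2^r, taken at r = m e / p and raised to the power p. *)
Lemma pow2_ge_poly p e : 0 < p -> 0 < e ->
  exists2 C : R, 0 < C & forall m : nat, m.+2%:R `^ p <= C * 2 `^ (m%:R * e).
Proof.
move=> p0 e0; pose d := e / p; have d0 : 0 < d by rewrite divr_gt0.
have l0 := ln2_gt0; have dl : 0 < d * ln 2 by rewrite mulr_gt0.
pose C0 := 2 + (d * ln 2)^-1.
have C00 : 0 < C0 by rewrite addr_gt0// invr_gt0.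
exists (C0 `^ p); first by rewrite powR_gt0.
move=> m; rewrite (_ : m%:R * e = m%:R * d * p); last by rewrite /d; field; rewrite gt_eqF.
rewrite powRrM -powRM ?powR_ge0 ?(ltW C00)//.
apply: ge0_ler_powR; rewrite ?nnegrE ?mulr_ge0 ?powR_ge0 ?(ltW C00) ?(ltW p0)//.
apply: le_trans (ler_wpM2l (ltW C00) (pow2_ge1Dx _)).
rewrite -addn2 natrD /C0 mulrDr mulr1 mulrDl -mulrA mulrDl.
have -> : (d * ln 2)^-1 * (m%:R * (d * ln 2)) = m%:R.
  by rewrite mulrCA mulVf ?mulr1// gt_eqF.
have : 0 <= m%:R * (d * ln 2) by rewrite mulr_ge0// ltW.
have : 0 < (d * ln 2)^-1 by rewrite invr_gt0.
by lra.
Qed.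

End powers_of_two.

(** * Counting separated points where some partial sum is large *)

Section fourier_sum_bound.
Context {R : realType}.
Local Notation mu := (@lebesgue_measure R).
Local Notation I01 := (`[0, 1]%classic : set R).
Local Notation modulus f := (fun t => Normc.normc (f (to_torus t))).
Variables (p : R) (f : torus R -> R[i]).
Hypotheses (p1 : 1 <= p) (fp : Lp p f).

Let p0 : 0 < p. Proof. exact: lt_le_trans p1. Qed.

Lemma Re_le_normc (z : R[i]) : `|complex.Re z| <= Normc.normc z.
Proof.
case: z => a b /=; rewrite -sqrtr_sqr ler_wsqrtr// lerDl sqr_ge0//.
Qed.

Lemma Im_le_normc (z : R[i]) : `|complex.Im z| <= Normc.normc z.
Proof.
case: z => a b /=; rewrite -sqrtr_sqr ler_wsqrtr// lerDr sqr_ge0//.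
Qed.

Lemma normc_le (a b : R) : Normc.normc (Complex a b) <= `|a| + `|b|.
Proof.
rewrite /= -[leRHS]ger0_norm ?addr_ge0// -sqrtr_sqr ler_wsqrtr//.
rewrite sqrrD !real_normK ?num_real// addrAC lerDl mulrn_wge0// mulr_ge0//.
Qed.

Lemma normc_ge0 (z : R[i]) : 0 <= Normc.normc z.
Proof. by case: z => a b /=; exact: sqrtr_ge0. Qed.

Lemma measurable_modulus : measurable_fun I01 (modulus f).
Proof.
have [mu_ mv _] := fp.
have -> : modulus f = (fun t =>
    (complex.Re (f (to_torus t)) ^+ 2 + complex.Im (f (to_torus t)) ^+ 2) `^ 2^-1).
  apply/funext => t.
  by rewrite powR12_sqrt ?addr_ge0 ?sqr_ge0//; case: (f _).
apply: (measurableT_comp (measurable_powR _)).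
by apply: measurable_funD; apply: measurable_funX.
Qed.

(** Since p >= 1, y <= 1 + y^p for y >= 0. *)
Lemma integrable_modulus : int01 (modulus f).
Proof.
have [_ _ fin] := fp.
have mF := measurable_modulus.
have iF : int01 (fun t => Normc.normc (f (to_torus t)) `^ p).
  apply/integrableP; split.
    by apply/measurable_EFinP; apply: (measurableT_comp (measurable_powR p)).
  apply: le_lt_trans fin; apply: ge0_le_integral => //.
  - apply/measurableT_comp => //; apply/measurable_EFinP.
    exact: (measurableT_comp (measurable_powR p)).
  - by apply/measurable_EFinP; apply: (measurableT_comp (measurable_powR p)).
  - by move=> t _ /=; rewrite ger0_norm ?powR_ge0.
have i1 : int01 (fun _ : R => 1).
  by apply: (@int01_bounded _ _ 1) => // t; rewrite normr1.
apply: (le_integrable _ _ _ (int01D i1 iF)) => //; first exact/measurable_EFinP.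
move=> t _ /=; rewrite lee_fin ger0_norm ?normc_ge0// ger0_norm ?addr_ge0 ?powR_ge0//.
set y := Normc.normc _.
have y0 : 0 <= y by exact: normc_ge0.
have [y1|y1] := leP y 1; first by rewrite (le_trans y1)// lerDl powR_ge0.
by rewrite ler_wpDl// -[leLHS]powRr1// ler_powR// ltW.
Qed.

Lemma int01_le_modulus (g : R -> R) : measurable_fun I01 g ->
  (forall t, `|g t| <= Normc.normc (f (to_torus t))) -> int01 g.
Proof.
move=> mg gf; apply: (le_integrable _ _ _ integrable_modulus) => //.
  exact/measurable_EFinP.
by move=> t _ /=; rewrite lee_fin (le_trans (gf t))// ler_norm.
Qed.

Lemma integral_dirichlet_le (g : R -> R) n m x : (n < 2 ^ m)%N ->
  measurable_fun I01 g ->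
  (forall t, `|g t| <= Normc.normc (f (to_torus t))) ->
  (`|\int[mu]_(t in I01) (g t * dirichlet n (x - t))|%:E <=
   2%:E * \int[mu]_(t in I01) (Normc.normc (f (to_torus t)) * dyadic_kernel m (x - t))%:E)%E.
Proof.
move=> nm mg gf.
have ig := int01_le_modulus mg gf.
have igd := int01_dirichlet n x ig.
have mgd : measurable_fun I01 (fun t => g t * dirichlet n (x - t)).
  by apply: measurable_funM => //; exact: measurable_dirichlet.
have mk : measurable_fun I01 (fun t => Normc.normc (f (to_torus t)) * dyadic_kernel m (x - t)).
  by apply: measurable_funM; [exact: measurable_modulus|exact: measurable_dyadic_kernel].
rewrite EFin_normr_Rintegral//.
apply: (le_trans (le_abse_integral _ _ _)) => //; first exact/measurable_EFinP.
rewrite -ge0_integralZl_EFin//; last 2 first.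
- by move=> t _; rewrite lee_fin mulr_ge0 ?normc_ge0 ?dyadic_kernel_ge0.
- exact/measurable_EFinP.
apply: ge0_le_integral => //.
- by apply/measurableT_comp => //; exact/measurable_EFinP.
- by apply/measurable_EFinP; apply: measurable_funM.
move=> t _; rewrite -EFinM/= lee_fin normrM mulrCA.
by rewrite ler_pM//; exact: dirichlet_dyadic.
Qed.

Lemma fourier_sum_le n m (x : torus R) : (n < 2 ^ m)%N ->
  ((Normc.normc (fourier_sum f n x))%:E <=
   4%:E * \int[mu]_(t in I01) (Normc.normc (f (to_torus t)) * dyadic_kernel m (repr x - t))%:E)%E.
Proof.
move=> nm; have [mu_ mv _] := fp.
have hu t := Re_le_normc (f (to_torus t)).
have hv t := Im_le_normc (f (to_torus t)).
rewrite fourier_sumE; [|exact: int01_le_modulus|exact: int01_le_modulus].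
apply: (@le_trans _ _ (_%:E + _%:E)%E).
  by rewrite -EFinD lee_fin; exact: normc_le.
rewrite (_ : 4%:E = 2%:E + 2%:E)%E; last by rewrite -EFinD; congr EFin; lra.
rewrite ge0_muleDl ?lee_fin//; apply: leeD; exact: integral_dirichlet_le.
Qed.

Lemma size_large_fourier_sum (gamma s : R) : 1 - gamma * p < s ->
  exists C e : R, [/\ 0 < C, 0 < e &
    forall (m : nat) (xs : seq (torus R)), uniq xs ->
      {in xs &, forall a b, a != b -> 2 ^- m.+1 < mdist a b} ->
      {in xs, forall a, exists2 n : nat, (2 ^ m <= n < 2 ^ m.+1)%N &
        n%:R `^ gamma <= Normc.normc (fourier_sum f n a)} ->
      (size xs)%:R <= C * 2 `^ (m%:R * (s - e))].
Proof.
(* One half of the margin is kept for the conclusion, the other absorbs the factor (m + 2)^p. *)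
move=> gs; pose e := (s - (1 - gamma * p)) / 2.
have e0 : 0 < e by rewrite /e; lra.
have [C0 C00 polyC] := pow2_ge_poly p0 e0.
have [_ _ fin] := fp.
set M := (\int[mu]_(t in _) _)%E in fin.
have M0 : (0 <= M)%E by apply: integral_ge0 => t _; rewrite lee_fin powR_ge0.
have MM : M = (fine M)%:E by rewrite fineK// ge0_fin_numE.
(* The 4 is the constant of [fourier_sum_le]; 2^-|gamma| allows n^gamma to be replaced by 2^(m
   gamma) for 2^m <= n < 2^(m+1), whatever the sign of gamma. *)
pose k := 2 `^ (- `|gamma|) / 4 : R.
have k0 : 0 < k by rewrite divr_gt0// pow2_gt0.
exists (32 * (fine M + 1) * k `^ (- p) * 24 `^ (p - 1) * C0), e; split => //.
  rewrite !mulr_gt0 ?powR_gt0//.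
  by have : 0 <= fine M; [exact: fine_ge0|lra].
move=> m xs uxs sep big.
pose lam := k * 2 `^ (m%:R * gamma).
have lam0 : 0 < lam by rewrite mulr_gt0// pow2_gt0.
have hM : (M <= (fine M + 1)%:E)%E by rewrite MM lee_fin/= lerDl.
have sep' : {in xs &, forall a b, a != b ->
    2 ^- m.+1 < dist_int ((repr a : R) - repr b)} by move=> a b; exact: sep.
have := @size_separated_le _ _ (fun a : torus R => repr a) xs m.+1 uxs sep'
  _ _ _ lam (fun t => normc_ge0 _) p1 lam0 measurable_modulus hM.
have big' : {in xs, forall a : torus R, (lam%:E <= \int[mu]_(t in I01)
   (Normc.normc (f (to_torus t)) * dyadic_kernel m.+1 (repr a - t))%:E)%E}.
  move=> a axs; have [n /andP[n1 n2] hn] := big a axs.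
  have := fourier_sum_le a n2; rewrite muleC -lee_pdivrMr// => /(le_trans _); apply.
  rewrite -EFinM lee_fin (le_trans _ (ler_wpM2r _ hn))//.
  rewrite /lam /k mulrAC ler_wpM2r// -pow2D.
  have n0 : 0 < n%:R :> R by rewrite ltr0n (leq_trans _ n1)// expn_gt0.
  have h1 : 2 `^ m%:R <= n%:R :> R by rewrite pow2n -natrX ler_nat.
  have h2 : n%:R <= 2 `^ m.+1%:R :> R by rewrite pow2n -natrX ler_nat ltnW.
  have [g0|g0] := leP 0 gamma.
    apply: (@le_trans _ _ ((2 `^ m%:R) `^ gamma)).
      by rewrite -powRrM ler_pow2//; have := normr_ge0 gamma; lra.
    by rewrite ge0_ler_powR// nnegrE ?pow2_ge0// ltW.
  rewrite (ltr0_norm g0) opprK.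
  rewrite -[n%:R `^ _]invrK -[leLHS]invrK lef_pV2 ?posrE ?invr_gt0 ?pow2_gt0 ?powR_gt0//.
  rewrite -!powRN.
  apply: (@le_trans _ _ ((2 `^ m.+1%:R) `^ (- gamma))).
    by rewrite ge0_ler_powR// ?nnegrE ?pow2_ge0// ?oppr_ge0 ltW.
  by rewrite -powRrM ler_pow2// -natr1; lra.
move=> /(_ big') /le_trans; apply.
have x0 : 0 < m.+2%:R :> R by [].
have -> : 16 * 2 ^+ m.+1 * m.+2%:R * (fine M + 1) * lam^-1 *
      (lam / (24 * m.+2%:R)) `^ (1 - p) =
    32 * (fine M + 1) * k `^ (- p) * 24 `^ (p - 1) *
      (2 `^ (m%:R * (1 - gamma * p)) * m.+2%:R `^ p).
  rewrite -(mulr_powRB1 (ltW x0) p0).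
  have -> : (lam / (24 * m.+2%:R)) `^ (1 - p) =
      lam * lam `^ (- p) * 24 `^ (p - 1) * m.+2%:R `^ (p - 1).
    rewrite powRM ?invr_ge0 ?mulr_ge0 ?ltW// -powR_inv1 ?mulr_ge0//.
    rewrite -powRrM mulN1r opprB [(24 * _) `^ _]powRM// mulrA; congr (_ * _ * _).
    by rewrite powRD ?(gt_eqF lam0) ?implybT// powRr1// ltW.
  have -> : lam `^ (- p) = k `^ (- p) * 2 `^ (- (m%:R * (gamma * p))).
    rewrite /lam powRM ?pow2_ge0 ?(ltW k0)// -powRrM.
    by congr (_ * 2 `^ _); ring.
  rewrite mulrBr mulr1 pow2D pow2n exprS.
  by field; rewrite gt_eqF.
have M1 : 0 <= fine M + 1 by rewrite addr_ge0 ?fine_ge0.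
rewrite -!mulrA !ler_wpM2l ?powR_ge0//.
rewrite (le_trans (ler_wpM2l (pow2_ge0 _) (polyC m)))//.
rewrite mulrCA ler_wpM2l ?(ltW C00)// -pow2D ler_pow2//.
rewrite -mulrDr ler_wpM2l// /e; lra.
Qed.

End fourier_sum_bound.

(** * Entropy bounds for packing and Hausdorff measures *)

Section level_sums.
Context {R : realType}.
Implicit Types (s e C : R).

Lemma sum_geometric_le (q : R) M N : 0 <= q < 1 ->
  \sum_(M <= m < N) q ^+ m <= q ^+ M / (1 - q).
Proof.
move=> /andP[q0 q1]; have q2 : 0 < 1 - q by rewrite subr_gt0.
rewrite ler_pdivlMr//.
have [NM|MN] := leqP N M; first by rewrite big_geq// mul0r exprn_ge0.
rewrite mulrC mulr_sumr.
rewrite (eq_bigr (fun m => - (q ^+ m.+1 - q ^+ m))); last by move=> m _; rewrite exprS; ring.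
rewrite sumrN telescope_sumr; last exact: ltnW.
by rewrite opprB lerBlDr lerDl exprn_ge0.
Qed.

Lemma pow2_decay (K e eps : R) (N0 : nat) : 0 < e -> 0 < eps ->
  exists2 M, (N0 <= M)%N & K * 2 `^ (- (M%:R * e)) <= eps.
Proof.
move=> e0 eps0; have l0 := @ln2_gt0 R.
have el0 : 0 < e * ln 2 by rewrite mulr_gt0.
pose M := maxn N0 (Num.truncn (`|K| / eps / (e * ln 2))).+1.
exists M; first exact: leq_maxl.
have h : `|K| / eps / (e * ln 2) <= M%:R.
  apply: (@le_trans _ _ (Num.truncn (`|K| / eps / (e * ln 2))).+1%:R); last first.
    by rewrite ler_nat leq_maxr.
  have : 0 <= `|K| / eps / (e * ln 2) by rewrite !divr_ge0// ltW.
  by move=> /truncn_itv/andP[_ /ltW].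
rewrite pow2N ler_pdivrMr ?pow2_gt0// (le_trans (ler_norm K))//.
rewrite mulrC -ler_pdivrMr//.
have h' : `|K| / eps <= M%:R * e * ln 2 by rewrite -mulrA -ler_pdivrMr.
by rewrite (le_trans h')// (le_trans _ (pow2_ge1Dx _))// lerDr.
Qed.

(** Cardinality C 2^(m (s - e)) against weight 2^(-m s) leaves C 2^(-m e) on level m, a geometric
    series starting at M. It serves for packings and for covers. *)
Lemma sum_by_level (T : eqType) (X : seq T) (lev : T -> nat) (M : nat) s e C :
  0 <= C -> 0 < e -> {in X, forall b, (M <= lev b)%N} ->
  (forall m, (M <= m)%N -> (count (fun b => lev b == m) X)%:R <= C * 2 `^ (m%:R * (s - e))) ->
  \sum_(b <- X) 2 `^ (- ((lev b)%:R * s)) <= C / (1 - 2 `^ (- e)) * 2 `^ (- (M%:R * e)).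
Proof.
move=> C0 e0 levM cnt.
pose N := (\max_(b <- X) lev b).+1.
have levN b : b \in X -> (lev b < N)%N.
  by move=> bX; rewrite ltnS; apply: (@leq_bigmax_seq _ X xpredT lev).
have q1 : 0 <= 2 `^ (- e) < 1.
  rewrite pow2_ge0/= pow2N invf_lt1 ?pow2_gt0//.
  by rewrite (lt_le_trans _ (pow2_ge1Dx e))// ltrDl mulr_gt0// ln2_gt0.
have qn m : 2 `^ (- (m%:R * e)) = (2 `^ (- e)) ^+ m :> R.
  by rewrite -powR_mulrn ?pow2_ge0// -powRrM; congr (2 `^ _); ring.
apply: (@le_trans _ _ (\sum_(M <= m < N) C * (2 `^ (- e)) ^+ m)); last first.
  by rewrite -mulr_sumr -mulrA ler_wpM2l// mulrC qn; exact: sum_geometric_le.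
apply: (@le_trans _ _ (\sum_(b <- X) \sum_(M <= m < N) (lev b == m)%:R * 2 `^ (- (m%:R * s)))).
  rewrite big_seq [leRHS]big_seq; apply: ler_sum => b bX.
  rewrite (bigD1_seq (lev b)) ?iota_uniq//= ?mem_index_iota ?levM ?levN//.
  by rewrite eqxx mul1r lerDl sumr_ge0// => m _; rewrite mulr_ge0// pow2_ge0.
rewrite exchange_big/= big_nat [leRHS]big_nat; apply: ler_sum => m /andP[Mm _].
rewrite -mulr_suml -natr_sum.
rewrite (_ : (\sum_(b <- X) _)%N = count (fun b => lev b == m) X); last first.
  by rewrite -sum1_count [RHS]big_mkcond; apply: eq_bigr => b _; case: eqP.
rewrite (le_trans (ler_wpM2r (pow2_ge0 _) (cnt m Mm)))// -mulrA ler_wpM2l//.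
by rewrite -pow2D -qn ler_pow2//; lra.
Qed.

Lemma esum_le_seq (T : choiceType) (P : set T) (a : T -> \bar R) (w : \bar R) :
  (forall X : seq T, uniq X -> {in X, forall b, P b} -> (\sum_(b <- X) a b <= w)%E) ->
  (\esum_(b in P) a b <= w)%E.
Proof.
move=> aw; apply: ge_ereal_sup => _ [A [finA AP] <-].
rewrite fsbig_finite//; apply: aw; first exact: finmap.fset_uniq.
by move=> b bA; apply: AP; move: bA; rewrite in_fset_set// inE.
Qed.

End level_sums.

Section separated_criteria.
Context {R : realType} {M : metricType R}.
Implicit Types (E : set M) (s e C : R).

Definition separated_seq (r : R) (xs : seq M) :=
  uniq xs /\ {in xs &, forall a b, a != b -> r < mdist a b}.

(** An entropy bound of exponent t at one scale; if it holds at all large scales, the upper box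
    dimension of E is at most t. The shift between m + 1 and m fits radii in the interval from
    2^-(m+1) to 2^-m. *)
Definition separated_growth C t m E := forall xs, separated_seq (2 ^- m.+1) xs ->
  {in xs, forall a, E a} -> (size xs)%:R <= C * 2 `^ (m%:R * t).

Lemma packing_premeasure_ge0 s delta E : (0 <= packing_premeasure s delta E)%E.
Proof.
by apply: ereal_sup_ubound; exists set0; split => //; rewrite esum_set0.
Qed.

Lemma packing_content_ge0 s E : (0 <= packing_content s E)%E.
Proof. by apply: le_ereal_inf_tmp => _ [d _ <-]; exact: packing_premeasure_ge0. Qed.

Lemma packing_measure_ge0 s E : (0 <= packing_measure s E)%E.
Proof.
apply: le_ereal_inf_tmp => _ [F [_ ->]]; apply: nneseries_ge0 => n _ _.
exact: packing_content_ge0.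
Qed.

Lemma hausdorff_premeasure_ge0 s delta E : (0 <= hausdorff_premeasure s delta E)%E.
Proof.
apply: le_ereal_inf_tmp => _ [I [U [_ _ ->]]]; apply: esum_ge0 => n _.
exact: poweR_ge0.
Qed.

Lemma dyadic_scale (r : R) (M0 : nat) : 0 < r <= 2 ^- M0 ->
  exists m, (M0 <= m)%N /\ 2 ^- m.+1 < r <= 2 ^- m.
Proof.
move=> /andP[r0 rM].
have [M1 _ hM1] := @pow2_decay R 1 1 r 0 ltr01 r0.
have ex : exists m, 2 ^- m.+1 < r.
  exists M1; apply: lt_le_trans hM1.
  rewrite mul1r mulr1 pow2N pow2n ltf_pV2 ?posrE ?exprn_gt0//.
  by rewrite exprS ltr_pMl ?exprn_gt0// ltr1n.
case: (ex_minnP ex) => n rn nmin.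
exists (maxn n M0); split; first exact: leq_maxr.
have [nM|Mn] := leqP n M0.
  rewrite rM andbT (le_lt_trans _ rn)//.
  by rewrite lef_pV2 ?posrE ?exprn_gt0// ler_eXn2l// ltr1n.
rewrite rn/=.
case: n rn nmin Mn => // n rn nmin Mn.
by rewrite leNgt; apply/negP => /nmin; rewrite ltnn.
Qed.

(** Sort a fine packing by the dyadic size of the radii. Centres of disjoint balls of radius more
    than 2^-(m+1) are 2^-(m+1)-separated, since a nearer centre would belong to both balls; so the
    entropy bound controls the number of balls of each level. *)
Lemma packing_content_eq0 s e C M0 E : 0 <= s -> 0 <= C -> 0 < e ->
  (forall m, (M0 <= m)%N -> separated_growth C (s - e) m E) ->
  packing_content s E = 0%E.
Proof.
move=> s0 C0 e0 growth; apply/eqP; rewrite eq_le packing_content_ge0 andbT.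
apply/lee_addgt0Pr => eps eps0; rewrite add0e.
pose K := 2 `^ s * (C / (1 - 2 `^ (- e))).
have [M1 M01 KM] := pow2_decay K M0 e0 eps0.
have d0 : 0 < 2 ^- M1 :> R by rewrite invr_gt0 exprn_gt0.
apply: (@le_trans _ _ (packing_premeasure s (2 ^- M1) E)).
  by apply: ereal_inf_lbound; exists (2 ^- M1).
apply: ge_ereal_sup => _ [P [_ PE triv ->]].
apply: esum_le_seq => X uX XP.
have /choice[lev levP] : forall b : M * R, exists m,
    P b -> (M1 <= m)%N /\ 2 ^- m.+1 < b.2 <= 2 ^- m.
  move=> b; have [Pb|nPb] := pselect (P b); last by exists 0%N.
  by have [_ /dyadic_scale[m mP]] := PE b Pb; exists m.
rewrite sumEFin lee_fin (le_trans _ KM)// /K -[leRHS]mulrA.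
apply: (@le_trans _ _ (2 `^ s * \sum_(b <- X) 2 `^ (- ((lev b)%:R * s)))).
  rewrite mulr_sumr big_seq [leRHS]big_seq; apply: ler_sum => b bX.
  have [_ /andP[b1 b2]] := levP b (XP b bX).
  have b0 : 0 <= b.2 by rewrite (le_trans _ (ltW b1))// invr_ge0 exprn_ge0.
  rewrite powRM// ler_wpM2l ?pow2_ge0// -mulNr powRrM pow2N pow2n.
  by apply: ge0_ler_powR; rewrite ?nnegrE ?invr_ge0 ?exprn_ge0.
rewrite ler_wpM2l ?pow2_ge0//; apply: sum_by_level => //.
  by move=> b bX; have [] := levP b (XP b bX).
move=> m M1m; rewrite -size_filter; set Y := seq.filter _ _.
have YP b : b \in Y -> [/\ P b, 2 ^- m.+1 < b.2 & b.2 <= 2 ^- m].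
  rewrite mem_filter => /andP[/eqP <- bX]; have Pb := XP b bX.
  by have [_ /andP[? ?]] := levP b Pb.
have inj b c : b \in Y -> c \in Y -> mdist b.1 c.1 <= 2 ^- m.+1 -> b = c.
  move=> /YP[Pb b1 _] /YP[Pc c1 _] bc; apply: triv => //.
  exists c.1; split; rewrite /mclosed_ball/=; first exact: le_trans (ltW b1).
  by rewrite mdistxx (le_trans _ (ltW c1))// invr_ge0 exprn_ge0.
have e1 : 0 <= 2 ^- m.+1 :> R by rewrite invr_ge0 exprn_ge0.
rewrite -(size_map fst); apply: growth; first exact: leq_trans M1m.
  split.
    rewrite map_inj_in_uniq ?filter_uniq// => b c bY cY bc.
    by apply: inj => //; rewrite bc mdistxx.
  move=> _ _ /mapP[b bY ->] /mapP[c cY ->] bc; rewrite ltNge; apply/negP => h.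
  by move: bc; rewrite (inj b c bY cY h) eqxx.
by move=> _ /mapP[b /YP[Pb _ _] ->]; have [] := PE b Pb.
Qed.

Lemma packing_measure_bigcup0 s E (F : nat -> set M) : E `<=` \bigcup_i F i ->
  (forall i, packing_content s (F i) = 0%E) -> packing_measure s E = 0%E.
Proof.
move=> EF F0; apply/eqP; rewrite eq_le packing_measure_ge0 andbT.
apply: ereal_inf_lbound; exists F; split => //.
by rewrite eseries0// => n _ _; rewrite F0.
Qed.

(** If no family were maximal, each could be extended by a point far from all its members, and the
    sizes would exceed N. *)
Lemma maximal_separated (r : R) E (N : nat) : 0 <= r ->
  (forall xs, separated_seq r xs -> {in xs, forall a, E a} -> (size xs <= N)%N) ->
  exists xs, [/\ separated_seq r xs, {in xs, forall a, E a} &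
    forall y, E y -> exists2 a, a \in xs & mdist a y <= r].
Proof.
move=> r0 bounded; apply: contrapT => nomax.
suff grow k : exists xs, [/\ separated_seq r xs, {in xs, forall a, E a} & size xs = k].
  have [xs [sxs xsE szxs]] := grow N.+1.
  by have := bounded xs sxs xsE; rewrite szxs ltnn.
elim: k => [|k [xs [[uxs sxs] xsE szxs]]]; first by exists [::]; split => //; split.
apply: contrapT => nogrow; apply: nomax; exists xs; split => // y Ey.
apply: contrapT => far; apply: nogrow; exists (y :: xs).
have far' a : a \in xs -> r < mdist a y.
  by move=> axs; rewrite ltNge; apply/negP => ay; apply: far; exists a.
split; last by rewrite /= szxs.
  split.
    rewrite /= uxs andbT; apply/negP => yxs; have := far' y yxs.
    by rewrite mdistxx ltNge r0.
  move=> a b; rewrite !inE => /predU1P[->|axs] /predU1P[->|bxs] ab.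
  - by rewrite eqxx in ab.
  - by rewrite metric_sym far'.
  - exact: far'.
  - exact: sxs.
by move=> a; rewrite inE => /predU1P[->|/xsE].
Qed.

Lemma diam_ge0 E : (0 <= diam E)%E.
Proof. by apply: ereal_sup_ubound; left. Qed.

Lemma diam_le E (r : R) : 0 <= r -> (forall x y, E x -> E y -> mdist x y <= r) ->
  (diam E <= r%:E)%E.
Proof.
move=> r0 Er; apply: ge_ereal_sup => _ [->|[x Ex [y Ey <-]]]; first by rewrite lee_fin.
by rewrite lee_fin Er.
Qed.

Lemma poweR_diam_le E s (r : R) : 0 <= s -> (diam E <= r%:E)%E ->
  (poweR (diam E) s <= (r `^ s)%:E)%E.
Proof.
move=> s0 Er; rewrite -poweR_EFin; apply: gt0_ler_poweR => //.
  by rewrite in_itv/= diam_ge0 leey.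
by rewrite in_itv/= leey (le_trans (diam_ge0 E)).
Qed.

(** The convergence half of the Borel-Cantelli argument: E is covered by the balls around maximal
    separated subsets of the sets [G m], m >= M2, and the corresponding sum is the tail of a
    convergent series. [M1] makes the diameters at most delta, [M2] the sum at most eps. *)
Lemma hausdorff_measure_limsup0 s e C M0 E (G : nat -> set M) :
  0 <= s -> 0 <= C -> 0 < e ->
  (forall m, (M0 <= m)%N -> separated_growth C (s - e) m (G m)) ->
  (forall m0 x, E x -> exists2 m, (m0 <= m)%N & G m x) ->
  hausdorff_measure s E = 0%E.
Proof.
move=> s0 C0 e0 growth limsup; apply/eqP; rewrite eq_le; apply/andP; split; last first.
  apply: (@le_trans _ _ (hausdorff_premeasure s 1 E)); first exact: hausdorff_premeasure_ge0.
  by apply: ereal_sup_ubound; exists 1; [exact: ltr01|].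
apply: ge_ereal_sup => _ [delta d0 <-]; apply/lee_addgt0Pr => eps eps0; rewrite add0e.
have [M1 M01 M1d] := @pow2_decay R 1 1 delta M0 ltr01 d0.
pose K := C / (1 - 2 `^ (- e)).
have [M2 M12 KM] := pow2_decay K M1 e0 eps0.
have e1 m : 0 <= 2 ^- m.+1 :> R by rewrite invr_ge0 exprn_ge0.
have /choice[xs xsP] : forall m, exists xs, (M2 <= m)%N ->
    [/\ separated_seq (2 ^- m.+1) xs, {in xs, forall a, G m a} &
    forall y, G m y -> exists2 a, a \in xs & mdist a y <= 2 ^- m.+1].
  move=> m; have [Mm|_] := leqP M2 m; last by exists [::].
  have gm := growth m (leq_trans M01 (leq_trans M12 Mm)).
  have [|xs xsP] := @maximal_separated _ (G m) (Num.truncn (C * 2 `^ (m%:R * (s - e)))) (e1 m).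
    move=> xs sxs xsG; have := gm xs sxs xsG.
    by rewrite truncn_ge_nat// mulr_ge0// pow2_ge0.
  by exists xs.
(* The number k stands for the ball around the i-th point of level m. The condition [pickle mi = k]
   in [I] discards the numbers decoded by default, so that no ball is counted twice. *)
pose code (k : nat) : nat * nat := odflt (0%N, 0%N) (unpickle k).
pose I := [set k | let mi := code k in
    [/\ pickle mi = k, (M2 <= mi.1)%N & (mi.2 < size (xs mi.1))%N]].
pose U (k : nat) : set M := [set y | if xs (code k).1 is x0 :: _ then
   (mdist (nth x0 (xs (code k).1) (code k).2) y <= 2 ^- (code k).1.+1)%R else false].
have diamU k : (diam (U k) <= (2 ^- (code k).1)%:E)%E.
  apply: diam_le; first by rewrite invr_ge0 exprn_ge0.
  move=> x y; rewrite /U/=; case: (xs _) => // x0 ys.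
  set c := nth _ _ _ => cx cy.
  rewrite (le_trans (metric_triangle _ c _))// metric_sym (le_trans (lerD cx cy))//.
  by rewrite exprS invfM; lra.
apply: (@le_trans _ _ (\esum_(k in I) poweR (diam (U k)) s)%E).
  apply: ereal_inf_lbound; exists I, U; split => //.
    move=> x Ex; have [m Mm Gx] := limsup M2 x Ex.
    have [sep xsG /(_ _ Gx)[a axs ax]] := xsP m Mm.
    exists (pickle (m, index a (xs m))).
      by rewrite /I/= /code pickleK/=; split => //; rewrite index_mem.
    rewrite /U/= /code pickleK/=; move: axs ax; case: (xs m) => // x0 ys axs ax.
    by rewrite nth_index.
  move=> k [_ Mk _]; rewrite (le_trans (diamU k))// lee_fin (le_trans _ M1d)//.
  rewrite mul1r mulr1 pow2N pow2n lef_pV2 ?posrE ?exprn_gt0//.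
  by rewrite ler_eXn2l ?ltr1n// (leq_trans M12).
apply: esum_le_seq => X uX XI.
apply: (@le_trans _ _ (\sum_(k <- X) (2 `^ (- ((code k).1%:R * s)))%:E)%E).
  apply: lee_sum => k _; rewrite (le_trans (poweR_diam_le s0 (diamU k)))// lee_fin.
  by rewrite -mulNr powRrM pow2N pow2n.
rewrite sumEFin lee_fin (le_trans _ KM)//; apply: sum_by_level => //.
  by move=> k /XI[].
move=> m Mm; have [sep xsG _] := xsP m Mm.
apply: le_trans (growth m (leq_trans M01 (leq_trans M12 Mm)) _ sep xsG).
rewrite ler_nat -size_filter; set Y := seq.filter _ _.
have YP k : k \in Y -> [/\ (code k).1 = m, pickle (code k) = k & ((code k).2 < size (xs m))%N].
  by rewrite mem_filter => /andP[/eqP <- /XI[]].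
rewrite -(size_map (fun k => (code k).2)) -(size_iota 0 (size (xs m))).
apply: uniq_leq_size.
  rewrite map_inj_in_uniq ?filter_uniq// => k l /YP[k1 k2 _] /YP[l1 l2 _] kl.
  by rewrite -k2 -l2; case: (code k) (code l) k1 l1 kl => ? ? [? ?] /= -> -> ->.
by move=> _ /mapP[k /YP[_ _ ?] ->]; rewrite mem_iota.
Qed.

End separated_criteria.

(** * Upper bounds for the dimensions *)

Section limits_inferior.
Context {R : realType}.
Implicit Types (u : (\bar R)^nat) (c : \bar R).

Lemma limn_esup_le u c N : (forall n, (N <= n)%N -> (u n <= c)%E) -> (limn_esup u <= c)%E.
Proof.
move=> uc; apply: ge_ereal_inf.
exists (ereal_sup (u @` [set n | (N <= n)%N])).
  by exists [set n | (N <= n)%N] => //; exists N.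
by apply: ge_ereal_sup => _ [n /= Nn <-]; exact: uc.
Qed.

Lemma le_limn_einf u c N : (forall n, (N <= n)%N -> (c <= u n)%E) -> (c <= limn_einf u)%E.
Proof.
move=> uc; rewrite -[c]oppeK leeN2; apply: (@limn_esup_le _ _ N) => n Nn /=.
by rewrite leeN2 uc.
Qed.

Lemma lt_limn_einf u c : (c < limn_einf u)%E -> exists N, forall n, (N <= n)%N -> (c <= u n)%E.
Proof.
rewrite -[c]oppeK lteN2 => /ereal_inf_lt[_ [V [N _ NV] <-] supV].
exists N => n Nn; rewrite leeNl -[leLHS]/((\- u)%E n); apply: le_trans (ltW supV).
by apply: ereal_sup_ubound; exists n => //; exact: NV.
Qed.

End limits_inferior.

Section growth_exponents.
Context {R : realType}.
Variable f : torus R -> R[i].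
Implicit Types (x : torus R) (gamma beta : R).
Local Notation S n x := (Normc.normc (fourier_sum f n x)).

Lemma ln_nat_gt0 n : (2 <= n)%N -> 0 < ln n%:R :> R.
Proof. by move=> n2; rewrite ln_gt0// ltr1n. Qed.

Lemma le_log_ratio x n gamma : (2 <= n)%N ->
  (gamma%:E <= log_ratio f x n)%E = (n%:R `^ gamma <= S n x).
Proof.
move=> n2; have n0 : 0 < n%:R :> R by rewrite ltr0n (leq_trans _ n2).
have l0 := ln_nat_gt0 n2.
rewrite /log_ratio inver (gt_eqF l0) lee_pdivlMr// -EFinM.
(* Where the partial sum vanishes its logarithm is -oo, and both sides are false. *)
have [S0|S0] := leP (S n x) 0.
  rewrite le0_lneNy ?lee_fin//; apply/esym/negbTE; rewrite -ltNge.
  by rewrite (le_lt_trans S0)// powR_gt0.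
rewrite lne_EFin// lee_fin -ler_expR lnK ?posrE//.
by rewrite /powR (gt_eqF n0) mulrC.
Qed.

Lemma log_ratio_le x n gamma : (2 <= n)%N -> S n x < n%:R `^ gamma ->
  (log_ratio f x n <= gamma%:E)%E.
Proof. by move=> n2; rewrite ltNge -le_log_ratio// -ltNge => /ltW. Qed.

Lemma beta_plus_growth x beta gamma : (beta%:E <= beta_plus f x)%E -> gamma < beta ->
  exists N, forall n, (N <= n)%N -> n%:R `^ gamma <= S n x.
Proof.
move=> bx gb; have /lt_limn_einf[N hN] : (gamma%:E < limn_einf (log_ratio f x))%E.
  by rewrite (lt_le_trans _ bx)// lte_fin.
exists (maxn 2 N) => n; rewrite geq_max => /andP[n2 Nn].
by rewrite -le_log_ratio// hN.
Qed.

Lemma le_beta_plus x beta :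
  (forall gamma, gamma < beta ->
    exists N, forall n, (N <= n)%N -> n%:R `^ gamma <= S n x) ->
  (beta%:E <= beta_plus f x)%E.
Proof.
move=> growth; apply/lee_addgt0Pr => e e0.
rewrite -leeBlDr// -EFinB.
have [N hN] := growth (beta - e) ltac:(by rewrite ltrBlDr ltrDl).
apply: (@le_limn_einf _ _ _ (maxn 2 N)) => n; rewrite geq_max => /andP[n2 Nn].
by rewrite le_log_ratio// hN.
Qed.

Lemma beta_minus_le x beta :
  (forall gamma, beta < gamma ->
    exists N, forall n, (N <= n)%N -> S n x < n%:R `^ gamma) ->
  (beta_minus f x <= beta%:E)%E.
Proof.
move=> growth; apply/lee_addgt0Pr => e e0; rewrite -EFinD.
have [N hN] := growth (beta + e) ltac:(by rewrite ltrDl).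
apply: (@limn_esup_le _ _ _ (maxn 2 N)) => n; rewrite geq_max => /andP[n2 Nn].
by rewrite log_ratio_le// hN.
Qed.

Definition often_large gamma : set (torus R) :=
  [set x | forall N, exists2 n, (N <= n)%N & n%:R `^ gamma <= S n x].

End growth_exponents.

Section upper_bounds.
Context {R : realType}.
Variables (p : R) (f : torus R -> R[i]).
Hypotheses (p1 : 1 <= p) (fp : Lp p f).
Local Notation S n x := (Normc.normc (fourier_sum f n x)).

Let p0 : 0 < p. Proof. exact: lt_le_trans p1. Qed.

(** On [F N] the partial sums are large from order N on, so n = 2^m gives the entropy bound at every
    scale m >= N, as the packing content requires; the union over N costs nothing for the packing
    measure. [gamma] gives away half of the margin. *)
Lemma packing_measure_calE_plus (beta s : R) : 0 <= s -> 1 - beta * p < s ->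
  packing_measure s (calE_plus beta f) = 0%E.
Proof.
move=> s0 bs; pose gamma := beta - (s - (1 - beta * p)) / (2 * p).
have gb : gamma < beta by rewrite ltrBlDr ltrDl divr_gt0 ?mulr_gt0// subr_gt0.
have gs : 1 - gamma * p < s.
  rewrite (_ : gamma * p = beta * p - (s - (1 - beta * p)) / 2); first by lra.
  by rewrite /gamma; field; rewrite gt_eqF.
have [C [e [C0 e0 count]]] := size_large_fourier_sum p1 fp gs.
pose F N := [set x | forall n, (N <= n)%N -> n%:R `^ gamma <= S n x].
apply: (@packing_measure_bigcup0 _ _ _ _ F).
  by move=> x /beta_plus_growth -/(_ _ gb)[N hN]; exists N.
move=> N; apply: (@packing_content_eq0 _ _ _ e C N) => //; first exact: ltW.
move=> m Nm xs [uxs sep] xsF; apply: count => // a axs; exists (2 ^ m)%N.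
  by rewrite leqnn ltn_exp2l/=.
by apply: (xsF a axs); rewrite (leq_trans Nm)// ltnW// ltn_expl.
Qed.

(** Now each point is controlled at infinitely many scales only, which is enough for covers but not
    for the packing criterion. *)
Lemma hausdorff_measure_often_large (gamma s : R) : 0 <= s -> 1 - gamma * p < s ->
  hausdorff_measure s (often_large f gamma) = 0%E.
Proof.
move=> s0 gs; have [C [e [C0 e0 count]]] := size_large_fourier_sum p1 fp gs.
pose G m := [set x | exists2 n, (2 ^ m <= n < 2 ^ m.+1)%N & n%:R `^ gamma <= S n x].
apply: (@hausdorff_measure_limsup0 _ _ _ e C 0 _ G) => //; first exact: ltW.
  by move=> m _ xs [uxs sep] xsG; apply: count => // a axs; have [n] := xsG a axs; exists n.
move=> m x /(_ (2 ^ m)%N)[n mn hn]; exists (trunc_log 2 n).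
  by apply: trunc_log_max.
exists n => //; apply/andP; split; last exact: trunc_log_ltn.
by rewrite trunc_logP// (leq_trans _ mn)// expn_gt0.
Qed.

Lemma packing_dim_calE_plus_le (beta : R) : beta * p <= 1 ->
  (packing_dim (calE_plus beta f) <= (1 - beta * p)%:E)%E.
Proof.
move=> bp; apply/lee_addgt0Pr => e e0; rewrite -EFinD; apply: ereal_inf_lbound.
exists (1 - beta * p + e) => //; split; first by lra.
by apply: packing_measure_calE_plus; lra.
Qed.

Lemma beta_plus_often_large (beta gamma : R) x : (beta%:E <= beta_plus f x)%E ->
  gamma < beta -> often_large f gamma x.
Proof.
move=> bx gb M; have [N hN] := beta_plus_growth bx gb.
by exists (maxn M N); [exact: leq_maxl|apply: hN; exact: leq_maxr].
Qed.

End upper_bounds.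

Section dimension_monotonicity.
Context {R : realType} {M : metricType R}.
Implicit Types (E F : set M) (s : R).

Lemma packing_measureS s E F : E `<=` F -> (packing_measure s E <= packing_measure s F)%E.
Proof.
move=> EF; apply: ereal_inf_le_tmp => _ [G [FG ->]]; exists G; split => //.
exact: subset_trans FG.
Qed.

Lemma hausdorff_measureS s E F : E `<=` F -> (hausdorff_measure s E <= hausdorff_measure s F)%E.
Proof.
move=> EF; apply: ge_ereal_sup => _ [d d0 <-].
apply: (@le_trans _ _ (hausdorff_premeasure s d F)); last first.
  by apply: ereal_sup_ubound; exists d.
apply: ereal_inf_le_tmp => _ [I [U [FU Ud ->]]]; exists I, U; split => //.
exact: subset_trans FU.
Qed.

Lemma hausdorff_measure_ge0 s E : (0 <= hausdorff_measure s E)%E.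
Proof.
apply: (@le_trans _ _ (hausdorff_premeasure s 1 E)); first exact: hausdorff_premeasure_ge0.
by apply: ereal_sup_ubound; exists 1; [exact: ltr01|].
Qed.

Lemma packing_dimS E F : E `<=` F -> (packing_dim E <= packing_dim F)%E.
Proof.
move=> EF; apply: ereal_inf_le_tmp => _ [s [s0 sF] <-]; exists s => //; split => //.
by apply/eqP; rewrite eq_le packing_measure_ge0 andbT -sF packing_measureS.
Qed.

Lemma le_dim_of_measure0 (mes : R -> set M -> \bar R) E (d : R) :
  (forall s, 0 <= s -> mes s E = 0%E -> d <= s) ->
  (d%:E <= ereal_inf [set s%:E | s in [set s | (0 <= s)%R /\ mes s E = 0%E]])%E.
Proof. by move=> h; apply: le_ereal_inf_tmp => _ [s [s0 sE] <-]; rewrite lee_fin h. Qed.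

End dimension_monotonicity.

Section upper_bound_E_FS.
Context {R : realType}.
Variables (p : R) (f : torus R -> R[i]).
Hypotheses (p1 : 1 <= p) (fp : Lp p f).

(** For every gamma < beta the set is contained in [often_large f gamma], so no comparison between
    the two dimensions enters. *)
Lemma hausdorff_dim_E_FS_le (beta : R) : beta * p <= 1 ->
  (hausdorff_dim (E_FS beta f) <= (1 - beta * p)%:E)%E.
Proof.
have p0 : 0 < p by exact: lt_le_trans p1.
move=> bp; apply/lee_addgt0Pr => e e0; rewrite -EFinD; apply: ereal_inf_lbound.
exists (1 - beta * p + e) => //; split; first by lra.
pose gamma := beta - e / (2 * p).
have gb : gamma < beta by rewrite ltrBlDr ltrDl divr_gt0 ?mulr_gt0.
have gs : 1 - gamma * p < 1 - beta * p + e.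
  by rewrite (_ : gamma * p = beta * p - e / 2); [lra|rewrite /gamma; field; rewrite gt_eqF].
apply/eqP; rewrite eq_le hausdorff_measure_ge0 andbT.
rewrite -(hausdorff_measure_often_large p1 fp _ gs); last by lra.
by apply: hausdorff_measureS => x [bx _];
  apply: (@beta_plus_often_large _ _ beta) => //; rewrite bx.
Qed.

End upper_bound_E_FS.

(** * Riesz products *)

Section orthogonality.
Context {R : realType}.
Local Notation mu := (@lebesgue_measure R).
Local Notation I01 := (`[0, 1]%classic : set R).
Implicit Types (t u x c : R).

Lemma Rintegral_cos_affine (k : int) c :
  (\int[mu]_(t in I01) cos (2 * pi * (k%:~R * t) + c))%R = (k == 0)%:R * cos c.
Proof.
have [->|k0] := eqVneq k 0.
  under eq_Rintegral do rewrite mul0r mulr0 add0r.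
  rewrite Rintegral_cst// mul1r [X in fine X](lebesgue_measure_itv `[0, 1])/=.
  by rewrite lte_fin ltr01 -EFinB/= subr0 mulr1.
rewrite mul0r; pose d : R := 2 * pi * k%:~R.
have d0 : d != 0 by rewrite !mulf_neq0// ?intr_eq0// gt_eqF// pi_gt0.
pose F t := sin (d * t + c) / d.
have dF t : is_derive t 1 F (cos (d * t + c)).
  have dl : is_derive t 1 (fun t : R => d * t + c) d.
    by apply: is_derive_eq; rewrite addr0 -[LHS]/(d * 1) mulr1.
  have ds := @is_derive1_comp _ (@sin R) (fun t => d * t + c) t _ _
     (is_derive_sin _) dl.
  rewrite /F; apply: is_derive_eq.
  by rewrite scaler0 add0r /GRing.scale/= mulrCA mulVf ?mulr1.
have cF : continuous F.
  by move=> t; apply: differentiable_continuous; apply/derivable1_diffP; exact: ex_derive.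
rewrite /Rintegral (@continuous_FTC2 _ _ F)//.
- have -> : F 1 = F 0.
    by rewrite /F mulr1 mulr0 add0r /d addrC sinD2piz.
  by rewrite -EFinB subrr.
- apply: continuous_subspaceT => t.
  have : derivable F t 1 by exact: ex_derive.
  move=> _; apply: (@continuous_comp _ _ _ (fun t => 2 * pi * (k%:~R * t) + c) cos).
    apply: cvgD; last exact: cvg_cst.
    apply: cvgM; first exact: cvg_cst.
    by apply: cvgM; [exact: cvg_cst|exact: cvg_id].
  exact: continuous_cos.
- split.
  + by move=> t _; exact: ex_derive.
  + by apply/cvg_at_right_filter; exact: cF.
  + by apply/cvg_at_left_filter; exact: cF.
- by move=> t _; rewrite derive1E derive_val /d mulrA.
Qed.

(** The indices l = k and l = -k of the kernel contribute one half each; for k = 0 both halves come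
    from the same index. *)
Lemma Rintegral_cos_dirichlet (k : int) n x :
  (\int[mu]_(t in I01) (cos (2 * pi * (k%:~R * t)) * dirichlet n (x - t)))%R =
  (`|k| <= n)%N%:R * cos (2 * pi * (k%:~R * x)).
Proof.
have ic (r : int) c : int01 (fun t => cos (2 * pi * (r%:~R * t) + c)).
  apply: (@int01_bounded _ _ 1); last by move=> t; exact: cos_max.
  apply: measurable_funTS; apply: continuous_measurable_fun.
  move=> t; apply: (@continuous_comp _ _ _ (fun t => 2 * pi * (r%:~R * t) + c) cos).
    apply: cvgD; last exact: cvg_cst.
    apply: cvgM; first exact: cvg_cst.
    by apply: cvgM; [exact: cvg_cst|exact: cvg_id].
  exact: continuous_cos.
transitivity (\sum_(0 <= j < (2 * n).+1) (let l := j%:Z - n%:Z in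
    2^-1 * (((k - l == 0)%:R + (k + l == 0)%:R) * cos (2 * pi * (l%:~R * x))))).
  rewrite /dirichlet; under eq_Rintegral do rewrite mulr_sumr.
  have E (j : nat) t (l := j%:Z - n%:Z) :
      cos (2 * pi * (k%:~R * t)) * cos (2 * pi * (l%:~R * (x - t))) =
      2^-1 * (cos (2 * pi * ((k - l)%:~R * t) + 2 * pi * (l%:~R * x)) +
              cos (2 * pi * ((k + l)%:~R * t) + - (2 * pi * (l%:~R * x)))).
    set a := 2 * pi * (k%:~R * t); set b := 2 * pi * _.
    rewrite (_ : _ + 2 * pi * (l%:~R * x) = a + b); last by rewrite /a /b intrB; ring.
    rewrite (_ : _ + - (2 * pi * (l%:~R * x)) = a - b); last by rewrite /a /b intrD; ring.
    by rewrite cosD cosB; field.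
  under eq_Rintegral do under eq_bigr do rewrite E.
  rewrite Rintegral01_sum; last by move=> j; apply: int01Z; exact: int01D.
  apply: eq_bigr => j _ /=; rewrite Rintegral01Z; last exact: int01D.
  rewrite Rintegral01D// !Rintegral_cos_affine cosN -mulrDl; congr (_ * ((_ + _) * _)).
pose G (l : int) := cos (2 * pi * (l%:~R * x)).
have GN l : G (- l) = G l by rewrite /G mulrNz mulNr mulrN cosN.
have pick (l : int) : \sum_(0 <= j < (2 * n).+1) (j%:Z - n%:Z == l)%:R * G (j%:Z - n%:Z) =
    (`|l| <= n)%N%:R * G l.
  have [ln|ln] := leqP `|l| n.
    have jE : (absz (l + n%:Z))%:Z - n%:Z = l by lia.
    rewrite (bigD1_seq (absz (l + n%:Z))) ?iota_uniq//=; last by rewrite mem_index_iota; lia.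
    rewrite jE eqxx big1 ?addr0// => j /eqP jl.
    case: eqP => [h|_]; last by rewrite mul0r.
    by exfalso; apply: jl; rewrite -h subrK.
  rewrite mul0r big_nat big1// => j /andP[_ jn].
  by case: eqP => [h|_]; [lia|rewrite mul0r].
have := pick k; have := pick (- k).
rewrite GN abszN => hN hP.
transitivity (2^-1 * ((`|k| <= n)%N%:R * G k + (`|k| <= n)%N%:R * G k)); last first.
  by rewrite -/(G k); field.
rewrite -{1}hP -{1}hN -big_split mulr_sumr; apply: eq_bigr => j _ /=.
rewrite -/(G _) mulrDl; congr (_ * (_%:R * _ + _%:R * _)); congr nat_of_bool; lia.
Qed.

End orthogonality.

Section riesz_products.
Context {R : realType}.
Local Notation mu := (@lebesgue_measure R).
Local Notation I01 := (`[0, 1]%classic : set R).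
Implicit Types (t u x : R) (B : pred nat).

Definition riesz B N t : R := \prod_(0 <= i < N | B i) (1 + cos (2 * pi * (2 ^+ i * t))).

(* The cosine expansion of [riesz B N] as a list of (coefficient, frequency). *)
Fixpoint riesz_spectrum B N : seq (R * int) :=
  if N is M.+1 then
    let s := riesz_spectrum B M in
    if B M then s ++ [seq (c.1 / 2, c.2 + (2 ^ M)%N%:Z) | c <- s] ++
                     [seq (c.1 / 2, c.2 - (2 ^ M)%N%:Z) | c <- s]
    else s
  else [:: (1, 0)].

Lemma riesz_spectrumP B N t :
  riesz B N t = \sum_(c <- riesz_spectrum B N) c.1 * cos (2 * pi * (c.2%:~R * t)).
Proof.
elim: N => [|N IH] /=.
  by rewrite /riesz big_nil big_seq1/= mul0r mulr0 cos0 mulr1.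
rewrite /riesz big_mkcond big_nat_recr//= -big_mkcond/= -/(riesz B N t).
case: ifP => BN; last by rewrite mulr1.
rewrite !big_cat !big_map/= mulrDr mulr1 IH; congr (_ + _).
rewrite -big_split mulr_suml; apply: eq_bigr => c _ /=.
have E : ((2 ^ N)%N%:Z)%:~R = 2 ^+ N :> R by rewrite -natrX.
set a := 2 * pi * (c.2%:~R * t); set b := 2 * pi * (2 ^+ N * t).
rewrite (_ : 2 * pi * ((c.2 + _)%:~R * t) = a + b); last by rewrite intrD E /a /b; ring.
rewrite (_ : 2 * pi * ((c.2 - _)%:~R * t) = a - b); last by rewrite intrB E /a /b; ring.
by rewrite cosD cosB; field.
Qed.

Lemma riesz_spectrum_ge0 B N : {in riesz_spectrum B N, forall c, 0 <= c.1}.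
Proof.
elim: N => [|N IH] c /=; first by rewrite inE => /eqP ->.
case: ifP => _; last exact: IH.
by rewrite !mem_cat => /or3P[/IH//|/mapP[d /IH d0 ->]|/mapP[d /IH d0 ->]]/=; rewrite divr_ge0.
Qed.

Lemma riesz_spectrum_freq B N : {in riesz_spectrum B N, forall c, (`|c.2| < 2 ^ N)%N}.
Proof.
elim: N => [|N IH] c /=; first by rewrite inE => /eqP ->.
rewrite expnS; move: (2 ^ N)%N IH => M IH.
case: ifP => _; last by move=> /IH /leq_trans; apply; lia.
rewrite !mem_cat => /or3P[/IH /leq_trans|/mapP[[w k] /IH /= kM ->]|/mapP[[w k] /IH /= kM ->]].
- by apply; lia.
- by rewrite /=; lia.
- by rewrite /=; lia.
Qed.

Lemma riesz_spectrum_sum B N :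
  \sum_(c <- riesz_spectrum B N) c.1 = 2 ^+ count B (iota 0 N).
Proof.
elim: N => [|N IH]; first by rewrite /= big_seq1.
rewrite (_ : iota 0 N.+1 = iota 0 N ++ iota N 1); last by rewrite -addn1 iotaD.
rewrite count_cat /= addn0.
case: ifP => BN; last by rewrite IH addn0.
rewrite !big_cat !big_map/= -mulr_suml IH addn1 exprS.
by field.
Qed.

(** With ratio 2, frequencies can coincide (2^(i+1) - 2^i = 2^i), but 0 arises only from the empty
    combination: the largest power used exceeds the sum of the smaller ones. *)
Lemma riesz_spectrum_sum0 B N :
  \sum_(c <- riesz_spectrum B N | c.2 == 0) c.1 = 1.
Proof.
elim: N => [|N IH] /=; first by rewrite big_mkcond big_seq1 eqxx.
case: ifP => BN //.
have zero (e : int) : absz e = (2 ^ N)%N ->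
    \sum_(c <- riesz_spectrum B N | c.2 + e == 0) c.1 / 2 = 0.
  move=> eN; rewrite big_seq_cond big1// => c /andP[/riesz_spectrum_freq cN /eqP].
  by move: (c.2) cN => k; lia.
have absN : `|- (2 ^ N)%N%:Z|%N = (2 ^ N)%N by rewrite abszN.
have abs : `|(2 ^ N)%N%:Z|%N = (2 ^ N)%N by [].
rewrite !big_cat !big_map/= IH (zero _ abs) (zero _ absN).
by rewrite !addr0.
Qed.

(** Each frequency is a signed sum of distinct powers 2^i with [B i], and [dist_int] is even and
    subadditive. *)
Lemma riesz_spectrum_dist B N x : {in riesz_spectrum B N, forall c,
  dist_int (c.2%:~R * x) <= \sum_(0 <= i < N | B i) dist_int (2 ^+ i * x)}.
Proof.
elim: N => [|N IH] c /=.
  by rewrite inE => /eqP ->/=; rewrite big_nil mul0r dist_int_abs normr0// divr_ge0.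
rewrite big_mkcond big_nat_recr//= -big_mkcond/=.
case: ifP => BN; last by rewrite addr0; exact: IH.
rewrite !mem_cat => /or3P[/IH h|/mapP[d /IH h ->]|/mapP[d /IH h ->]]/=.
- by rewrite (le_trans h)// lerDl dist_int_ge0.
- rewrite intrD mulrDl (le_trans (dist_intD _ _))// lerD//.
  by rewrite (_ : ((2 ^ N)%N%:Z)%:~R = 2 ^+ N)// -natrX.
- rewrite intrB mulrBl (le_trans (dist_intD _ _))// lerD// dist_intN.
  by rewrite (_ : ((2 ^ N)%N%:Z)%:~R = 2 ^+ N)// -natrX.
Qed.

Lemma riesz_ge0 B N t : 0 <= riesz B N t.
Proof.
by apply: prodr_ge0 => i _; have := cos_geN1 (2 * pi * (2 ^+ i * t)); lra.
Qed.

Lemma riesz_le B N t : riesz B N t <= 2 ^+ count B (iota 0 N).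
Proof.
rewrite -riesz_spectrum_sum riesz_spectrumP big_seq [leRHS]big_seq.
apply: ler_sum => c /riesz_spectrum_ge0 c0.
by rewrite -[leRHS]mulr1 ler_wpM2l// cos_le1.
Qed.

Lemma measurable_riesz B N (D : set R) : measurable_fun D (riesz B N).
Proof.
rewrite (_ : riesz B N = fun t =>
  \sum_(c <- riesz_spectrum B N) c.1 * cos (2 * pi * (c.2%:~R * t))).
  apply: measurable_sum => c; apply: measurable_funM => //; exact: measurable_cos.
by apply/funext => t; exact: riesz_spectrumP.
Qed.

Lemma rieszDz B N t (k : int) : riesz B N (t + k%:~R) = riesz B N t.
Proof.
apply: eq_bigr => i _; congr (1 + _).
rewrite [2 ^+ i * (_ + _)]mulrDr (_ : (2 : R) ^+ i * k%:~R = ((2 ^ i)%N%:Z * k)%:~R) ?cos2piDz//.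
by rewrite intrM -natrX.
Qed.

Lemma int01_riesz B N : int01 (riesz B N).
Proof.
apply: (@int01_bounded _ _ (2 ^+ count B (iota 0 N))); first exact: measurable_riesz.
by move=> t; rewrite ger0_norm ?riesz_ge0// riesz_le.
Qed.

Lemma Rintegral_riesz_dirichlet B N n x :
  (\int[mu]_(t in I01) (riesz B N t * dirichlet n (x - t)))%R =
  \sum_(c <- riesz_spectrum B N) c.1 * ((`|c.2| <= n)%N%:R * cos (2 * pi * (c.2%:~R * x))).
Proof.
have ic (c : R * int) : int01 (fun t => cos (2 * pi * (c.2%:~R * t)) * dirichlet n (x - t)).
  apply: int01_dirichlet; apply: (@int01_bounded _ _ 1); first exact: measurable_cos.
  by move=> t; exact: cos_max.
under eq_Rintegral do rewrite riesz_spectrumP mulr_suml.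
under eq_Rintegral do under eq_bigr do rewrite -mulrA.
rewrite Rintegral01_sum; last by move=> c; exact: int01Z.
by apply: eq_bigr => c _; rewrite Rintegral01Z// Rintegral_cos_dirichlet.
Qed.

Lemma Rintegral_riesz B N : (\int[mu]_(t in I01) riesz B N t)%R = 1.
Proof.
transitivity (\int[mu]_(t in I01) (riesz B N t * dirichlet 0 (0 - t)))%R.
  apply: eq_Rintegral => t _.
  by rewrite dirichletE big_geq// mulr0 addr0 mulr1.
rewrite Rintegral_riesz_dirichlet -[RHS](riesz_spectrum_sum0 B N) [RHS]big_mkcond.
apply: eq_bigr => c _; rewrite leqn0 absz_eq0.
by case: eqP => [->|_]; rewrite ?mul0r ?mulr0// mul1r cos0 mulr1.
Qed.

(** The sum, and not only each term, is bounded, because a frequency of the product combines many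
    powers of 2; an eighth of a period keeps all its cosines at least 1/2. *)
Definition nearly_periodic B x := forall N, \sum_(0 <= i < N | B i) dist_int (2 ^+ i * x) <= 1 / 8.

Lemma riesz_dirichlet_ge0 B N n x : nearly_periodic B x ->
  0 <= (\int[mu]_(t in I01) (riesz B N t * dirichlet n (x - t)))%R.
Proof.
move=> nper; rewrite Rintegral_riesz_dirichlet big_seq.
apply: sumr_ge0 => c cN; rewrite mulr_ge0//; first exact: riesz_spectrum_ge0 cN.
rewrite mulr_ge0// (le_trans _ (cos2pi_ge_half (le_trans (riesz_spectrum_dist x cN) (nper N))))//.
Qed.

Lemma riesz_dirichlet_ge B N n x : nearly_periodic B x -> (2 ^ N <= n)%N ->
  2 ^+ count B (iota 0 N) / 2 <=
  (\int[mu]_(t in I01) (riesz B N t * dirichlet n (x - t)))%R.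
Proof.
move=> nper Nn; rewrite Rintegral_riesz_dirichlet -riesz_spectrum_sum mulr_suml.
rewrite big_seq [leRHS]big_seq; apply: ler_sum => c cN.
rewrite ler_wpM2l ?(riesz_spectrum_ge0 cN)//.
rewrite (leq_trans (ltnW (riesz_spectrum_freq cN)) Nn) mul1r.
have := cos2pi_ge_half (le_trans (riesz_spectrum_dist x cN) (nper N)); lra.
Qed.

End riesz_products.

(** * Points with prescribed blocks of binary zeros *)

Section digits.
Context {R : realType}.
Implicit Types (theta t u v x : R) (s i j : nat).

Lemma ltr_pow2 (a b : R) : a < b -> 2 `^ a < 2 `^ b :> R.
Proof. by move=> ab; rewrite /powR gt_eqF// ltr_expR ltr_pM2r// ln2_gt0. Qed.

(** This is (s + 1)^3 - s^3, so that sums over stages are exact cubes. *)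
Definition stage_digits s := (3 * s ^ 2 + 3 * s + 1)%N.

(* Stage [s] occupies the binary positions from [stage_start s] on:
   3 address digits, [stage_digits s] digits shared between free digits and
   zeros, and [s + 5] further zeros. *)
Definition stage_start s := (\sum_(0 <= i < s) (stage_digits i + (i + 8)))%N.

Lemma stage_startS s : stage_start s.+1 = (stage_start s + 3 + stage_digits s + (s + 5))%N.
Proof. by rewrite /stage_start big_nat_recr//=; lia. Qed.

Lemma sum_stage_digits s : (\sum_(0 <= i < s) stage_digits i = s ^ 3)%N.
Proof.
elim: s => [|s IH]; first by rewrite big_geq.
by rewrite big_nat_recr//= IH /stage_digits; lia.
Qed.

Lemma stage_start_le s : (stage_start s <= s ^ 3 + s ^ 2 + 8 * s)%N.
Proof.
rewrite /stage_start big_split/= sum_stage_digits -addnA leq_add2l.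
elim: s => [|s IH]; first by rewrite big_geq.
by rewrite big_nat_recr//=; lia.
Qed.

Lemma leq_stage_start : {homo stage_start : s s' / (s <= s')%N}.
Proof. by apply: homo_leq => // [|s]; [exact: leq_trans|rewrite stage_startS; lia]. Qed.

Lemma stage_start_ge s : (s <= stage_start s)%N.
Proof. by elim: s => // s IH; rewrite stage_startS; lia. Qed.

(** Passing to the next stage costs O(s^2), so this step and all linear losses are absorbed by any
    increase of the slope of s^3, up to a constant. *)
Lemma stage_start_asymp (a b c : R) : 0 <= a -> a < b ->
  exists D, forall s, a * (stage_start s.+1)%:R + c * s%:R <= b * s%:R ^+ 3 + D.
Proof.
move=> a0 ab; pose d := b - a; have d0 : 0 < d by rewrite subr_gt0.
pose A := 17 * a + `|c|.
have A0 : 0 <= A by rewrite addr_ge0// mulr_ge0.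
exists (A * (A / d) ^+ 2 + 10 * a) => s.
(* [stage_start_le] gives s^3 + 4 s^2 + 13 s + 10, and s <= s^2. *)
have h1 : (stage_start s.+1)%:R <= s%:R ^+ 3 + 17 * s%:R ^+ 2 + 10 :> R.
  rewrite -!natrX -natrM -!natrD ler_nat (leq_trans (stage_start_le _))//; nia.
have h2 : c * s%:R <= `|c| * s%:R ^+ 2.
  apply: (@le_trans _ _ (`|c| * s%:R)); first by rewrite ler_wpM2r// ler_norm.
  by rewrite ler_wpM2l// -natrX ler_nat; nia.
have h3 : A * s%:R ^+ 2 <= d * s%:R ^+ 3 + A * (A / d) ^+ 2.
  have [sA|sA] := leP (s%:R) (A / d).
    have : A * s%:R ^+ 2 <= A * (A / d) ^+ 2.
      by rewrite ler_wpM2l// lerXn2r ?nnegrE// divr_ge0// ltW.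
    have : 0 <= d * s%:R ^+ 3 by rewrite mulr_ge0 ?exprn_ge0// ltW.
    by lra.
  have : A * s%:R ^+ 2 <= d * s%:R ^+ 3.
    rewrite [_ ^+ 3]exprS mulrA ler_wpM2r ?exprn_ge0//.
    by rewrite mulrC -ler_pdivrMr// ltW.
  have : 0 <= A * (A / d) ^+ 2 by rewrite mulr_ge0// exprn_ge0// divr_ge0// ltW.
  by lra.
have h4 : a * (stage_start s.+1)%:R <= a * (s%:R ^+ 3 + 17 * s%:R ^+ 2 + 10).
  by rewrite ler_wpM2l.
by move: h3; rewrite /A /d; lra.
Qed.

Section parameter.
Variable theta : R.
Hypotheses (theta0 : 0 <= theta) (theta1 : theta <= 1).

Definition zero_digits s := Num.truncn (theta * (stage_digits s)%:R).

Definition free_digits s := (stage_digits s - zero_digits s)%N.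

(** The stage is searched among s <= i to make the predicate boolean; this is no restriction since s
    <= [stage_start s]. *)
Definition zero_positions : pred nat := fun i =>
  [exists s : 'I_i.+1,
    (stage_start s + 3 + free_digits s <= i < stage_start s + 3 + stage_digits s)%N].

Lemma zero_digits_le s : (zero_digits s <= stage_digits s)%N.
Proof.
rewrite -(ler_nat R) (@le_trans _ _ (theta * (stage_digits s)%:R))//.
  by have /andP[] := truncn_itv (mulr_ge0 theta0 (ler0n R (stage_digits s))).
by rewrite -[leRHS]mul1r ler_wpM2r.
Qed.

Lemma free_digits_ge s : (1 - theta) * (stage_digits s)%:R <= (free_digits s)%:R.
Proof.
rewrite natrB ?zero_digits_le// mulrBl mul1r lerD2l lerN2.
by have /andP[] := truncn_itv (mulr_ge0 theta0 (ler0n R (stage_digits s))).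
Qed.

Lemma zero_positionP i s : (stage_start s <= i < stage_start s.+1)%N ->
  zero_positions i ->
  (stage_start s + 3 + free_digits s <= i < stage_start s + 3 + stage_digits s)%N.
Proof.
move=> /andP[si is'] /existsP[[r /= _] /andP[ri ir]].
suff -> : s = r by rewrite ri ir.
have [sr|rs|->//] := ltngtP s r.
- by have := leq_stage_start sr; lia.
- by have := leq_stage_start rs; rewrite stage_startS; lia.
Qed.

Lemma mem_zero_positions i s :
  (stage_start s + 3 + free_digits s <= i < stage_start s + 3 + stage_digits s)%N ->
  zero_positions i.
Proof.
move=> h; have si : (s < i.+1)%N by have := stage_start_ge s; lia.
by apply/existsP; exists (Ordinal si).
Qed.

(** Rounding down in [zero_digits] loses less than one position per stage, hence the term - s. *)
Lemma count_zero_positions s :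
  theta * s%:R ^+ 3 - s%:R <= (count zero_positions (iota 0 (stage_start s)))%:R.
Proof.
have H : (\sum_(0 <= i < s) zero_digits i <= count zero_positions (iota 0 (stage_start s)))%N.
  elim: s => [|s IH]; first by rewrite big_geq.
  rewrite big_nat_recr//=.
  pose m1 := (3 + free_digits s)%N.
  have fz : (free_digits s + zero_digits s = stage_digits s)%N.
    by rewrite subnK// zero_digits_le.
  have -> : stage_start s.+1 = (stage_start s + (m1 + (zero_digits s + (s + 5))))%N.
    by rewrite stage_startS /m1; lia.
  rewrite !iotaD !count_cat add0n leq_add// (leq_trans _ (leq_addl _ _))//.
  rewrite (leq_trans _ (leq_addr _ _))//.
  rewrite -[X in (X <= _)%N](size_iota (stage_start s + m1)) eq_leq//; apply/esym/eqP.
  rewrite -all_count; apply/allP => i; rewrite mem_iota => hi.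
  by apply: (@mem_zero_positions i s); move: hi; rewrite /m1; lia.
apply: (@le_trans _ _ (\sum_(0 <= i < s) zero_digits i)%:R); last by rewrite ler_nat.
elim: s {H} => [|s IH]; first by rewrite big_geq// expr0n/= mulr0 subrr.
rewrite big_nat_recr//= natrD.
have := truncnS_gt (theta * (stage_digits s)%:R); rewrite -/(zero_digits s) -natr1.
have -> : (stage_digits s)%:R = s.+1%:R ^+ 3 - s%:R ^+ 3 :> R.
  rewrite -!natrX -natrB ?leq_exp2r//; congr _%:R; rewrite /stage_digits; lia.
by rewrite -(natr1 s); lra.
Qed.

Definition free_count s := (\sum_(0 <= i < s) free_digits i)%N.

Lemma free_count_ge s : (1 - theta) * s%:R ^+ 3 <= (free_count s)%:R.
Proof.
rewrite -natrX -sum_stage_digits natr_sum mulr_sumr natr_sum.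
by apply: ler_sum => i _; exact: free_digits_ge.
Qed.

Variable address : nat -> bool.

(** For u in [0, 1), the first [free_count s] binary digits of u, read as an integer. *)
Definition prefix s u := Num.truncn (2 ^+ free_count s * u).

(** The [free_digits s] next digits of u, those written in stage s. *)
Definition block s u := (prefix s.+1 u - 2 ^ free_digits s * prefix s u)%N.

(* The address bit decides on which side of 1/2 the point lies at scale
   2^-(stage_start s), and the middle term 1/8 keeps it away from the jumps of
   [lower_half]. *)
Definition stage_value s u : R :=
  (address s)%:R / 2 + 1 / 8 + (block s u)%:R * 2 ^- (3 + free_digits s).

Definition point_upto s u := \sum_(0 <= i < s) 2 ^- stage_start i * stage_value i u.

Definition digit_point u := sup (range (point_upto^~ u)).

Lemma prefixS s u : 0 <= u ->
  (2 ^ free_digits s * prefix s u <= prefix s.+1 u < 2 ^ free_digits s * (prefix s u).+1)%N.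
Proof.
move=> u0; pose y := 2 ^+ free_count s * u.
have y0 : 0 <= y by rewrite mulr_ge0// exprn_ge0.
have E : 2 ^+ free_count s.+1 * u = 2 ^+ free_digits s * y.
  by rewrite /free_count big_nat_recr//= addnC exprD -mulrA.
have e0 : 0 < 2 ^+ free_digits s :> R by rewrite exprn_gt0.
rewrite /prefix E -/y; have /andP[h1 h2] := truncn_itv y0.
have ey0 : 0 <= 2 ^+ free_digits s * y by rewrite mulr_ge0// ltW.
rewrite truncn_ge_nat// truncn_lt_nat// !natrM natrX.
by rewrite ler_wpM2l// ?(ltW e0)// ltr_pM2l.
Qed.

Lemma block_lt s u : 0 <= u -> (block s u < 2 ^ free_digits s)%N.
Proof. by move=> /(prefixS s); rewrite /block mulnS; lia. Qed.

Lemma stage_value_bounds s u : 0 <= u ->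
  (address s)%:R / 2 + 1 / 8 <= stage_value s u <=
  (address s)%:R / 2 + 1 / 4 - 2 ^- (3 + free_digits s).
Proof.
move=> u0; have e0 : 0 < 2 ^- (3 + free_digits s) :> R by rewrite invr_gt0 exprn_gt0.
rewrite /stage_value lerDl mulr_ge0 ?(ltW e0)//=.
have h : (block s u)%:R + 1 <= 2 ^+ free_digits s :> R.
  by rewrite natr1 -natrX ler_nat block_lt.
have : ((block s u)%:R + 1) * 2 ^- (3 + free_digits s) <= 1 / 8 :> R.
  apply: (le_trans (ler_wpM2r (ltW e0) h)).
  by rewrite exprD invfM mulrCA mulfV ?mulr1 ?expf_neq0//; lra.
by lra.
Qed.

Lemma stage_start_expS s : 2 ^- stage_start s.+1 <= 2 ^- stage_start s / 256 :> R.
Proof.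
rewrite (_ : 256 = 2 ^+ 8 :> R); last by rewrite -natrX.
rewrite -invfM -exprD lef_pV2 ?posrE ?exprn_gt0//.
by rewrite ler_eXn2l ?ltr1n// stage_startS; lia.
Qed.

(** A stage value is below 3/4 and the next stage is at least 2^8 times finer, so 3/4 + (7/8) / 256
    <= 7/8 closes the induction. The constant being less than 1, later stages never carry into
    earlier ones. *)
Lemma point_upto_le s k u : 0 <= u ->
  point_upto (s + k) u <= point_upto s u + 2 ^- stage_start s * (7 / 8).
Proof.
move=> u0; have e0 i : 0 < 2 ^- stage_start i :> R by rewrite invr_gt0 exprn_gt0.
elim: k s => [|k IH] s; first by rewrite addn0 lerDl mulr_ge0// ltW.
rewrite addnS -addSn (le_trans (IH _))//.
rewrite {1}/point_upto big_nat_recr//= -/(point_upto s u) -addrA lerD2l.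
have /andP[_ h] := stage_value_bounds s u0.
have := stage_start_expS s.
have b1 : (address s)%:R <= 1 :> R by case: (address s).
have : 2 ^- stage_start s * stage_value s u <= 2 ^- stage_start s * (3 / 4).
  rewrite ler_wpM2l ?(ltW (e0 s))//.
  have : 0 < 2 ^- (3 + free_digits s) :> R by rewrite invr_gt0 exprn_gt0.
  by lra.
by have := e0 s; lra.
Qed.

Lemma point_upto_mono s k u : 0 <= u -> point_upto s u <= point_upto (s + k) u.
Proof.
move=> u0; elim: k => [|k IH]; first by rewrite addn0.
rewrite addnS (le_trans IH)// {2}/point_upto big_nat_recr//= lerDl.
rewrite mulr_ge0 ?invr_ge0 ?exprn_ge0//.
have /andP[h _] := stage_value_bounds (s + k) u0; apply: le_trans h.
by rewrite addr_ge0.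
Qed.

Lemma point_bounds s u : 0 <= u ->
  point_upto s u <= digit_point u <= point_upto s u + 2 ^- stage_start s * (7 / 8).
Proof.
move=> u0.
have ub : ubound (range (point_upto^~ u)) (point_upto s u + 2 ^- stage_start s * (7 / 8)).
  move=> _ [k _ <-]; apply: le_trans (point_upto_le s k u0).
  by rewrite addnC; exact: point_upto_mono.
apply/andP; split.
  by apply: ub_le_sup; [exists (point_upto s u + 2 ^- stage_start s * (7 / 8))|exists s].
by apply: ge_sup => //; exists (point_upto 0 u), 0%N.
Qed.

Lemma point_upto_int s u i : (stage_start s + 3 + free_digits s <= i)%N ->
  2 ^+ i * point_upto s.+1 u \is a Num.int.
Proof.
have e2 k l : (l <= k)%N -> 2 ^+ k * 2 ^- l = 2 ^+ (k - l) :> R.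
  by move=> lk; rewrite -{1}(subnK lk) exprD mulfK// expf_neq0.
have int2 k : (2 : R) ^+ k \is a Num.int by rewrite -natrX; exact: natr_int.
move=> si; rewrite /point_upto mulr_sumr big_nat; apply: rpred_sum => j /andP[_ js].
have ji : (stage_start j + 3 + free_digits j <= i)%N.
  move: js; rewrite ltnS leq_eqVlt => /predU1P[->//|/leq_stage_start].
  by rewrite stage_startS /free_digits; lia.
rewrite (_ : _ * _ = (address j)%:R * (2 ^+ i * 2 ^- (stage_start j + 1)) +
    2 ^+ i * 2 ^- (stage_start j + 3) +
    (block j u)%:R * (2 ^+ i * 2 ^- (stage_start j + 3 + free_digits j))).
  by rewrite !e2 ?rpredD ?rpredM ?natr_int//; lia.
rewrite /stage_value !exprD.
have h k : (2 : R) ^+ k != 0 by rewrite expf_neq0.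
by field; rewrite !h.
Qed.

(** Past the free digits of stage s, multiplication by 2^i makes all stages up to s integral; only
    the tail of the later stages remains. *)
Lemma dist_int_point s u i : 0 <= u -> (stage_start s + 3 + free_digits s <= i)%N ->
  dist_int (2 ^+ i * digit_point u) <= 2 ^+ i * 2 ^- stage_start s.+1.
Proof.
move=> u0 si; have /andP[h1 h2] := point_bounds s.+1 u0.
rewrite -(subrKC (2 ^+ i * point_upto s.+1 u) (2 ^+ i * digit_point u)).
rewrite (le_trans (dist_intD _ _))// (dist_int_int (point_upto_int u si)) add0r.
rewrite (le_trans (dist_int_norm _))// -mulrBr normrM ger0_norm ?exprn_ge0//.
rewrite ler_wpM2l ?exprn_ge0// ger0_norm; last by rewrite subr_ge0.
have : 0 < 2 ^- stage_start s.+1 :> R by rewrite invr_gt0 exprn_gt0.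
by lra.
Qed.

(** The bounds double from one position to the next, so a block sums to at most 2^(its end - next
    stage start). The s + 5 zeros that follow it make this 2^-(s+5), and the sum over all stages is
    at most 1/16. *)
Lemma sum_zero_positions_dist u S : 0 <= u ->
  \sum_(0 <= i < stage_start S | zero_positions i) dist_int (2 ^+ i * digit_point u) <=
  1 / 16 - 2 ^- (S + 4).
Proof.
move=> u0; elim: S => [|S IH].
  by rewrite /stage_start big_geq// big_geq// add0n; lra.
have leS : (stage_start S <= stage_start S.+1)%N by apply: leq_stage_start.
rewrite (@big_cat_nat _ _ _ (stage_start S))//=.
pose e := (stage_start S + 3 + stage_digits S)%N.
have eS : (stage_start S <= e <= stage_start S.+1)%N by rewrite stage_startS /e; lia.
have H : \sum_(stage_start S <= i < stage_start S.+1 | zero_positions i)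
    dist_int (2 ^+ i * digit_point u) <= 2 ^- (S + 5).
  apply: (@le_trans _ _ (\sum_(stage_start S <= i < e) 2 ^+ i * 2 ^- stage_start S.+1)).
    case/andP: eS => eS1 eS2.
    rewrite (@big_cat_nat _ _ _ e)//= [X in _ + X]big_nat_cond [X in _ + X]big1 ?addr0; last first.
      move=> i /andP[/andP[ei iS] /zero_positionP h].
      by have := h S; rewrite iS (leq_trans eS1 ei) => /(_ isT); rewrite -/e ltnNge ei andbF.
    rewrite big_mkcond big_nat [leRHS]big_nat; apply: ler_sum => i /andP[Si ie].
    case: ifP => zi; last by rewrite mulr_ge0 ?invr_ge0 ?exprn_ge0.
    apply: dist_int_point => //.
    by have /andP[] := @zero_positionP i S ltac:(lia) zi.
  rewrite -mulr_suml ler_pdivrMr ?exprn_gt0//.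
  have -> : 2 ^- (S + 5) * 2 ^+ stage_start S.+1 = 2 ^+ e :> R.
    by rewrite stage_startS -/e [2 ^+ (e + _)]exprD mulrC mulfK// expf_neq0.
  rewrite (eq_bigr (fun i => 2 ^+ i.+1 - 2 ^+ i)); last by move=> i _; rewrite exprS; ring.
  case/andP: eS => eS1 _; rewrite telescope_sumr//.
  by rewrite lerBlDr lerDl exprn_ge0.
have := IH; have : 2 ^- (S + 4) = 2 * 2 ^- (S + 5) :> R.
  by rewrite (addnS S 4) exprS invfM mulrA mulfV ?mul1r.
have -> : (S.+1 + 4 = S + 5)%N by lia.
by lra.
Qed.

Lemma point_nearly_periodic u : 0 <= u -> nearly_periodic zero_positions (digit_point u).
Proof.
move=> u0 N.
apply: (@le_trans _ _
  (\sum_(0 <= i < stage_start N | zero_positions i) dist_int (2 ^+ i * digit_point u))).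
  rewrite [leRHS](@big_cat_nat _ _ _ N)//=; last exact: stage_start_ge.
  by rewrite lerDl sumr_ge0// => i _; exact: dist_int_ge0.
apply: le_trans (sum_zero_positions_dist N u0) _.
by have : 0 <= 2 ^- (N + 4) :> R; [rewrite invr_ge0 exprn_ge0|lra].
Qed.

Definition lower_half j t :=
  2 ^+ stage_start j * t - (Num.floor (2 ^+ stage_start j * t))%:~R < 1 / 2 :> R.

(** At scale 2^-(stage_start j) the point has fractional part [w] in [1/8, 1/4) or [5/8, 3/4)
    according to the address bit, at least 1/8 away from the jumps at 0 and 1/2; the displacement
    [r] is less than that. *)
Lemma lower_half_point u j t : 0 <= u -> dist_int (digit_point u - t) < 2 ^- stage_start j / 8 ->
  lower_half j t = ~~ address j.
Proof.
move=> u0; have [k _ ->] := dist_int_near (digit_point u - t) => kt.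
have e0 : 0 < 2 ^+ stage_start j :> R by rewrite exprn_gt0.
have /andP[h1 h2] := point_bounds j.+1 u0.
have := stage_start_expS j.
have E : point_upto j.+1 u = point_upto j u + 2 ^- stage_start j * stage_value j u.
  by rewrite /point_upto big_nat_recr.
have f0 : 2 ^- stage_start j.+1 <= 2 ^- stage_start j * 2 ^- (3 + free_digits j) :> R.
  rewrite -invfM -exprD lef_pV2 ?posrE ?exprn_gt0// ler_eXn2l ?ltr1n//.
  by rewrite stage_startS /free_digits; lia.
have /andP[v1 v2] := stage_value_bounds j u0.
have g0 : 0 < 2 ^- (3 + free_digits j) :> R by rewrite invr_gt0 exprn_gt0.
have e1 : 0 < 2 ^- stage_start j :> R by rewrite invr_gt0.
have /intrP[z Ez] : 2 ^+ stage_start j * point_upto j u \is a Num.int.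
  case: j {kt h1 h2 e0 E f0 v1 v2 g0 e1} => [|j]; first by rewrite /point_upto big_geq// mulr0.
  by apply: point_upto_int; rewrite stage_startS /free_digits; lia.
move=> _.
pose r := 2 ^+ stage_start j * (digit_point u - t - k%:~R).
have r8 : `|r| < 1 / 8.
  rewrite /r normrM gtr0_norm// mulrC -ltr_pdivlMr// (lt_le_trans kt)//.
  by rewrite mulrC mul1r.
pose w := 2 ^+ stage_start j * (digit_point u - point_upto j u).
have [w1 w2] : (address j)%:R / 2 + 1 / 8 <= w /\ w < (address j)%:R / 2 + 1 / 4.
  have ee : 2 ^+ stage_start j * 2 ^- stage_start j = 1 :> R by rewrite mulfV// gt_eqF.
  split.
    apply: (le_trans v1); rewrite -[leLHS]mul1r -ee -mulrA /w ler_wpM2l ?(ltW e0)//.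
    by rewrite lerBrDl -E.
  apply: (@lt_le_trans _ _ (stage_value j u + 2 ^- (3 + free_digits j))); last by lra.
  rewrite /w -[ltRHS]mul1r -[X in _ < X * _]ee -mulrA ltr_pM2l//.
  rewrite mulrDr ltrBlDl addrA -E (le_lt_trans h2)// ltrD2l (lt_le_trans _ f0)//.
  by have : 0 < 2 ^- stage_start j.+1 :> R; [rewrite invr_gt0 exprn_gt0|lra].
pose K : int := (2 ^ stage_start j)%N%:Z * k.
have Et : 2 ^+ stage_start j * t = (z - K)%:~R + (w - r).
  rewrite intrB intrM -Ez (_ : ((2 ^ stage_start j)%N%:Z)%:~R = 2 ^+ stage_start j :> R).
    by rewrite /w /r; ring.
  by rewrite -natrX.
have a01 : (address j)%:R = 0 :> R \/ (address j)%:R = 1 :> R.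
  by case: (address j); [right|left].
move: r8; rewrite ltr_norml => /andP[r1 r2].
have fl : Num.floor (2 ^+ stage_start j * t) = z - K.
  apply: floor_def; rewrite Et [(z - K + 1)%:~R]intrD.
  by case: a01 => a; rewrite a in w1 w2; lra.
rewrite /lower_half fl Et addrAC subrr add0r.
case: (address j) w1 w2 {a01 v1 v2} => /= w1 w2; last by lra.
by apply/negbTE; rewrite -leNgt; lra.
Qed.

Lemma prefix0 u : 0 <= u < 1 -> prefix 0 u = 0%N.
Proof.
move=> /andP[u0 u1]; rewrite /prefix /free_count big_geq// expr0 mul1r.
by apply: truncn_def; rewrite u0.
Qed.

Lemma eq_prefix_dist s u v : 0 <= u -> 0 <= v -> prefix s u = prefix s v ->
  `|u - v| <= 2 ^- free_count s.
Proof.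
move=> u0 v0 uv; have e0 : 0 < 2 ^+ free_count s :> R by rewrite exprn_gt0.
have := truncn_itv (mulr_ge0 (ltW e0) u0); have := truncn_itv (mulr_ge0 (ltW e0) v0).
rewrite -/(prefix s u) -/(prefix s v) uv -natr1 => /andP[v1 v2] /andP[u1 u2].
rewrite -[leRHS]div1r ler_pdivlMr// -[X in _ * X](gtr0_norm e0) -normrM mulrBl.
by rewrite ler_norml !(mulrC _ (2 ^+ _)); apply/andP; split; lra.
Qed.

(** Take the first stage whose blocks differ. The earlier free digits agree, which bounds |u - v|;
    the blocks separate the points by at least 2 * 2^-(stage_start s.+1), of which the tails take
    back at most one half. *)
Lemma dist_int_point_ge u v : theta < 1 -> 0 <= u < 1 -> 0 <= v < 1 -> u != v ->
  exists s, `|u - v| <= 2 ^- free_count s /\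
    2 ^- stage_start s.+1 <= dist_int (digit_point u - digit_point v).
Proof.
move=> th1 /[dup] u01 /andP[u0 u1] /[dup] v01 /andP[v0 v1] uv.
have ex : exists s, prefix s u != prefix s v.
  apply: contrapT => alleq; have uv0 : 0 < `|u - v| by rewrite normr_gt0 subr_eq0.
  have th0 : 0 < 1 - theta by rewrite subr_gt0.
  have [M M1 small] := @pow2_decay R 1 (1 - theta) `|u - v| 1 th0 uv0.
  have eqM : prefix M.+1 u = prefix M.+1 v.
    by apply/eqP/negPn/negP => neq; apply: alleq; exists M.+1.
  have := eq_prefix_dist u0 v0 eqM; rewrite leNgt => /negP; apply.
  apply: lt_le_trans small; rewrite mul1r pow2N ltf_pV2 ?posrE ?exprn_gt0 ?pow2_gt0//.
  rewrite -pow2n; apply: ltr_pow2; rewrite (lt_le_trans _ (free_count_ge M.+1))//.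
  rewrite mulrC ltr_pM2l// -natrX ltr_nat; nia.
case: (ex_minnP ex) => [[|s]]; first by rewrite !prefix0// eqxx.
move=> neq smin; exists s.
have eqs i : (i <= s)%N -> prefix i u = prefix i v.
  move=> ile; apply/eqP/negPn/negP => /smin; lia.
split; first exact: eq_prefix_dist (eqs s (leqnn s)).
have eqp : point_upto s u = point_upto s v.
  rewrite /point_upto big_nat [RHS]big_nat; apply: eq_bigr => i /andP[_ ile].
  by rewrite /stage_value /block (eqs i.+1)// (eqs i)// ltnW.
have blk : block s u != block s v.
  rewrite /block (eqs s)//; apply/negP => /eqP h; move/negP: neq; apply; apply/eqP.
  have /andP[a1 _] := prefixS s u0; have /andP[b1 _] := prefixS s v0.
  by move: a1 b1 h; rewrite (eqs s)//; lia.
have /andP[p1 p2] := point_bounds s.+1 u0; have /andP[q1 q2] := point_bounds s.+1 v0.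
have E w : point_upto s.+1 w = point_upto s w + 2 ^- stage_start s * stage_value s w.
  by rewrite /point_upto big_nat_recr.
have e0 : 0 < 2 ^- stage_start s.+1 :> R by rewrite invr_gt0 exprn_gt0.
have gap : 2 * 2 ^- stage_start s.+1 <= `|point_upto s.+1 u - point_upto s.+1 v|.
  rewrite !E eqp opprD addrACA subrr add0r -mulrBr /stage_value.
  rewrite opprD addrACA subrr add0r -mulrBl !normrM.
  have gp k : `|2 ^- k| = 2 ^- k :> R by rewrite gtr0_norm// invr_gt0 exprn_gt0.
  rewrite !gp; have : 1 <= `|(block s u)%:R - (block s v)%:R : R|.
    rewrite (_ : _ - _ = ((block s u)%:Z - (block s v)%:Z)%:~R); last by rewrite intrB.
    rewrite -intr_norm (_ : 1 = 1%:~R)// ler_int; move/eqP: blk; lia.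
  move=> h; apply: (@le_trans _ _ (2 ^- stage_start s * (1 * 2 ^- (3 + free_digits s)))).
    rewrite mul1r -invfM -exprD -[X in X * _]invrK -invfM.
    rewrite lef_pV2 ?posrE ?mulr_gt0 ?invr_gt0 ?exprn_gt0//.
    rewrite mulrC ler_pdivlMr// -exprSr ler_eXn2l ?ltr1n//.
    by rewrite stage_startS /free_digits; lia.
  by rewrite ler_wpM2l ?ler_wpM2r ?invr_ge0 ?exprn_ge0.
rewrite dist_int_abs.
  have := ler_normD (digit_point u - digit_point v)
    ((point_upto s.+1 u - digit_point u) - (point_upto s.+1 v - digit_point v)).
  rewrite (_ : digit_point u - digit_point v + _ = point_upto s.+1 u - point_upto s.+1 v); last by ring.
  move=> h.
  have : `|point_upto s.+1 u - digit_point u - (point_upto s.+1 v - digit_point v)| <= 2 ^- stage_start s.+1.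
    by rewrite ler_norml; apply/andP; split; lra.
  by lra.
(* The distance on the circle is the one on the line: stage 0 has the same address bit for both
   points and so puts them within 1/2 of each other. *)
have /andP[x1 x2] := point_bounds 1 u0; have /andP[y1 y2] := point_bounds 1 v0.
have F w : point_upto 1 w = stage_value 0 w.
  by rewrite /point_upto big_nat1 /stage_start big_geq// expr0 invr1 mul1r.
have /andP[a1 a2] := stage_value_bounds 0 u0; have /andP[b1 b2] := stage_value_bounds 0 v0.
have := stage_start_expS 0; rewrite {2}/stage_start big_geq// expr0 invr1.
have : 0 < 2 ^- (3 + free_digits 0) :> R by rewrite invr_gt0 exprn_gt0.
rewrite !F in x1 x2 y1 y2.
by move=> ? ?; rewrite ler_norml; apply/andP; split; lra.
Qed.

(** If the digits first differ in stage r, then |u - v| is at most 2^-((1 - theta) r^3), while the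
    points are 2^-(r^3 + O(r^2)) apart; the ratio of the exponents tends to 1 - theta. *)
Lemma point_hoelder (s : R) : 0 <= s -> s < 1 - theta -> exists2 C, 0 < C &
  forall u v, 0 <= u < 1 -> 0 <= v < 1 ->
    `|u - v| <= C * dist_int (digit_point u - digit_point v) `^ s.
Proof.
move=> s0 st; have [D asymp] := stage_start_asymp 0 s0 st.
exists (2 `^ D); first exact: pow2_gt0.
move=> u v u01 v01; have [->|uv] := eqVneq u v.
  by rewrite !subrr normr0 mulr_ge0 ?powR_ge0.
have th1 : theta < 1 by lra.
have [r [uvr dr]] := dist_int_point_ge th1 u01 v01 uv.
rewrite (le_trans uvr)//.
have e0 : 0 <= 2 ^- stage_start r.+1 :> R by rewrite invr_ge0 exprn_ge0.
apply: (@le_trans _ _ (2 `^ D * (2 ^- stage_start r.+1) `^ s)); last first.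
  by rewrite ler_wpM2l ?pow2_ge0// ge0_ler_powR// nnegrE (le_trans e0).
rewrite -!pow2n -!pow2N -powRrM -pow2D ler_pow2//.
by have := asymp r; have := free_count_ge r; lra.
Qed.

End parameter.
End digits.

(** * The multifractal series *)

Section Lp_series.
Context {R : realType}.
Local Notation mu := (@lebesgue_measure R).
Local Notation I01 := (`[0, 1]%classic : set R).
Variables (p : R) (g : nat -> R -> R).
Hypotheses (p1 : 1 <= p) (g0 : forall s t, 0 <= g s t).
Hypothesis mg : forall s, measurable_fun I01 (g s).
Hypothesis gfin : (\sum_(s <oo) \int[mu]_(t in I01) ((2 ^+ s.+1 * g s t) `^ p)%:E < +oo)%E.

Let p0 : 0 < p. Proof. exact: lt_le_trans p1. Qed.

(** [fine] assigns 0 where the series diverges, which by the summability hypothesis is a null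
    set. *)
Definition series_fun t := fine (\sum_(s <oo) (g s t)%:E)%E.

(* The weights 2^-(s+1) add up to 1, so sum_s g_s <= sup_s 2^(s+1) g_s, whose
   p-th power is at most the following function. *)
Let H t := (\sum_(s <oo) ((2 ^+ s.+1 * g s t) `^ p)%:E)%E.

Let mHs s : measurable_fun I01 (fun t => ((2 ^+ s.+1 * g s t) `^ p)%:E).
Proof.
apply/measurable_EFinP; apply: (measurableT_comp (measurable_powR p)).
exact: measurable_funM.
Qed.

Let H_ge0 t : (0 <= H t)%E.
Proof. by apply: nneseries_ge0 => s _ _; rewrite lee_fin powR_ge0. Qed.

Let mH : measurable_fun I01 H.
Proof.
by apply: ge0_emeasurable_sum => // s t _ _; rewrite lee_fin powR_ge0.
Qed.

Let iH : mu.-integrable I01 H.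
Proof.
apply/integrableP; split => //.
under eq_integral do rewrite (gee0_abs (H_ge0 _)).
by rewrite /H integral_nneseries// => s t _; rewrite lee_fin powR_ge0.
Qed.

Let partial_le t n : H t \is a fin_num -> \sum_(0 <= s < n) g s t <= fine (H t) `^ p^-1.
Proof.
move=> fH; set h := fine (H t).
have h0 : 0 <= h by rewrite fine_ge0.
have gs s : g s t <= 2 ^- s.+1 * h `^ p^-1.
  have : (2 ^+ s.+1 * g s t) `^ p <= h.
    rewrite -lee_fin fineK//.
    have pos n' : (0 <= ((2 ^+ n'.+1 * g n' t) `^ p)%:E)%E by rewrite lee_fin powR_ge0.
    have lim : (\sum_(0 <= i < s.+1) ((2 ^+ i.+1 * g i t) `^ p)%:E <= H t)%E.
      exact: nneseries_lim_ge.
    by apply: le_trans lim; rewrite big_nat_recr//= leeDr// sume_ge0.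
  have e0 : 0 < 2 ^+ s.+1 :> R by rewrite exprn_gt0.
  have y0 : 0 <= 2 ^+ s.+1 * g s t by rewrite mulr_ge0// ltW.
  move=> hs; rewrite mulrC ler_pdivlMr// mulrC.
  rewrite -[leLHS](powRr1 y0) -[X in _ `^ X <= _](mulfV (lt0r_neq0 p0)) powRrM.
  by apply: ge0_ler_powR; rewrite ?nnegrE ?powR_ge0 ?invr_ge0 ?(ltW p0).
apply: (@le_trans _ _ (\sum_(0 <= s < n) 2 ^- s.+1 * h `^ p^-1)).
  by apply: ler_sum => s _; exact: gs.
rewrite -mulr_suml -[leRHS]mul1r ler_wpM2r ?powR_ge0//.
have : \sum_(0 <= s < n) 2 ^- s.+1 = 1 - 2 ^- n :> R.
  elim: n => [|n IH]; first by rewrite big_geq// expr0 invr1 subrr.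
  by rewrite big_nat_recr//= IH exprS invfM; lra.
by move=> ->; rewrite lerBlDr lerDl invr_ge0 exprn_ge0.
Qed.

Let sum_le t : H t \is a fin_num -> (\sum_(s <oo) (g s t)%:E <= (fine (H t) `^ p^-1)%:E)%E.
Proof.
move=> fH; apply: lime_le.
  by apply: is_cvg_nneseries => s _ _; rewrite lee_fin.
by apply: nearW => n; rewrite sumEFin lee_fin partial_le.
Qed.

Let sum_ge0 t : (0 <= \sum_(s <oo) (g s t)%:E)%E.
Proof. by apply: nneseries_ge0 => s _ _; rewrite lee_fin. Qed.

Lemma series_fun_ge0 t : 0 <= series_fun t.
Proof. by rewrite /series_fun fine_ge0. Qed.

Lemma measurable_series_fun : measurable_fun I01 series_fun.
Proof.
apply: (@measurableT_comp _ _ _ _ _ _ fine); first exact: fine_measurable.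
apply: ge0_emeasurable_sum => [s t _ _|s _]; first by rewrite lee_fin.
exact/measurable_EFinP.
Qed.

Lemma series_fun_Lp : (\int[mu]_(t in I01) (series_fun t `^ p)%:E < +oo)%E.
Proof.
have /integrableP[_] := iH; apply: le_lt_trans; apply: ge0_le_integral => //.
- by move=> t _; rewrite lee_fin powR_ge0.
- apply/measurable_EFinP; apply: (measurableT_comp (measurable_powR p)).
  exact: measurable_series_fun.
- exact: measurableT_comp.
move=> t _; rewrite gee0_abs//.
have [fH|] := boolP (H t \is a fin_num); last first.
  by rewrite ge0_fin_numE// -leNgt leye_eq => /eqP ->; rewrite leey.
have := sum_le fH => sle.
rewrite -[leRHS](fineK fH) lee_fin.
have h0 : 0 <= fine (H t) by rewrite fine_ge0.
apply: (@le_trans _ _ ((fine (H t) `^ p^-1) `^ p)); last first.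
  by rewrite -powRrM mulVf ?gt_eqF// powRr1.
apply: ge0_ler_powR; rewrite ?nnegrE ?powR_ge0 ?series_fun_ge0 ?(ltW p0)//.
by rewrite -lee_fin /series_fun fineK// ge0_fin_numE// (le_lt_trans sle)// ltry.
Qed.

(** Dominated convergence: wherever H is finite, all partial sums are at most H^(1/p) <= 1 + H,
    which is integrable. *)
Lemma series_fun_integral_ge (b : R -> R) (B c : R) N : 0 < B ->
  measurable_fun I01 b -> (forall t, `|b t| <= B) ->
  (forall n, (N <= n)%N ->
    c <= (\int[mu]_(t in I01) ((\sum_(0 <= s < n) g s t) * b t))%R) ->
  c <= (\int[mu]_(t in I01) (series_fun t * b t))%R.
Proof.
move=> B0 mb bB cn.
have mI : measurable I01 by exact: measurable_itv.
pose F n t := (((\sum_(0 <= s < n) g s t) * b t)%:E : \bar R).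
have mF n : measurable_fun I01 (F n).
  by apply/measurable_EFinP; apply: measurable_funM => //; exact: measurable_sum.
have mlim : measurable_fun I01 (fun t => (series_fun t * b t)%:E).
  by apply/measurable_EFinP; apply: measurable_funM => //; exact: measurable_series_fun.
have idom : mu.-integrable I01 (fun t => B%:E * (1%:E + H t))%E.
  apply: integrableZl => //; apply: integrableD => //.
  by apply: (@int01_bounded _ _ 1) => // t; rewrite normr1.
have cvgF : {ae mu, forall t, I01 t -> F ^~ t @ \oo --> (series_fun t * b t)%:E}.
  have := @integrable_ae _ _ _ mu I01 mI H iH; apply: filterS => t /[apply] fH.
  have pos s (_ : (0 <= s)%N) (_ : true) : (0 <= (g s t)%:E)%E by rewrite lee_fin.
  have := is_cvg_nneseries pos.
  have sfin : (\sum_(s <oo) (g s t)%:E)%E \is a fin_num.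
    by rewrite ge0_fin_numE// (le_lt_trans (sum_le fH))// ltry.
  rewrite -(fineK sfin) => /fine_cvgP[_ cv].
  apply: cvg_EFin; first exact: nearW.
  rewrite /=; apply: cvgMl; apply: cvg_trans cv.
  by apply: near_eq_cvg; apply: nearW => n; rewrite /= sumEFin.
have domP n t : (`|F n t| <= B%:E * (1%:E + H t))%E.
  have [fH|] := boolP (H t \is a fin_num); last first.
    rewrite ge0_fin_numE// -leNgt leye_eq => /eqP ->.
    by rewrite addey// gt0_muley ?lte_fin// leey.
  rewrite -(fineK fH) -EFinD -EFinM abse_EFin lee_fin normrM mulrC ler_pM//.
  have h0 : 0 <= fine (H t) by rewrite fine_ge0.
  rewrite ger0_norm ?sumr_ge0// (le_trans (partial_le n fH))//.
  have [h1|h1] := leP (fine (H t)) 1.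
    apply: (@le_trans _ _ (1 `^ p^-1)); last by rewrite powR1 lerDl.
    by apply: ge0_ler_powR; rewrite ?nnegrE ?invr_ge0 ?(ltW p0).
  rewrite ler_wpDl// -[leRHS]powRr1// ler_powR// ?(ltW h1)//.
  by rewrite invf_le1.
have dom : {ae mu, forall t n, I01 t -> (`|F n t| <= B%:E * (1%:E + H t))%E}.
  exact: aeW.
have [ilim _ cvgI] := @dominated_convergence _ _ _ mu I01 mI F _ _ mF mlim cvgF idom dom.
have iF n : mu.-integrable I01 (F n).
  apply: (@le_integrable _ _ _ mu I01 mI _ _ (mF n) _ idom) => t _.
  rewrite (le_trans (domP n t))//.
  exact: lee_abs.
rewrite -lee_fin /Rintegral fineK; last exact: integrable_fin_num.
rewrite -(cvg_lim _ cvgI)//; apply: lime_ge; first exact: cvgP cvgI.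
exists N => // n /= Nn; have := cn n Nn; rewrite -lee_fin /Rintegral fineK//.
exact: (@integrable_fin_num _ _ _ mu I01 mI (F n) (iF n)).
Qed.

End Lp_series.

Section construction.
Context {R : realType}.
Local Notation mu := (@lebesgue_measure R).
Local Notation I01 := (`[0, 1]%classic : set R).
Variables (p : R) (th : nat -> R).
Hypotheses (p1 : 1 <= p) (th0 : forall j, 0 <= th j) (th1 : forall j, th j <= 1).
Implicit Types (s j n : nat) (t x : R).

Let p0 : 0 < p. Proof. exact: lt_le_trans p1. Qed.

Local Notation zeros j := (zero_positions (th j)).

Definition peak j s : R := 2 ^+ count (zeros j) (iota 0 (stage_start s)).

(** 16^-s pays for two factors s <= 2^s and for the weight 2^(s+1) of the series, and leaves a
    summable 2^-s; the 64 reduces the localization constant 16 to 1/4. *)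
Definition damping s : R := 16 ^- s / 64.

(* A Riesz product has mean 1 and maximum [peak], so multiplying it by
   peak^(1/p - 1) makes its L^p norm at most 1 and its maximum peak^(1/p). *)
Definition amplitude j s : R :=
  2 ^- stage_start j * damping s * peak j s `^ (p^-1 - 1).

Definition piece j s t : R := (lower_half j t : nat)%:R * riesz (zeros j) (stage_start s) t.

(** The constant 1 in term 0 keeps the partial sums of f at least 1/2 in spite of the localization
    errors, whose total is at most 1/2. *)
Definition term s t : R :=
  (s == 0%N)%:R + \sum_(0 <= j < s) amplitude j s * piece j s t.

Lemma measurable_lower_half j (D : set R) :
  measurable_fun D (fun t : R => (lower_half j t : nat)%:R : R).
Proof.
pose y t : R := 2 ^+ stage_start j * t.
have my : measurable_fun [set: R] y by exact: measurable_funM.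
have mf : measurable_fun [set: R] (fun z : R => z - (Num.floor z)%:~R).
  apply: measurable_funB => //; apply: nondecreasing_measurable => // a b ab.
  by rewrite ler_int le_floor.
have mset : measurable ([set t | lower_half j t] : set R).
  have -> : [set t | lower_half j t] =
      (fun t => y t - (Num.floor (y t))%:~R) @^-1` (`]-oo, (1 / 2)[%classic : set R).
    by apply/seteqP; split => t /=; rewrite in_itv.
  rewrite -[X in measurable X]setTI.
  exact: (measurableT_comp mf my).
rewrite (_ : (fun t => _) = \1_[set t | lower_half j t]); first exact: measurable_indic.
apply/funext => t; rewrite indicE; congr (nat_of_bool _)%:R.
by apply/idP/idP => [?|]; rewrite inE.
Qed.

Lemma lower_halfDz j t (k : int) : lower_half j (t + k%:~R) = lower_half j t.
Proof.
rewrite /lower_half mulrDr.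
rewrite (_ : 2 ^+ stage_start j * k%:~R = ((2 ^ stage_start j)%N%:Z * k)%:~R); last first.
  by rewrite intrM -natrX.
by rewrite floorDrz ?intr_int// intrKfloor intrD opprD addrACA subrr addr0.
Qed.

Lemma peak_ge1 j s : 1 <= peak j s.
Proof. by rewrite exprn_ege1// ler1n. Qed.

Lemma peak_gt0 j s : 0 < peak j s.
Proof. exact: lt_le_trans (peak_ge1 j s). Qed.

Lemma damping_gt0 s : 0 < damping s.
Proof. by rewrite divr_gt0// invr_gt0 exprn_gt0. Qed.

Lemma amplitude_ge0 j s : 0 <= amplitude j s.
Proof.
by rewrite !mulr_ge0 ?powR_ge0 ?(ltW (damping_gt0 s))// invr_ge0 exprn_ge0.
Qed.

Lemma piece_ge0 j s t : 0 <= piece j s t.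
Proof. by rewrite mulr_ge0// riesz_ge0. Qed.

Lemma piece_le j s t : piece j s t <= riesz (zeros j) (stage_start s) t.
Proof. by rewrite -[leRHS]mul1r ler_wpM2r ?riesz_ge0//; case: lower_half. Qed.

Lemma measurable_piece j s (D : set R) : measurable_fun D (piece j s).
Proof.
by apply: measurable_funM; [exact: measurable_lower_half|exact: measurable_riesz].
Qed.

Lemma int01_piece j s : int01 (piece j s).
Proof.
apply: (@int01_bounded _ _ (peak j s)); first exact: measurable_piece.
by move=> t; rewrite ger0_norm ?piece_ge0// (le_trans (piece_le _ _ _))// riesz_le.
Qed.

Lemma term_ge0 s t : 0 <= term s t.
Proof.
by rewrite addr_ge0// sumr_ge0// => j _; rewrite mulr_ge0 ?amplitude_ge0 ?piece_ge0.
Qed.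

Lemma measurable_term s (D : set R) : measurable_fun D (term s).
Proof.
apply: measurable_funD => //; apply: measurable_sum => j.
by apply: measurable_funM => //; exact: measurable_piece.
Qed.

Lemma termDz s t (k : int) : term s (t + k%:~R) = term s t.
Proof.
congr (_ + _); apply: eq_bigr => j _.
by rewrite /piece lower_halfDz rieszDz.
Qed.

(** Some summand is at least the average, and it alone gives the bound. *)
Lemma powR_sum_le s (y : nat -> R) : (0 < s)%N -> (forall j, 0 <= y j) ->
  (\sum_(0 <= j < s) y j) `^ p <= \sum_(0 <= j < s) (s%:R * y j) `^ p.
Proof.
move=> s0 y0; set S := \sum_(0 <= j < s) y j.
have [j js hj] : exists2 j, (j < s)%N & S <= s%:R * y j.
  apply: contrapT => none.
  have : \sum_(0 <= j < s) s%:R * y j < \sum_(0 <= j < s) S.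
    apply: ltr_sum_nat => // j /andP[_ js]; rewrite ltNge; apply/negP => h.
    by apply: none; exists j.
  by rewrite -mulr_sumr sumr_const_nat subn0 -/S mulr_natl ltxx.
rewrite (bigD1_seq j) ?iota_uniq ?mem_index_iota//=.
rewrite (@le_trans _ _ ((s%:R * y j) `^ p))//; last first.
  by rewrite lerDl sumr_ge0// => i _; rewrite powR_ge0.
by apply: ge0_ler_powR; rewrite ?nnegrE ?sumr_ge0 ?mulr_ge0 ?(ltW p0).
Qed.

(** From a <= 1 follows a^p <= a, and since the Riesz product r is at most its peak V, (V^(1/p - 1)
    r)^p = V^(1 - p) r^p <= r. The right-hand side then has a known integral. *)
Lemma amplitude_piece_le j s t (a := s%:R * 2 ^+ s.+1 * damping s) :
  (s%:R * (2 ^+ s.+1 * (amplitude j s * piece j s t))) `^ p <=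
  a * riesz (zeros j) (stage_start s) t.
Proof.
have V0 := peak_gt0 j s; have r0 := @riesz_ge0 R (zeros j) (stage_start s) t.
have rV : riesz (zeros j) (stage_start s) t <= peak j s := riesz_le _ _ _.
have a01 : 0 <= a <= 1.
  rewrite /a !mulr_ge0 ?exprn_ge0 ?(ltW (damping_gt0 s))//=.
  have h : s%:R <= 2 ^+ s :> R by rewrite -natrX ler_nat ltnW// ltn_expl.
  rewrite /damping mulrA ler_pdivrMr// ler_pdivrMr ?exprn_gt0// mul1r.
  apply: (@le_trans _ _ (2 ^+ s * 2 ^+ s.+1)); first by rewrite ler_wpM2r// exprn_ge0.
  rewrite exprS mulrCA -exprD addnn -mul2n exprM.
  have : (2 ^+ 2) ^+ s <= 16 ^+ s :> R by apply: lerXn2r; rewrite ?nnegrE; lra.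
  by have : 0 <= 16 ^+ s :> R; [rewrite exprn_ge0|lra].
have /andP[a0 a1] := a01.
set r := riesz _ _ t in r0 rV *.
apply: (@le_trans _ _ ((a * (peak j s `^ (p^-1 - 1) * r)) `^ p)).
  have ap0 : 0 <= amplitude j s * piece j s t by rewrite mulr_ge0 ?amplitude_ge0 ?piece_ge0.
  apply: ge0_ler_powR; rewrite ?nnegrE ?(ltW p0)//.
  - by apply: mulr_ge0 => //; apply: mulr_ge0 => //; exact: exprn_ge0.
  - by apply: mulr_ge0 => //; apply: mulr_ge0 => //; exact: powR_ge0.
  have key : amplitude j s * piece j s t <= damping s * (peak j s `^ (p^-1 - 1) * r).
    apply: (@le_trans _ _ (amplitude j s * r)).
      by rewrite ler_wpM2l ?amplitude_ge0 ?piece_le.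
    rewrite /amplitude mulrAC -mulrA (mulrC r) -mulrA.
    rewrite ler_piMl ?mulr_ge0 ?powR_ge0 ?(ltW (damping_gt0 s))//.
    by rewrite invf_le1 ?exprn_gt0// exprn_ege1// ler1n.
  rewrite /a -[s%:R * _ * _]mulrA -[s%:R * _ * _]mulrA ler_wpM2l// -[2 ^+ _ * _ * _]mulrA.
  by rewrite ler_wpM2l ?exprn_ge0.
rewrite powRM ?mulr_ge0 ?powR_ge0//.
have ap : a `^ p <= a.
  have [->|an0] := eqVneq a 0; first by rewrite powR0// gt_eqF.
  by rewrite ge1r_powR// lt_neqAle eq_sym an0 a0.
rewrite ler_pM ?powR_ge0//.
rewrite powRM ?powR_ge0// -powRrM.
have [->|rn0] := eqVneq r 0; first by rewrite powR0 ?mulr0// gt_eqF.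
rewrite -(mulr_powRB1 r0 p0) mulrCA -[leRHS]mulr1 ler_wpM2l//.
have -> : (p^-1 - 1) * p = - (p - 1) by rewrite mulrBl mulVf ?gt_eqF//; ring.
rewrite powRN mulrC ler_pdivrMr ?powR_gt0// mul1r.
by apply: ge0_ler_powR; rewrite ?nnegrE ?subr_ge0 ?(ltW V0).
Qed.

Lemma term_powR_le s t : (2 ^+ s.+1 * term s t) `^ p <=
  (s == 0%N)%:R * 2 `^ p + \sum_(0 <= j < s)
     s%:R * 2 ^+ s.+1 * damping s * riesz (zeros j) (stage_start s) t.
Proof.
case: s => [|s]; first by rewrite /term !big_geq//= !addr0 mulr1 mul1r expr1.
rewrite /term/= mul0r !add0r mulr_sumr.
apply: le_trans (powR_sum_le _ _) _ => //.
  move=> j; apply: mulr_ge0; first exact: exprn_ge0.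
  exact: mulr_ge0 (amplitude_ge0 _ _) (piece_ge0 _ _ _).
by apply: ler_sum => j _; exact: amplitude_piece_le.
Qed.

Lemma integral_term_powR_le s :
  (\int[mu]_(t in I01) ((2 ^+ s.+1 * term s t) `^ p)%:E <=
   ((2 `^ p + 1) * 2 ^- s)%:E)%E.
Proof.
pose a := s%:R * 2 ^+ s.+1 * damping s.
have a0 : 0 <= a by rewrite !mulr_ge0 ?exprn_ge0 ?(ltW (damping_gt0 s)).
pose h t := (s == 0%N)%:R * 2 `^ p + \sum_(0 <= j < s) a * riesz (zeros j) (stage_start s) t.
have c1 : int01 (fun _ : R => (s == 0%N)%:R * 2 `^ p).
  apply: (@int01_bounded _ _ `|(s == 0%N)%:R * 2 `^ p|) => [|t]; last exact: lexx.
  exact: measurable_cst.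
have c2 : int01 (fun t => \sum_(0 <= j < s) a * riesz (zeros j) (stage_start s) t).
  by apply: int01_sum => j; apply: int01Z; exact: int01_riesz.
have ih : int01 h by exact: int01D.
have mh : measurable_fun I01 (fun t => (h t)%:E) by have /integrableP[] := ih.
apply: (@le_trans _ _ (\int[mu]_(t in I01) (h t)%:E)%E).
  apply: ge0_le_integral => //.
  - by move=> t _; rewrite lee_fin powR_ge0.
  - apply/measurable_EFinP; apply: (measurableT_comp (measurable_powR p)).
    by apply: measurable_funM => //; exact: measurable_term.
  - by move=> t _; rewrite lee_fin; exact: term_powR_le.
have -> : (\int[mu]_(t in I01) (h t)%:E = (\int[mu]_(t in I01) h t)%R%:E)%E.
  by rewrite /Rintegral fineK//; exact: (@integrable_fin_num _ _ _ mu I01 _ _ ih).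
rewrite lee_fin /h Rintegral01D// Rintegral01_sum; last first.
  by move=> j; apply: int01Z; exact: int01_riesz.
rewrite Rintegral_cst// [X in fine X](lebesgue_measure_itv `[0, 1])/=.
rewrite lte_fin ltr01 -EFinB/= subr0 mulr1.
rewrite (eq_bigr (fun=> a)); last first.
  by move=> j _; rewrite Rintegral01Z ?Rintegral_riesz ?mulr1//; exact: int01_riesz.
rewrite sumr_const_nat subn0.
have p2 := @pow2_ge0 R p.
have s2 : s%:R <= 2 ^+ s :> R by rewrite -natrX ler_nat ltnW// ltn_expl.
have e0 : 0 < 2 ^+ s :> R by rewrite exprn_gt0.
have as_ : a *+ s <= 2 ^- s.
  rewrite -mulr_natr /a /damping exprS.
  have -> : 16 ^- s = 2 ^- s * 2 ^- s * 2 ^- s * 2 ^- s :> R.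
    have -> : 16 = 2 ^+ 4 :> R by rewrite -natrX.
    by rewrite -!invfM -!exprD -exprM; congr (_ ^- _); lia.
  pose d := s%:R * 2 ^- s : R.
  have d0 : 0 <= d by rewrite mulr_ge0// invr_ge0 exprn_ge0.
  have d1 : d <= 1 by rewrite ler_pdivrMr// mul1r.
  rewrite (_ : _ * s%:R = d * d * (2 ^- s * (1 / 32))); last by rewrite /d; field; rewrite gt_eqF.
  have d2 : d * d <= 1 by rewrite mulr_ile1.
  have e1 : 0 <= 2 ^- s :> R by rewrite invr_ge0 exprn_ge0.
  rewrite (le_trans (ler_wpM2r _ d2)) ?mulr_ge0//.
  by lra.
rewrite mulrDl mul1r lerD//.
case: s {a a0 h c1 c2 ih mh s2 as_} e0 => [|s] e0 /=; first by rewrite mul1r expr0 invr1 mulr1.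
by rewrite mul0r mulr_ge0// invr_ge0 ltW.
Qed.

Lemma term_summable :
  (\sum_(s <oo) \int[mu]_(t in I01) ((2 ^+ s.+1 * term s t) `^ p)%:E < +oo)%E.
Proof.
apply: (@le_lt_trans _ _ ((2 `^ p + 1) * 2)%:E); last exact: ltry.
apply: lime_le.
  by apply: is_cvg_nneseries => s _ _; apply: integral_ge0 => t _; rewrite lee_fin powR_ge0.
apply: nearW => n; apply: (@le_trans _ _ (\sum_(0 <= s < n) ((2 `^ p + 1) * 2 ^- s)%:E)%E).
  by apply: lee_sum => s _; exact: integral_term_powR_le.
rewrite sumEFin lee_fin -mulr_sumr ler_wpM2l ?addr_ge0 ?pow2_ge0//.
have : \sum_(0 <= s < n) 2 ^- s = 2 - 2 * 2 ^- n :> R.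
  elim: n => [|n IH]; first by rewrite big_geq// expr0 invr1; lra.
  by rewrite big_nat_recr//= IH exprS invfM; lra.
by move=> ->; have : 0 <= 2 ^- n :> R; [rewrite invr_ge0 exprn_ge0|lra].
Qed.

Local Open Scope complex_scope.

Definition multifractal_series (x : torus R) : R[i] := series_fun term (repr x) +i* 0.

Lemma series_funDz t (k : int) : series_fun term (t + k%:~R) = series_fun term t.
Proof. by congr fine; apply: eq_eseriesr => s _; rewrite termDz. Qed.

Lemma repr_to_torus (t : R) : exists k : int, repr (to_torus t) = t + k%:~R.
Proof.
have : to_torus t = to_torus (repr (to_torus t)) by rewrite /to_torus reprK.
move=> /eqP; rewrite /to_torus -Quotient.idealrBE => /intrP[k Ek].
by exists (- k); rewrite mulrNz -Ek; ring.
Qed.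

Lemma multifractal_series_to_torus t :
  multifractal_series (to_torus t) = series_fun term t +i* 0.
Proof.
by rewrite /multifractal_series; have [k ->] := repr_to_torus t; rewrite series_funDz.
Qed.

Let pos := term_ge0.
Let meas s := @measurable_term s I01.

Lemma multifractal_series_Lp : Lp p multifractal_series.
Proof.
have E : (fun t : R => complex.Re (multifractal_series (to_torus t))) = series_fun term.
  by apply/funext => t; rewrite multifractal_series_to_torus.
split.
- by rewrite E; exact: (measurable_series_fun pos meas).
- have -> : (fun t : R => complex.Im (multifractal_series (to_torus t))) = cst 0.
    by apply/funext => t; rewrite multifractal_series_to_torus.
  exact: measurable_cst.
under eq_integral => t _.
  rewrite multifractal_series_to_torus /= expr0n addr0 sqrtr_sqr.
  rewrite ger0_norm ?series_fun_ge0//.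
  over.
exact: (series_fun_Lp p1 pos meas term_summable).
Qed.

End construction.

Section kernel_localization.
Context {R : realType}.
Local Notation mu := (@lebesgue_measure R).
Local Notation I01 := (`[0, 1]%classic : set R).

(** Quantitative localization: at distance delta from the integers the Dirichlet kernels are bounded
    by 2 / delta, uniformly in n. *)
Lemma integral_dirichlet_far (h : R -> R) n x (delta : R) : 0 < delta -> int01 h ->
  (forall t, 0 <= h t) -> (forall t, dist_int (x - t) < delta -> h t = 0) ->
  `|(\int[mu]_(t in I01) (h t * dirichlet n (x - t)))%R| <=
  2 / delta * (\int[mu]_(t in I01) h t)%R.
Proof.
move=> d0 ih h0 hfar; have ihd := int01_dirichlet n x ih.
have mI : measurable I01 by exact: measurable_itv.
apply: (@le_trans _ _ (\int[mu]_(t in I01) `|h t * dirichlet n (x - t)|)%R).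
  exact: le_normr_Rintegral.
rewrite -Rintegral01Z//; apply: le_Rintegral => //.
- have := ihd => /integrable_abse; congr (integrable _ _ _).
- exact: int01Z.
move=> t _; rewrite normrM (ger0_norm (h0 t)).
have [near|far] := ltP (dist_int (x - t)) delta; first by rewrite hfar// mul0r mulr0.
rewrite mulrC ler_wpM2r// ler_pdivlMr// (le_trans _ (dirichlet_dist n (x - t)))//.
by rewrite ler_wpM2l.
Qed.

End kernel_localization.

(** * Lower bounds for the partial sums at the constructed points *)

Section growth.
Context {R : realType}.
Local Notation mu := (@lebesgue_measure R).
Local Notation I01 := (`[0, 1]%classic : set R).
Variables (p : R) (th : nat -> R).
Hypotheses (p1 : 1 <= p) (th0 : forall j, 0 <= th j) (th1 : forall j, th j <= 1).
Variable theta : R.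
Hypotheses (theta0 : 0 <= theta) (theta1 : theta <= 1).
Implicit Types (s j n : nat).

Let p0 : 0 < p. Proof. exact: lt_le_trans p1. Qed.

(* At a point with zeros in the positions of th j only, partial sums of Riesz
   products with larger exponents have no sign; the address bits place the point
   where the corresponding pieces vanish. *)
Definition inactive j := theta < th j.

Definition peak_point u := digit_point theta inactive u.

Variable u : R.
Hypothesis u0 : 0 <= u.
Local Notation x := (peak_point u).
Local Notation zeros j := (zero_positions (th j)).

Lemma free_digits_anti j s : th j <= theta -> (free_digits theta s <= free_digits (th j) s)%N.
Proof.
move=> jt; apply: leq_sub2l; apply: le_truncn; exact: ler_wpM2r.
Qed.

(** The zero blocks of a stage end at the same position for all parameters; a larger parameter only
    extends them to the left. *)
Lemma zero_positions_active j i : th j <= theta -> zeros j i -> zero_positions theta i.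
Proof.
move=> jt /existsP[s /andP[h1 h2]]; apply/existsP; exists s; rewrite h2 andbT.
by apply: leq_trans h1; rewrite leq_add2l free_digits_anti.
Qed.

Lemma peak_point_nearly_periodic j : th j <= theta -> nearly_periodic (zeros j) x.
Proof.
move=> jt N; apply: le_trans (point_nearly_periodic theta0 theta1 inactive u0 N).
rewrite big_mkcond [leRHS]big_mkcond; apply: ler_sum => i _.
case: ifP => [/(zero_positions_active jt) ->//|_].
by case: ifP => // _; exact: dist_int_ge0.
Qed.

Let far j t : dist_int (x - t) < 2 ^- stage_start j / 8 ->
  lower_half j t = ~~ inactive j.
Proof. exact: lower_half_point. Qed.

Lemma piece_dirichlet_inactive j s n : inactive j ->
  - (16 * 2 ^+ stage_start j) <=
  (\int[mu]_(t in I01) (piece th j s t * dirichlet n (x - t)))%R.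
Proof.
move=> aj; have e0 : 0 < 2 ^- stage_start j / 8 :> R.
  by rewrite divr_gt0// invr_gt0 exprn_gt0.
have := @integral_dirichlet_far _ (piece th j s) n x _ e0 (int01_piece th j s)
  (piece_ge0 th j s) _.
move=> /(_ _)/ler_normlP[|h _].
  by move=> t /far; rewrite aj /piece => ->; rewrite mul0r.
rewrite lerNl (le_trans h)//.
rewrite (_ : 2 / (2 ^- stage_start j / 8) = 16 * 2 ^+ stage_start j); last first.
  by field; rewrite expf_neq0.
rewrite -[leRHS]mulr1 ler_wpM2l ?mulr_ge0 ?exprn_ge0//.
rewrite -[leRHS](Rintegral_riesz (zeros j) (stage_start s)); apply: le_Rintegral => //.
- exact: int01_piece.
- exact: int01_riesz.
- by move=> t _; exact: piece_le.
Qed.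

(** Here it is the removed part, the Riesz product minus the piece, that vanishes near the point. *)
Lemma piece_dirichlet_active j s n : th j <= theta ->
  (\int[mu]_(t in I01) (riesz (zeros j) (stage_start s) t * dirichlet n (x - t)))%R -
  16 * 2 ^+ stage_start j <=
  (\int[mu]_(t in I01) (piece th j s t * dirichlet n (x - t)))%R.
Proof.
move=> aj; have e0 : 0 < 2 ^- stage_start j / 8 :> R.
  by rewrite divr_gt0// invr_gt0 exprn_gt0.
pose r := riesz (zeros j) (stage_start s) : R -> R.
have ir : int01 r by exact: int01_riesz.
pose h t := r t - piece th j s t.
have ih : int01 h.
  have := int01D ir (int01Z (-1) (int01_piece th j s)).
  by congr int01; apply/funext => t; rewrite mulN1r.
have h0 t : 0 <= h t by rewrite subr_ge0 piece_le.
have := @integral_dirichlet_far _ h n x _ e0 ih h0 _.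
move=> /(_ _)/ler_normlP[|_ hle].
  move=> t /far; rewrite /inactive ltNge aj/= /h /piece => ->.
  by rewrite mul1r subrr.
have -> : (\int[mu]_(t in I01) (r t * dirichlet n (x - t)))%R =
    (\int[mu]_(t in I01) (h t * dirichlet n (x - t)))%R +
    (\int[mu]_(t in I01) (piece th j s t * dirichlet n (x - t)))%R.
  rewrite -Rintegral01D; last 2 first.
  - exact: int01_dirichlet.
  - by apply: int01_dirichlet; exact: int01_piece.
  by apply: eq_Rintegral => t _; rewrite /h; ring.
rewrite lerBlDr addrC lerD2l (le_trans hle)//.
rewrite (_ : 2 / (2 ^- stage_start j / 8) = 16 * 2 ^+ stage_start j); last first.
  by field; rewrite expf_neq0.
rewrite -[leRHS]mulr1 ler_wpM2l ?mulr_ge0 ?exprn_ge0//.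
rewrite -[leRHS](Rintegral_riesz (zeros j) (stage_start s)); apply: le_Rintegral => //.
by move=> t _; rewrite gerBl piece_ge0.
Qed.

(** The guaranteed contribution of a piece to the partial sum of order n. Below order 2^(stage_start
    s) only the sign of the Riesz sum is known, so nothing is credited. *)
Definition gain n j s : R :=
  ((th j <= theta) && (2 ^ stage_start s <= n)%N)%:R * (amplitude p th j s * peak th j s / 2).

Lemma gain_ge0 n j s : 0 <= gain n j s.
Proof.
by rewrite mulr_ge0// divr_ge0// mulr_ge0 ?amplitude_ge0 ?(ltW (peak_gt0 th j s)).
Qed.

(** The factor 2^-(stage_start j) of the amplitude is there to cancel the localization constant. *)
Lemma amplitude_error j s : amplitude p th j s * (16 * 2 ^+ stage_start j) <= 16 ^- s / 4.
Proof.
have V1 : peak th j s `^ (p^-1 - 1) <= 1.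
  by rewrite -[leRHS](powRr0 (peak th j s)) ler_powR ?peak_ge1// subr_le0 invf_le1.
rewrite /amplitude /damping.
rewrite [leLHS](_ : _ = (16 ^- s / 4) * peak th j s `^ (p^-1 - 1)).
  by rewrite -[leRHS]mulr1 ler_wpM2l// divr_ge0// invr_ge0 exprn_ge0.
by field; rewrite !expf_neq0.
Qed.

Lemma piece_dirichlet_ge j s n :
  gain n j s - 16 ^- s / 4 <=
  amplitude p th j s * (\int[mu]_(t in I01) (piece th j s t * dirichlet n (x - t)))%R.
Proof.
have A0 := amplitude_ge0 p th j s.
have err := amplitude_error j s.
rewrite /gain; have [aj|aj] := leP (th j) theta; last first.
  rewrite mul0r add0r; have := ler_wpM2l A0 (piece_dirichlet_inactive s n aj).
  by rewrite mulrN; lra.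
have := ler_wpM2l A0 (piece_dirichlet_active s n aj); rewrite mulrBr.
have nper := peak_point_nearly_periodic aj.
have [sn|ns] /= := leqP (2 ^ stage_start s) n.
  have := ler_wpM2l A0 (riesz_dirichlet_ge nper sn); rewrite -/(peak th j s).
  by rewrite mul1r mulrA; lra.
have := mulr_ge0 A0 (riesz_dirichlet_ge0 (stage_start s) n nper).
by rewrite mul0r; lra.
Qed.

Lemma term_dirichlet_ge s n :
  (s == 0%N)%:R + \sum_(0 <= j < s) gain n j s - 2 ^- s / 4 <=
  (\int[mu]_(t in I01) (term p th s t * dirichlet n (x - t)))%R.
Proof.
have iD (c : R) : int01 (fun t => c * dirichlet n (x - t)).
  by apply: int01_dirichlet; apply: (@int01_bounded _ _ `|c|) => //; exact: measurable_cst.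
have ip j : int01 (fun t => amplitude p th j s * (piece th j s t * dirichlet n (x - t))).
  by apply: int01Z; apply: int01_dirichlet; exact: int01_piece.
have D1 : (\int[mu]_(t in I01) ((s == 0%N)%:R * dirichlet n (x - t)))%R = (s == 0%N)%:R.
  rewrite Rintegral01Z; last first.
    by have := iD 1; under eq_fun do rewrite mul1r.
  have := @Rintegral_cos_dirichlet R 0 n x; rewrite mul0r mulr0 cos0 mulr1/= => h.
  rewrite -[RHS]mulr1 -[X in _ = _ * X]h; congr (_ * _); apply: eq_Rintegral => t _.
  by rewrite mul0r mulr0 cos0 mul1r.
rewrite (_ : (\int[mu]_(t in I01) (term p th s t * dirichlet n (x - t)))%R =
   (s == 0%N)%:R + \sum_(0 <= j < s) amplitude p th j s *
     (\int[mu]_(t in I01) (piece th j s t * dirichlet n (x - t)))%R); last first.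
  have -> : \sum_(0 <= j < s) amplitude p th j s *
      (\int[mu]_(t in I01) (piece th j s t * dirichlet n (x - t)))%R =
      \sum_(0 <= j < s) (\int[mu]_(t in I01)
        (amplitude p th j s * (piece th j s t * dirichlet n (x - t))))%R.
    apply: eq_bigr => j _; rewrite Rintegral01Z//.
    by apply: int01_dirichlet; exact: int01_piece.
  rewrite -[X in X + _]D1 -Rintegral01_sum// -Rintegral01D//; last exact: int01_sum.
  apply: eq_Rintegral => t _; rewrite /term mulrDl mulr_suml; congr (_ + _).
  by apply: eq_bigr => j _; rewrite mulrA.
rewrite -addrA lerD2l.
apply: (@le_trans _ _ (\sum_(0 <= j < s) (gain n j s - 16 ^- s / 4))); last first.
  by apply: ler_sum => j _; exact: piece_dirichlet_ge.
rewrite sumrB lerD2l lerN2 sumr_const_nat subn0 -[leLHS]mulr_natl mulrA ler_pM2r//.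
have h : s%:R <= 2 ^+ s :> R by rewrite -natrX ler_nat ltnW// ltn_expl.
rewrite ler_pdivrMr ?exprn_gt0// (le_trans h)//.
rewrite ler_pdivlMl ?exprn_gt0// -expr2 -exprM mulnC exprM.
by apply: lerXn2r; rewrite ?nnegrE//; lra.
Qed.

Lemma partial_dirichlet_ge n N c :
  (0 < N)%N -> c <= \sum_(0 <= s < N) \sum_(0 <= j < s) gain n j s ->
  c + 1 / 2 <= (\int[mu]_(t in I01) ((\sum_(0 <= s < N) term p th s t) * dirichlet n (x - t)))%R.
Proof.
move=> N0 cN.
have iT s : int01 (fun t => term p th s t * dirichlet n (x - t)).
  apply: int01_dirichlet; apply: int01D.
    by apply: (@int01_bounded _ _ `|(s == 0%N)%:R|) => //; exact: measurable_cst.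
  by apply: int01_sum => j; apply: int01Z; exact: int01_piece.
under eq_Rintegral do rewrite mulr_suml.
rewrite Rintegral01_sum//.
apply: (@le_trans _ _
  (\sum_(0 <= s < N) ((s == 0%N)%:R + \sum_(0 <= j < s) gain n j s - 2 ^- s / 4))); last first.
  by apply: ler_sum => s _; exact: term_dirichlet_ge.
rewrite sumrB big_split/=.
have -> : \sum_(0 <= s < N) (s == 0%N)%:R = 1 :> R.
  case: N N0 {cN} => // N _; rewrite big_nat_recl//= big1 ?addr0//.
have : \sum_(0 <= s < N) 2 ^- s / 4 <= 1 / 2 :> R.
  rewrite -mulr_suml.
  have -> : \sum_(0 <= s < N) 2 ^- s = 2 - 2 * 2 ^- N :> R.
    elim: N {N0 cN} => [|N IH]; first by rewrite big_geq// expr0 invr1; lra.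
    by rewrite big_nat_recr//= IH exprS invfM; lra.
  by have : 0 <= 2 ^- N :> R; [rewrite invr_ge0 exprn_ge0|lra].
by lra.
Qed.

Lemma gain_le_sum n j s N : (j < s < N)%N ->
  gain n j s <= \sum_(0 <= r < N) \sum_(0 <= i < r) gain n i r.
Proof.
move=> /andP[js sN].
rewrite (bigD1_seq s) ?iota_uniq ?mem_index_iota//=.
rewrite (bigD1_seq j) ?iota_uniq ?mem_index_iota//= -addrA lerDl.
rewrite addr_ge0 ?sumr_ge0// => [i _|r _]; first exact: gain_ge0.
by rewrite sumr_ge0// => i _; exact: gain_ge0.
Qed.

Local Notation F := (multifractal_series p th).

Lemma fourier_sum_multifractal n :
  fourier_sum F n (to_torus x) =
  Complex (\int[mu]_(t in I01) (series_fun (term p th) t * dirichlet n (x - t)))%R 0.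
Proof.
have E : (fun t : R => complex.Re (F (to_torus t))) = series_fun (term p th).
  by apply/funext => t; rewrite multifractal_series_to_torus.
have E' : (fun t : R => complex.Im (F (to_torus t))) = cst 0.
  by apply/funext => t; rewrite multifractal_series_to_torus.
have LF := multifractal_series_Lp th p1.
rewrite fourier_sumE.
- have [k ->] := repr_to_torus x; congr Complex.
    apply: eq_Rintegral => t _; rewrite multifractal_series_to_torus/=.
    by rewrite addrAC dirichletDz.
  under eq_Rintegral do rewrite multifractal_series_to_torus/= mul0r.
  by rewrite Rintegral_cst// mul0r.
- apply: (int01_le_modulus p1 LF); first by case: LF.
  by move=> t; exact: Re_le_normc.
- apply: (int01_le_modulus p1 LF); first by case: LF.
  by move=> t; exact: Im_le_normc.
Qed.

Lemma fourier_sum_multifractal_ge n c N :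
  (forall M, (N <= M)%N -> c <= \sum_(0 <= s < M) \sum_(0 <= j < s) gain n j s) ->
  c + 1 / 2 <= Normc.normc (fourier_sum F n (to_torus x)).
Proof.
move=> cN; rewrite fourier_sum_multifractal /= expr0n addr0 sqrtr_sqr.
apply: le_trans (ler_norm _).
apply: (@series_fun_integral_ge _ p _ p1 (term_ge0 p th) (fun s => measurable_term p th s (D := _))
  (term_summable th p1) _ (2 * n + 1)%:R _ (maxn 1 N)).
- by rewrite ltr0n addn1.
- exact: measurable_dirichlet.
- by move=> t; exact: dirichlet_le.
move=> M; rewrite geq_max => /andP[M0 NM]; apply: partial_dirichlet_ge => //.
exact: cN.
Qed.

Lemma fourier_sum_ge_half n : 1 / 2 <= Normc.normc (fourier_sum F n (to_torus x)).
Proof.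
rewrite -[leLHS]add0r; apply: (@fourier_sum_multifractal_ge _ _ 0) => M _.
by apply: sumr_ge0 => s _; apply: sumr_ge0 => j _; exact: gain_ge0.
Qed.

Lemma fourier_sum_ge_gain n j s : (j < s)%N ->
  gain n j s <= Normc.normc (fourier_sum F n (to_torus x)).
Proof.
move=> js; apply: (@le_trans _ _ (gain n j s + 1 / 2)); first by rewrite lerDl.
by apply: (@fourier_sum_multifractal_ge _ _ s.+1) => M sM; apply: gain_le_sum; rewrite js.
Qed.

(** Amplitude times peak leaves peak^(1/p). The losses are s from rounding in
    [count_zero_positions], 4 s + 7 from [damping] and the division by 2, and [stage_start j] from
    the amplitude. *)
Lemma gain_ge n j s : th j <= theta -> (2 ^ stage_start s <= n)%N ->
  2 `^ (th j / p * s%:R ^+ 3 - 5 * s%:R - (stage_start j)%:R - 7) <= gain n j s.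
Proof.
move=> jt sn; rewrite /gain jt sn mul1r /amplitude /damping.
have V0 := peak_gt0 th j s.
have -> : 2 ^- stage_start j * (16 ^- s / 64) * peak th j s `^ (p^-1 - 1) * peak th j s / 2 =
   2 ^- stage_start j * (16 ^- s / 128) * peak th j s `^ p^-1.
  rewrite powRD ?(gt_eqF V0) ?implybT// (powRN _ 1) powRr1 ?(ltW V0)//.
  by field; rewrite !expf_neq0 ?gt_eqF.
have -> : 16 ^- s / 128 = 2 `^ (- (4 * s%:R + 7)) :> R.
  rewrite pow2N pow2D powRrM !(pow2n 4) (pow2n 7) powR_mulrn ?exprn_ge0// -invfM.
  have -> : 16 = 2 ^+ 4 :> R by rewrite -natrX.
  by have -> : 128 = 2 ^+ 7 :> R by rewrite -natrX.
rewrite -pow2n -pow2N /peak -pow2n -powRrM -!pow2D ler_pow2//.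
have h := count_zero_positions (th0 j) (th1 j) s.
have hp : (th j * s%:R ^+ 3 - s%:R) / p <= (count (zeros j) (iota 0 (stage_start s)))%:R / p.
  by rewrite ler_pM2r ?invr_gt0.
have sp : s%:R / p <= s%:R by rewrite ler_pdivrMr// ler_peMr.
rewrite mulrBl mulrAC in hp.
by lra.
Qed.

End growth.

(** * Lower bounds for the dimensions *)

Section null_preimages.
Context {R : realType}.
Local Notation mu := (@lebesgue_measure R).
Implicit Types (X : set R) (w : \bar R).

(** Outer measure through measurable supersets: the preimages below are not known to be
    measurable. *)
Definition outer_le X w := exists B : set R, [/\ measurable B, X `<=` B & (mu B <= w)%E].

Lemma outer_leS X Y w : X `<=` Y -> outer_le Y w -> outer_le X w.
Proof. by move=> XY [B [mB YB Bw]]; exists B; split => //; exact: subset_trans YB. Qed.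

Lemma outer_le_trans X w w' : (w <= w')%E -> outer_le X w -> outer_le X w'.
Proof. by move=> ww' [B [mB XB Bw]]; exists B; split => //; exact: le_trans ww'. Qed.

Lemma outer_le0 : outer_le set0 0%E.
Proof. by exists set0; split => //; rewrite measure0. Qed.

Lemma outer_le_bigcup (X : nat -> set R) (w : nat -> \bar R) :
  (forall i, outer_le (X i) (w i)) -> outer_le (\bigcup_i X i) (\sum_(i <oo) w i)%E.
Proof.
move=> /choice[B BP]; exists (\bigcup_i B i); split.
- by apply: bigcup_measurable => i _; have [] := BP i.
- by move=> x [i _ Xx]; exists i => //; have [_ + _] := BP i; exact.
apply: (@le_trans _ _ (\sum_(i <oo) mu (B i))%E).
  apply: measure_sigma_subadditive => //.
  - by move=> i; have [] := BP i.
  - by apply: bigcup_measurable => i _; have [] := BP i.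
by apply: lee_nneseries => [i _ _|i _]; [exact: measure_ge0|have [] := BP i].
Qed.

Lemma outer_leU X Y w w' : outer_le X w -> outer_le Y w' -> outer_le (X `|` Y) (w + w')%E.
Proof.
move=> [B [mB XB Bw]] [D [mD YD Dw]]; exists (B `|` D); split.
- exact: measurableU.
- exact: setUSS.
have h : (mu (B `|` D) <= mu B + mu D)%E by exact: measureU2.
by apply: (le_trans h); exact: leeD.
Qed.

Lemma outer_le_seq (T : eqType) (xs : seq T) (Y : T -> set R) (c : R) :
  (forall a, outer_le (Y a) c%:E) ->
  outer_le [set u | exists2 a, a \in xs & Y a u] ((size xs)%:R * c)%:E.
Proof.
move=> Yc; elim: xs => [|a xs IH].
  by rewrite mul0r; apply: outer_leS outer_le0 => u [].
rewrite /= -natr1 mulrDl mul1r addrC EFinD.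
apply: outer_leS (outer_leU (Yc a) IH) => u [b].
by rewrite inE => /predU1P[->|bxs] Yu; [left|right; exists b].
Qed.

Lemma outer_le_diam X (d : R) : 0 <= d -> (forall u v, X u -> X v -> `|u - v| <= d) ->
  outer_le X (2 * d)%:E.
Proof.
move=> d0 Xd; have [[a Xa]|X0] := pselect (X !=set0); last first.
  apply: outer_leS (outer_le_trans _ outer_le0); last by rewrite lee_fin mulr_ge0.
  by move=> u Xu; exfalso; apply: X0; exists u.
exists `[a - d, a + d]%classic; split.
- exact: measurable_itv.
- move=> u Xu /=; rewrite in_itv/=; have := Xd u a Xu Xa; rewrite ler_norml.
  by move=> /andP[? ?]; apply/andP; split; lra.
rewrite lebesgue_measure_itv/= lte_fin; case: ifPn => _; last by rewrite lee_fin mulr_ge0.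
by rewrite -EFinB lee_fin; lra.
Qed.

Lemma negligible_outer_le X : (forall e : R, 0 < e -> outer_le X e%:E) -> mu.-negligible X.
Proof.
move=> small.
have /choice[B BP] : forall n : nat, exists B : set R,
    [/\ measurable B, X `<=` B & (mu B <= (n.+1%:R^-1)%:E)%E].
  by move=> n; apply: small; rewrite invr_gt0.
have mB : measurable (\bigcap_n B n).
  by apply: bigcap_measurable => // n _; have [] := BP n.
exists (\bigcap_n B n); split => //; last first.
  by move=> x Xx n _; have [_ + _] := BP n; exact.
apply/eqP; rewrite eq_le measure_ge0 andbT; apply/lee_addgt0Pr => e e0; rewrite add0e.
pose n := Num.truncn e^-1.
have [mBn _ hn] := BP n.
apply: (@le_trans _ _ (mu (B n))).
  by apply: le_measure; [exact: mem_set|exact: mem_set|exact: bigcap_inf].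
apply: (le_trans hn); rewrite lee_fin -[leRHS]invrK lef_pV2 ?posrE ?invr_gt0//.
by rewrite ltW// truncnS_gt.
Qed.

Section inverse_hoelder.
Context {M : metricType R}.
Variables (phi : R -> M) (s C : R).
Hypotheses (s0 : 0 <= s) (C0 : 0 < C).
Hypothesis hoelder : forall u v : R, 0 <= u < 1 -> 0 <= v < 1 ->
  `|u - v| <= C * mdist (phi u) (phi v) `^ s.
Implicit Types A E : set M.

Definition param A : set R := [set u | 0 <= u < 1 /\ A (phi u)].

Lemma param_outer_le A (d : R) : 0 <= d ->
  (forall x y, A x -> A y -> mdist x y <= d) ->
  outer_le (param A) (2 * (C * d `^ s))%:E.
Proof.
move=> d0 Ad; apply: outer_le_diam; first by rewrite mulr_ge0 ?powR_ge0// ltW.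
move=> u v [u01 Au] [v01 Av]; apply: (le_trans (hoelder u01 v01)).
rewrite ler_wpM2l ?(ltW C0)//; apply: ge0_ler_powR; rewrite ?nnegrE//.
- exact: mdist_ge0.
- exact: Ad.
Qed.

(** The mass distribution principle: a set of diameter d has a preimage of outer measure at most 2 C
    d^s. Covers at scale 1 suffice, since only the smallness of the sum matters. *)
Lemma negligible_of_hausdorff A : hausdorff_measure s A = 0%E -> mu.-negligible (param A).
Proof.
move=> HA; apply: negligible_outer_le => e e0.
have pre0 : (hausdorff_premeasure s 1 A <= 0)%E.
  by rewrite -HA; apply: ereal_sup_ubound; exists 1; [exact: ltr01|].
have : (hausdorff_premeasure s 1 A < (e / (2 * C))%:E)%E.
  by rewrite (le_lt_trans pre0)// lte_fin divr_gt0// mulr_gt0.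
move=> /ereal_inf_lt[_ [I [U [AU Ud ->]]] small].
have dfin i : I i -> (diam (U i)) = (fine (diam (U i)))%:E.
  move=> Ii; rewrite fineK// ge0_fin_numE ?diam_ge0//.
  by rewrite (le_lt_trans (Ud i Ii))// ltry.
pose w i : \bar R := if i \in I then ((2 * C)%:E * poweR (diam (U i)) s)%E else 0%E.
have cover i : outer_le (param (if i \in I then U i else set0)) (w i).
  rewrite /w; case: ifPn => [/set_mem Ii|_]; last first.
    by apply: outer_leS outer_le0 => u [].
  rewrite (dfin i Ii) poweR_EFin -EFinM -mulrA; apply: param_outer_le.
    by rewrite fine_ge0 ?diam_ge0.
  move=> x y Ux Uy; rewrite -lee_fin -(dfin i Ii).
  by apply: ereal_sup_ubound; right; exists x => //; exists y.
apply: outer_leS (outer_le_trans _ (outer_le_bigcup cover)).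
  move=> u [u01 /AU[i Ii Ui]]; exists i => //; split => //.
  by rewrite (mem_set Ii).
have w0 i : (0 <= w i)%E.
  by rewrite /w; case: ifP => // _; rewrite mule_ge0 ?poweR_ge0// lee_fin mulr_ge0// ltW.
have -> : (\sum_(i <oo) w i = (2 * C)%:E * \esum_(i in I) poweR (diam (U i)) s)%E.
  have pos i : (0 <= if i \in I then poweR (diam (U i)) s else 0)%E.
    by case: ifP => // _; exact: poweR_ge0.
  rewrite esum_mkcond -nneseries_esumT// -nneseriesZl//.
  by apply: eq_eseriesr => i _; rewrite /w; case: ifP => // _; rewrite mule0.
by rewrite -lee_pdivlMl ?mulr_gt0// -EFinM mulrC; exact: ltW.
Qed.

(** A maximal 2d-separated family in A is at once a packing by balls of radius d, which bounds its
    size by w / (2 d)^s, and a cover by balls of radius 2 d, whose preimages have outer measure at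
    most 2 C (4 d)^s. *)
Lemma packing_content_outer_le A (w : R) : (packing_content s A < w%:E)%E ->
  outer_le (param A) (2 * C * 2 `^ s * w)%:E.
Proof.
move=> /ereal_inf_lt[_ [/= d d0 <-] dw]; move: (d : R) d0 dw => {}d d0 dw.
have fin_packing xs : separated_seq (2 * d) xs -> {in xs, forall a, A a} ->
    (size xs)%:R * (2 * d) `^ s <= w.
  move=> [uxs sep] xsA; rewrite -lee_fin; apply: le_trans (ltW dw).
  pose P : set (M * R) := [set b | b.1 \in xs /\ b.2 = d].
  have PE : P = [set` [seq (a, d) | a <- xs]].
    apply/seteqP; split => [[a r] [/= axs ->]|[a r] /=].
      by apply/mapP; exists a.
    by move=> /mapP[b bxs [-> ->]].
  have finP : finite_set P by rewrite PE; exact: finite_seq.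
  apply: (@le_trans _ _ (\esum_(b in P) ((2 * b.2) `^ s)%:E)%E).
    apply: ereal_sup_ubound; exists P; first exact: fsets_self.
    rewrite PE -fsbig_seq ?map_inj_uniq// => [|a b [->]//].
    rewrite big_map/= sumEFin; congr EFin.
    by rewrite big_const_seq count_predT iter_addr_0 [RHS]mulr_natl.
  apply: ereal_sup_ubound; exists P; split => //.
  - exact: finite_set_countable.
  - by move=> b [bxs ->]; split; [exact: xsA|rewrite d0 lexx].
  move=> [a r] [b r'] [/= axs ->] [/= bxs ->] [c [/= ac bc]].
  have [->//|ab] := eqVneq a b.
  have := sep a b axs bxs ab; rewrite ltNge => /negP; case.
  rewrite (le_trans (metric_triangle a c b))// (metric_sym c) mulr2n mulrDl mul1r lerD//.
have d20 : 0 < (2 * d) `^ s by rewrite powR_gt0// mulr_gt0.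
have w0 : 0 <= w.
  have := fin_packing [::]; rewrite mul0r; apply => //; split => //.
have [||xs [sxs xsA xsmax]] := @maximal_separated _ _ (2 * d) A (Num.truncn (w / (2 * d) `^ s)).
- by rewrite mulr_ge0// ltW.
- move=> xs sxs xsA; rewrite truncn_ge_nat ?divr_ge0 ?powR_ge0// ler_pdivlMr//.
  exact: fin_packing.
have Y a : outer_le (param [set x | mdist a x <= 2 * d]) (2 * (C * (2 * (2 * d)) `^ s))%:E.
  apply: param_outer_le; first by rewrite !mulr_ge0// ltW.
  move=> x y /= ax ay; rewrite (le_trans (metric_triangle x a y))// (metric_sym x).
  by rewrite (mulr_natl _ 2) mulr2n lerD.
apply: outer_leS (outer_le_trans _ (outer_le_seq xs Y)).
  by move=> u [u01 Au]; have [a axs ay] := xsmax _ Au; exists a.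
rewrite lee_fin (@powRM _ 2) ?mulr_ge0 ?(ltW d0)//.
have := fin_packing xs sxs xsA.
have K0 : 0 <= 2 * C * 2 `^ s by rewrite !mulr_ge0 ?pow2_ge0 ?(ltW C0).
move=> /(ler_wpM2l K0); apply: le_trans.
by rewrite le_eqVlt; apply/orP; left; apply/eqP; ring.
Qed.

Lemma negligible_of_packing A : packing_measure s A = 0%E -> mu.-negligible (param A).
Proof.
move=> PA; apply: negligible_outer_le => e e0.
pose K := 2 * C * 2 `^ s.
have K0 : 0 < K by rewrite !mulr_gt0 ?pow2_gt0.
have : (packing_measure s A < (e / (2 * K))%:E)%E.
  by rewrite PA lte_fin divr_gt0// mulr_gt0.
move=> /ereal_inf_lt[_ [F [AF ->]] small].
have pos i : (0 <= packing_content s (F i))%E by exact: packing_content_ge0.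
have cfin i : packing_content s (F i) = (fine (packing_content s (F i)))%:E.
  rewrite fineK// ge0_fin_numE//.
  apply: (@le_lt_trans _ _ (\sum_(j <oo) packing_content s (F j))%E).
    have := @nneseries_lim_ge R (fun j => packing_content s (F j)) xpredT 0 i.+1
      (fun j _ _ => pos j).
    by apply: le_trans; rewrite big_nat_recr//= leeDr// sume_ge0.
  by apply: (lt_trans small); exact: ltry.
pose r := e / (2 * K); have r0 : 0 < r by rewrite divr_gt0// mulr_gt0.
(* The slack turns the content into a strict upper bound of itself; summed over i it adds at most
   r. *)
pose w i := (K%:E * (packing_content s (F i) + (r / (2 ^ i.+1)%:R)%:E))%E.
have cover i : outer_le (param (F i)) (w i).
  rewrite /w (cfin i) -EFinD -EFinM; apply: packing_content_outer_le.
  by rewrite {1}(cfin i) lte_fin ltrDl divr_gt0// ltr0n expn_gt0.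
apply: outer_leS (outer_le_trans _ (outer_le_bigcup cover)).
  by move=> u [u01 /AF[i _ Fi]]; exists i.
rewrite nneseriesZl; last first.
  by move=> i _; rewrite adde_ge0// lee_fin divr_ge0// ltW.
have := @epsilon_trick R _ r xpredT pos (ltW r0).
have KE : (0 <= K%:E)%E by rewrite lee_fin ltW.
move=> /(lee_wpmul2l KE) /le_trans; apply.
rewrite -lee_pdivlMl// -EFinM.
apply: (@le_trans _ _ (r%:E + r%:E)%E); first by rewrite leeD2r// ltW.
by rewrite -EFinD lee_fin /r; rewrite le_eqVlt; apply/orP; left; apply/eqP; field; rewrite gt_eqF.
Qed.

End inverse_hoelder.
End null_preimages.

Section unit_rationals.
Context {R : realType}.

(** Default value and clamping make every index yield a parameter in [0, 1]; repetitions are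
    harmless, the pieces being indexed by j. *)
Definition unit_rational (n : nat) : R :=
  Num.max 0 (Num.min 1 (ratr (odflt 0 (unpickle n : option rat)))).

Lemma unit_rational_ge0 n : 0 <= unit_rational n.
Proof. by rewrite /unit_rational le_max lexx. Qed.

Lemma unit_rational_le1 n : unit_rational n <= 1.
Proof. by rewrite /unit_rational ge_max ler01 ge_min lexx. Qed.

Lemma unit_rational_dense (a b : R) : 0 <= a -> a < b -> b <= 1 ->
  exists2 j, a < unit_rational j & unit_rational j <= b.
Proof.
move=> a0 ab b1; have [q] := rat_in_itvoo ab; rewrite in_itv/= => /andP[aq qb].
have E : unit_rational (pickle q) = ratr q.
  rewrite /unit_rational pickleK/= min_r ?(le_trans (ltW qb))//.
  by rewrite max_r// (le_trans a0)// ltW.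
by exists (pickle q); rewrite E// ltW.
Qed.

End unit_rationals.

(** * Almost every parameter u gives a point of exponent beta *)

Section peak_points.
Context {R : realType}.
Variable p : R.
Hypothesis p1 : 1 <= p.
Local Notation mu := (@lebesgue_measure R).
Local Notation th := (@unit_rational R).
Local Notation F := (multifractal_series p th).
Local Notation S n x := (Normc.normc (fourier_sum F n x)).

Let p0 : 0 < p. Proof. exact: lt_le_trans p1. Qed.

Variable beta : R.
Hypotheses (b0 : 0 <= beta) (b1 : beta <= p^-1).
Local Notation theta := (beta * p).
Local Notation phi u := (to_torus (peak_point th theta u)).

Let theta0 : 0 <= theta. Proof. by rewrite mulr_ge0// ltW. Qed.
Let theta1 : theta <= 1. Proof. by rewrite -ler_pdivlMr// div1r. Qed.

Lemma stage_of_nat (s0 n : nat) : (2 ^ stage_start s0 <= n)%N ->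
  exists s, [/\ (s0 <= s)%N, (2 ^ stage_start s <= n)%N & (n < 2 ^ stage_start s.+1)%N].
Proof.
move=> s0n; have ub s : (2 ^ stage_start s <= n)%N -> (s <= n)%N.
  by apply: leq_trans; rewrite (leq_trans (stage_start_ge s))// ltnW// ltn_expl.
case: (ex_maxnP (ex_intro _ s0 s0n) ub) => s sn smax; exists s; split => //.
  exact: smax.
by rewrite ltnNge; apply/negP => /smax; rewrite ltnn.
Qed.

Lemma fourier_sum_growth (u gamma : R) : 0 <= u -> gamma < beta ->
  exists N, forall n, (N <= n)%N -> n%:R `^ gamma <= S n (phi u).
Proof.
(* For negative gamma, the only case when beta = 0, the bound 1/2 suffices because n^gamma tends to
   0. *)
move=> u0 gb; have [g0|g0] := ltP gamma 0.
  have g'0 : 0 < - gamma by rewrite oppr_gt0.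
  have h0 : 0 < 1 / 2 :> R by [].
  have [M _] := pow2_decay 1 0 g'0 h0; rewrite mul1r mulrN opprK => hM.
  exists (2 ^ M)%N => n Mn; apply: le_trans (fourier_sum_ge_half th p1 theta0 theta1 u0 n).
  apply: le_trans hM; rewrite powRrM pow2n.
  have M0 : 0 < 2 ^+ M :> R by rewrite exprn_gt0.
  have Mn' : 2 ^+ M <= n%:R :> R by rewrite -natrX ler_nat.
  rewrite -[gamma]opprK !(powRN _ (- gamma)) lef_pV2 ?posrE ?powR_gt0//;
    last exact: lt_le_trans Mn'.
  by apply: ge0_ler_powR; rewrite ?nnegrE ?(ltW g'0) ?(ltW M0)// (le_trans (ltW M0)).
have gt : gamma * p < theta by rewrite ltr_pM2r.
have [j gj jt] := unit_rational_dense (mulr_ge0 g0 (ltW p0)) gt theta1.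
(* Of the 6 s, five pay for the loss in [gain_ge] and the sixth outgrows the constants D +
   stage_start j + 7. *)
have [D hD] := stage_start_asymp 6 g0 (b := th j / p) ltac:(by rewrite ltr_pdivlMr).
pose s0 := maxn j.+1 (Num.truncn (D + (stage_start j)%:R + 7)).+1.
exists (2 ^ stage_start s0)%N => n /stage_of_nat[s [s0s sn ns]].
move: s0s; rewrite geq_max => /andP[js Ds].
apply: le_trans (fourier_sum_ge_gain th p1 theta0 theta1 u0 n js).
apply: le_trans (gain_ge p1 unit_rational_ge0 unit_rational_le1 jt sn).
apply: (@le_trans _ _ ((2 ^+ stage_start s.+1) `^ gamma)).
  apply: ge0_ler_powR => //; rewrite ?nnegrE ?exprn_ge0//.
  by rewrite -natrX ler_nat ltnW.
rewrite -pow2n -powRrM ler_pow2//.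
have : D + (stage_start j)%:R + 7 <= s%:R.
  by rewrite ltW// (lt_le_trans (truncnS_gt _))// ler_nat.
by have := hD s; lra.
Qed.

Lemma peak_point_hoelder (s : R) : 0 <= s -> s < 1 - theta ->
  exists2 C : R, 0 < C & forall u v : R, 0 <= u < 1 -> 0 <= v < 1 ->
    `|u - v| <= C * mdist (phi u) (phi v) `^ s.
Proof.
move=> s0 s1; have [C C0 hC] := point_hoelder theta0 theta1 (inactive th theta) s0 s1.
exists C => // u v u01 v01; apply: le_trans (hC u v u01 v01) _.
rewrite ler_wpM2l ?(ltW C0)//.
have -> // : mdist (phi u) (phi v) = dist_int (peak_point th theta u - peak_point th theta v).
rewrite /mdist/= /torus_dist.
have [k ->] := repr_to_torus (peak_point th theta u).
have [l ->] := repr_to_torus (peak_point th theta v).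
rewrite opprD addrACA -mulrNz -intrD.
exact: dist_intDz.
Qed.

Lemma negligible_often_large gamma : theta < 1 -> beta < gamma ->
  mu.-negligible (param (fun u => phi u) (often_large F gamma)).
Proof.
move=> t1 bg; have gt : theta < gamma * p by rewrite ltr_pM2r.
(* An order s above 1 - gamma p, where the Hausdorff measure vanishes, and below 1 - theta, where u
   is still a Hoelder function of the point; the maximum with 0 is for gamma p > 1. *)
pose m := Num.max 0 (1 - gamma * p); pose s := (m + (1 - theta)) / 2.
have m0 : 0 <= m by rewrite /m le_max lexx.
have mg : 1 - gamma * p <= m by rewrite /m le_max lexx orbT.
have mt : m < 1 - theta by rewrite /m gt_max; apply/andP; split; lra.
have s0 : 0 <= s by rewrite /s; lra.
have [C C0 hC] := @peak_point_hoelder s s0 ltac:(by rewrite /s; lra).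
apply: (negligible_of_hausdorff s0 C0 hC).
apply: (hausdorff_measure_often_large p1 (multifractal_series_Lp th p1) s0).
by rewrite /s; lra.
Qed.

Lemma peak_point_E_FS u : 0 <= u ->
  (forall m : nat, ~ often_large F (beta + m.+1%:R^-1) (phi u)) -> E_FS beta F (phi u).
Proof.
move=> u0 rare.
have lb : (beta%:E <= beta_plus F (phi u))%E.
  by apply: le_beta_plus => gamma; exact: fourier_sum_growth.
have ub : (beta_minus F (phi u) <= beta%:E)%E.
  apply: beta_minus_le => gamma bg; have d0 : 0 < gamma - beta by rewrite subr_gt0.
  have := rare (Num.truncn (gamma - beta)^-1) => /existsNP[N hN].
  exists (maxn 1 N) => n; rewrite geq_max => /andP[n1 Nn].
  rewrite ltNge; apply/negP => ngamma; apply: hN; exists n => //.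
  apply: le_trans ngamma; apply: ler_powR; first by rewrite ler1n.
  rewrite -lerBrDl -[leRHS]invrK lef_pV2 ?posrE ?invr_gt0//.
  by rewrite ltW// truncnS_gt.
have pm := limn_einf_sup (log_ratio F (phi u)).
split; apply/eqP; rewrite eq_le.
- by rewrite lb andbT (le_trans pm).
- by rewrite ub (le_trans lb).
Qed.

(** Outside this set, some gamma = beta + 1 / (m + 1) is reached infinitely often: a countable union
    of null sets, which together with a null set could not fill [0, 1). *)
Lemma E_FS_not_negligible : theta < 1 ->
  ~ mu.-negligible (param (fun u => phi u) (E_FS beta F)).
Proof.
move=> t1 negE.
have : mu.-negligible (`[0, 1[%classic : set R).
  have above m : beta < beta + m.+1%:R^-1 by rewrite ltrDl invr_gt0.
  apply: negligibleS (negligibleU negE (negligible_bigcup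
    (fun m => negligible_often_large t1 (above m)))).
  move=> u /=; rewrite in_itv/= => u01.
  have u0 : 0 <= u by case/andP: u01.
  have [rare|] := pselect (forall m : nat, ~ often_large F (beta + m.+1%:R^-1) (phi u)).
    by left; split => //; exact: peak_point_E_FS.
  by move=> /existsNP[m /contrapT ol]; right; exists m.
move=> [B [mB B0 IB]].
have : (mu `[0%R, 1%R[%classic <= mu B)%E by apply: le_measure; rewrite ?inE.
by rewrite B0 lebesgue_measure_itv/= lte_fin ltr01 EFinN oppe0 adde0 lee_fin ler10.
Qed.

Lemma hausdorff_dim_E_FS_ge : ((1 - theta)%:E <= hausdorff_dim (E_FS beta F))%E.
Proof.
(* From 0 <= s < 1 - theta follows theta < 1; for theta = 1 the bound is trivial. *)
apply: le_dim_of_measure0 => s s0 E0; rewrite leNgt; apply/negP => s1.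
have [C C0 hC] := peak_point_hoelder s0 s1.
apply: E_FS_not_negligible; first by lra.
exact: (negligible_of_hausdorff s0 C0 hC).
Qed.

Lemma packing_dim_E_FS_ge : ((1 - theta)%:E <= packing_dim (E_FS beta F))%E.
Proof.
apply: le_dim_of_measure0 => s s0 E0; rewrite leNgt; apply/negP => s1.
have [C C0 hC] := peak_point_hoelder s0 s1.
apply: E_FS_not_negligible; first by lra.
exact: (negligible_of_packing s0 C0 hC).
Qed.

End peak_points.

Theorem theorem1p1 (R : realType) (p : R) (hp : 1 <= p) :
  (forall f : torus R -> R[i], Lp p f ->
    forall beta : R, 0 <= beta <= p^-1 ->
      (packing_dim (calE_plus beta f) <= (1 - beta * p)%:E)%E)
  /\
  (exists f : torus R -> R[i],
    [/\ Lp p f,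
        forall beta : R, 0 <= beta <= p^-1 ->
          hausdorff_dim (E_FS beta f) = (1 - beta * p)%:E /\
          packing_dim (E_FS beta f) = (1 - beta * p)%:E &
        forall beta : R, 0 <= beta <= p^-1 ->
          packing_dim (E_plus beta f) = (1 - beta * p)%:E]).
Proof.
have le1 (beta : R) : beta <= p^-1 -> beta * p <= 1.
  by move=> b1; rewrite -ler_pdivlMr ?div1r// (lt_le_trans ltr01).
split=> [f fp beta /andP[_ /le1]|]; first exact: packing_dim_calE_plus_le.
have Fp := multifractal_series_Lp (@unit_rational R) hp.
have E_FS_sub (f : torus R -> R[i]) beta : E_FS beta f `<=` E_plus beta f by move=> x [].
have E_plus_sub (f : torus R -> R[i]) beta : E_plus beta f `<=` calE_plus beta f.
  by move=> x E; rewrite /calE_plus/= E.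
exists (multifractal_series p (@unit_rational R)); split => // beta /andP[b0 b1].
- split; apply/eqP; rewrite eq_le.
  + by rewrite hausdorff_dim_E_FS_le ?le1//= hausdorff_dim_E_FS_ge.
  + rewrite packing_dim_E_FS_ge// andbT.
    apply: le_trans (packing_dim_calE_plus_le hp Fp (le1 _ b1)).
    by apply: packing_dimS; exact: subset_trans (E_plus_sub _ _).
- apply/eqP; rewrite eq_le; apply/andP; split.
    exact: le_trans (packing_dimS (E_plus_sub _ _)) (packing_dim_calE_plus_le hp Fp (le1 _ b1)).
  exact: le_trans (packing_dim_E_FS_ge hp b0 b1) (packing_dimS (E_FS_sub _ _)).
Qed.
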